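(* There exist numerical constants $c_1,c_2,C_1>0$ such that the following holds. Let $\Sigma\in\mathbb{R}^{n\times n}$ be positive definite with positive definite square root $\sqrt\Sigma$, let $x_0\in\mathbb{R}^n$ with $\|\sqrt\Sigma x_0\|_2=1$, let $a_1,\dots,a_m\sim\mathcal N(0,\Sigma)$ be independent, let $y_i=f(\langle a_i,x_0\rangle)\in\mathcal Y$, $i=1,\dots,m$, be the ideal observations and $\tilde y\in\mathcal Y^m$ the actual observations, with adversarial noise parameter $\varepsilon=\big(\frac1m\sum_{i=1}^m|\tilde y_i-y_i|^2\big)^{1/2}$. Let $\mathcal L\colon\mathbb{R}\times\mathcal Y\to\mathbb{R}$ be convex and twice continuously differentiable in the first variable (derivatives $\mathcal L',\mathcal L''$), with $\mathcal L'$ Lipschitz continuous in the second variable (uniformly in the first). Let $\mu,\sigma,\eta$ be the associated model parameters, and let $K\subset\mathbb{R}^n$ be a convex set with $\mu x_0\in K$. Let $t>0$ be any error accuracy, and assume that there are fixed numbers $0<M,N\le\infty$ with $M\ge\max\{32t,\,c_1|\mu|\}$ and $N\ge c_2\,\mathbb{E}[|f(g)|]+\|y-\tilde y\|_\infty$, where $g\sim\mathcal N(0,1)$, and a constant $C_{M,N}>0$ with $$\mathcal L''(v,y)\ge C_{M,N}\quad\text{for all }(v,y)\in(-M,M)\times\big((-N,N)\cap\mathcal Y\big).$$ Then there exists a constant $C_2>0$, which might depend on the probability of success and on $C_{M,N}$, such that the following holds: if $$m\ge C_1\cdot d_t\big(\sqrt\Sigma(K-\mu x_0)\big)$$ and $$t>C_2\cdot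 t_0:=C_2\cdot\Big(\frac{\sigma\cdot\sqrt{d_t(\sqrt\Sigma(K-\mu x_0))}+\eta}{\sqrt m}+\varepsilon\Big),$$ then any minimizer $\hat x$ of $$\min_{x\in\mathbb{R}^n}\ \frac1m\sum_{i=1}^m\mathcal L(\langle a_i,x\rangle,\tilde y_i)\quad\text{subject to }x\in K$$ satisfies $\|\sqrt\Sigma(\hat x-\mu x_0)\|_2\le t$ with high probability.
   Context: A numerical constant is one whose value is independent of all other parameters of the setup. ''With high probability'' means that the event occurs with at least a fixed (and high) probability of success, for instance 99%. Observation model: $\mathcal Y\subset\mathbb{R}$ is closed and $f\colon\mathbb{R}\to\mathcal Y$ is a (possibly random) function independent of the $a_i$; the randomness of $f$ is understood measurement-wise, i.e. for each $i$ an independent copy of $f$ is used in $y_i=f(\langle a_i,x_0\rangle)$. The vector $\tilde y=(\tilde y_1,\dots,\tilde y_m)\in\mathcal Y^m$ could differ from $y=(y_1,\dots,y_m)$; the mismatch may be deterministic or depend on the $a_i$. Lipschitz assumption: there is $C_{\mathcal L'}>0$ with $|\mathcal L'(v,y)-\mathcal L'(v,\tilde y)|\le C_{\mathcal L'}|y-\tilde y|$ for all $v\in\mathbb{R}$, $y,\tilde y\in\mathcal Y$. Model parameters: with $g\sim\mathcal N(0,1)$, $\mu\in\mathbb{R}$ is the solution of $0=\mathbb{E}[\mathcal L'(\mu g,f(g))\cdot g]$ (the solvability of this equation is postulated), $\sigma^2:=\mathbb{E}[\mathcal L'(\mu g,f(g))^2]$ and $\eta^2:=\mathbb{E}[\mathcal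 L'(\mu g,f(g))^2\cdot g^2]$, $\sigma,\eta\ge0$. Local effective dimension: for $L\subset\mathbb{R}^n$ and $t>0$, $w_t(L):=\mathbb{E}[\sup_{x\in L\cap tB_2^n}\langle g,x\rangle]$ with $g\sim\mathcal N(0,I_n)$ and $B_2^n$ the Euclidean unit ball, and $d_t(L):=w_t(L)^2/t^2$.
   Formalization: C_2 may also depend on the Lipschitz constant C_{L'} of L' in its second variable (without this the claim fails, e.g. for L(v,y)=(v-Ay)^2/2, f(s)=s/A, A large), and C_1 is numerical only once the success probability is fixed. *)

(* Defs.v *)
From HB Require Import structures.
From mathcomp Require Import all_boot all_order all_algebra.
From mathcomp Require Import all_classical all_reals all_analysis.

Set Implicit Arguments.
Unset Strict Implicit.
Unset Printing Implicit Defensive.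

Import Order.TTheory GRing.Theory Num.Theory.
Import numFieldNormedType.Exports.

Local Open Scope classical_set_scope.
Local Open Scope ring_scope.

Section Euclidean.
Context {R : realType} {n : nat}.

Definition dot (u v : 'cV[R]_n) : R := \sum_i u i 0 * v i 0.

(* The library norm on matrices is the sup norm, hence this Euclidean one. *)
Definition norm2 (u : 'cV[R]_n) : R := Num.sqrt (dot u u).

Definition posdef (A : 'M[R]_n) : Prop :=
  A^T = A /\ forall u : 'cV[R]_n, u != 0 -> 0 < dot u (A *m u).

(* Random vectors of R^n take values in [n.-tuple R], which the library equips
   with the product sigma-algebra. *)
Definition vec (x : n.-tuple R) : 'cV[R]_n := \col_i tnth x i.

Definition unvec (u : 'cV[R]_n) : n.-tuple R := [tuple u i 0 | i < n].

End Euclidean.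

Definition std_normal1 (R : realType) : probability (measurableTypeR R) R :=
  normal_prob (0 : R) 1.

Section Gaussian.
Context {R : realType}.

Definition tcons n (z : measurableTypeR R * n.-tuple (measurableTypeR R)) :
  n.+1.-tuple (measurableTypeR R) := [tuple of z.1 :: z.2].

Lemma measurable_tcons n : measurable_fun setT (@tcons n).
Proof. exact: measurable_cons. Qed.

HB.instance Definition _ n :=
  @isMeasurableFun.Build _ _ _ _ (@tcons n) (@measurable_tcons n).

(* N(0, I_n) as the n-fold product of N(0, 1) *)
Fixpoint std_normal n : probability (n.-tuple (measurableTypeR R)) R :=
  match n with
  | 0%N => \d_[tuple]
  | n'.+1 => distribution (std_normal1 R \x std_normal n')%E (@tcons n')
  end.

(* X ~ N(0, Sigma): X has the law of A g with A A^T = Sigma and g ~ N(0, I_n) *)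
Definition is_centered_normal n d (Omega : measurableType d)
    (P : probability Omega R) (X : {RV P >-> n.-tuple (measurableTypeR R)})
    (Sigma : 'M[R]_n) : Prop :=
  exists A : 'M[R]_n, A *m A^T = Sigma /\
    forall B : set (n.-tuple (measurableTypeR R)), measurable B ->
      P (X @^-1` B) = std_normal n [set g | B (unvec (A *m vec g))].

(* w_t(L) = E sup_(x in L, |x| <= t) <g, x>.  The integral is finite, and [fine]
   harmless, as soon as L meets the ball of radius t. *)
Definition local_width n (L : set 'cV[R]_n) (t : R) : R :=
  fine (\int[std_normal n]_g
    ereal_sup [set (dot (vec g) x)%:E | x in L `&` [set x | (norm2 x <= t)%R]])%E.

Definition local_dim n (L : set 'cV[R]_n) (t : R) : R :=
  local_width L t ^+ 2 / t ^+ 2.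

End Gaussian.

(* Mutual independence of the 2m random elements a_1, .., a_m, xi_1, .., xi_m;
   subfamilies are covered by taking some of the sets to be setT. *)
Definition samples_independent (R : realType) d (Omega : measurableType d)
    (P : probability Omega R) dA (TA : measurableType dA)
    dX (TX : measurableType dX) m
    (a : 'I_m -> {RV P >-> TA}) (xi : 'I_m -> {RV P >-> TX}) : Prop :=
  forall (A : 'I_m -> set TA) (B : 'I_m -> set TX),
    (forall i, measurable (A i)) -> (forall i, measurable (B i)) ->
    P [set w | forall i, A i (a i w) /\ B i (xi i w)] =
    (\prod_(i < m) (P (a i @^-1` A i) * P (xi i @^-1` B i)))%E.

Section Loss.
Context {R : realType}.
Implicit Types (Y : set R) (L : R -> R -> R).

Definition loss1 L (v y : R) : R := derive1 (fun u => L u y) v.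

Definition loss2 L (v y : R) : R := derive1n 2 (fun u => L u y) v.

Definition convex_C2_loss Y L : Prop :=
  forall y, Y y ->
    [/\ convex_function [set: R^o] (fun v : R^o => L v y : R^o),
        forall v, derivable (fun u => L u y) v 1,
        forall v, derivable (loss1 L ^~ y) v 1 &
        continuous (loss2 L ^~ y)].

Definition loss1_lipschitz Y L (C : R) : Prop :=
  forall v y y', Y y -> Y y' -> `|loss1 L v y - loss1 L v y'| <= C * `|y - y'|.

(* A random function is f s for a random seed s of law Q.  Expectations in
   g ~ N(0, 1) and f are taken over pairs z = (g, seed).  The value 0 of the
   first expectation entails integrability: an integral whose positive or
   negative part is infinite is itself infinite. *)
Definition is_model_param d (S : measurableType d) (Q : probability S R)
    (f : S -> R -> R) L (mu sigma eta : R) : Prop :=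
  let L'gf (z : measurableTypeR R * S) := loss1 L (mu * z.1) (f z.2 z.1) in
  [/\ 'E_(std_normal1 R \x Q)[fun z => (L'gf z * z.1)%R] = 0,
      (0 <= sigma)%R,
      (sigma ^+ 2)%:E = 'E_(std_normal1 R \x Q)[fun z => (L'gf z ^+ 2)%R],
      (0 <= eta)%R &
      (eta ^+ 2)%:E =
        'E_(std_normal1 R \x Q)[fun z => (L'gf z ^+ 2 * z.1 ^+ 2)%R]]%E.

Definition mean_abs_output d (S : measurableType d) (Q : probability S R)
    (f : S -> R -> R) : \bar R :=
  'E_(std_normal1 R \x Q)[fun z : measurableTypeR R * S => `|f z.2 z.1|%R]%E.

Definition strongly_convex_near0 Y L (M N : \bar R) (C : R) : Prop :=
  forall v y, (- M < v%:E < M)%E -> Y y -> (- N < y%:E < N)%E ->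
    C <= loss2 L v y.

Definition noise_level m (y y' : 'I_m -> R) : R :=
  Num.sqrt (m%:R^-1 * \sum_i `|y' i - y i| ^+ 2).

Definition noise_max m (y y' : 'I_m -> R) : R :=
  \big[Num.max/0]_(i < m) `|y i - y' i|.

Definition is_empirical_minimizer m n L (K : set 'cV[R]_n)
    (a : 'I_m -> 'cV[R]_n) (y : 'I_m -> R) (xhat : 'cV[R]_n) : Prop :=
  let risk x := m%:R^-1 * \sum_i L (dot (a i) x) (y i) in
  K xhat /\ forall x, K x -> risk xhat <= risk x.

End Loss.

(* Main.v *)
(** The idea.  Let G be orthogonal with G (sqrtSigma x0) the first axis, and put
    z_i = G sqrtSigma^-1 a_i.  The pairs (z_i, xi_i) are i.i.d. with z_i standard
    normal, and y_i depends only on xi_i and the first coordinate s_i of z_i.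
    By convexity, a minimizer at distance more than t provides a vector
    h = G sqrtSigma (x - mu x0) of norm exactly t, with x in K, at which the
    empirical risk is not larger than at mu x0.  Expanding the loss at mu s_i and
    using its curvature at the ideal observation y_i, m times the increment of the
    risk is at least
      sum_i L'(mu s_i, y_i) <z_i, h> + (C/2) sum_i b_i min(|<z_i, h>|, t)^2
        - CL sum_i |ytilde_i - y_i| |<z_i, h>|,
    where b_i = 1 if |s_i| <= B and |y_i| < N, and b_i = 0 otherwise.  Uniformly
    in h, with high probability:
    - the linear term is small: its part along the first axis is centered by the
      choice of mu and has variance of order m eta^2, and in the other directions
      the L'(mu s_i, y_i) are independent multipliers of Gaussian vectors, so that
      the supremum over h is of order sqrt m sigma times the width;
    - sum_i <z_i, h>^2 <= Lam m t^2: exp (l^2 |Z h|^2 / 2) is a Gaussian average of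
      exp (l <Z^T gamma, h>), and the maximum of a Gaussian process concentrates;
    - sum_i b_i min(|<z_i, h>|, t) >= c m t, by symmetrization and contraction,
      carried out one sample at a time.
    All suprema are taken over finite sets of h, and extended by density. *)

(* The noise may depend on the whole sample, so only functions of the ideal pairs [(s_i, xi_i)] may
   serve as multipliers or weights: these are i.i.d. and independent of the other coordinates of
   [z_i]. The noise then enters only through the products [|ytilde_i - y_i| |<z_i, h>|], each split
   by the weighted inequality of arithmetic and geometric means with weight [C2]. This is why an
   upper bound on the quadratic form is required, and why any constant [Lam] does: [C2] is chosen
   after it. With [k] the mean of [min(|g|, 1)], a direction of norm [t] has clipped mean [k t]. The
   constants [c1 = 4 B] and [c2 = 4 / k] come from Markov's inequality: each of [|s_i| > B] and
   [|y_i| >= N] has probability at most [k / 4], so discarding these samples costs at most half of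
   [k t]. No random signs are needed in the symmetrization: the samples are themselves symmetric
   Gaussian vectors, and exchanging one sample for [2 g] lets stability of the normal law merge it
   with those exchanged before. A supremum over uncountably many [h] need not be measurable, whence
   the finite sets. *)
From HB Require Import structures.
Require Import Defs.
From mathcomp Require Import all_boot all_order all_algebra.
From mathcomp Require Import all_classical all_reals all_analysis.
From mathcomp Require Import measurable_realfun.
From mathcomp Require Import ring lra.

Set Implicit Arguments.
Unset Strict Implicit.
Unset Printing Implicit Defensive.

Import Order.TTheory GRing.Theory Num.Theory.
Import numFieldNormedType.Exports.

Local Open Scope classical_set_scope.
Local Open Scope ring_scope.

(** * Integration against Gaussian measures *)

Section Integrals.
Local Open Scope ereal_scope.
Context d (T : measurableType d) (R : realType).
Variable mu : {measure set T -> \bar R}.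

(* Unlike the library's [ge0_le_integral], no measurability is required. *)
Lemma le_ge0_integral (f g : T -> \bar R) :
  (forall x, 0 <= f x) -> (forall x, f x <= g x) ->
  \int[mu]_x f x <= \int[mu]_x g x.
Proof.
move=> f0 fg.
rewrite !ge0_integralTE//; last by move=> x; apply: le_trans (fg x).
apply: ub_ereal_sup => _ [h hf <-].
by apply: ereal_sup_ubound; exists h => // x; apply: le_trans (fg x).
Qed.

Lemma integral_cst_prob (P : probability T R) (k : \bar R) :
  \int[P]_x k = k.
Proof.
have PT : P setT = 1 by exact: probability_setT.
transitivity (k * P setT); last by rewrite PT mule1.
by rewrite integral_cst.
Qed.

End Integrals.

Section LebesgueTranslation.
Context {R : realType}.
Local Open Scope ereal_scope.
Notation leb := (@lebesgue_measure R).

Lemma lebesgue_measure_translate (a : R) (A : set R) : measurable A ->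
  pushforward leb (fun x : measurableTypeR R => (x + a)%R : measurableTypeR R) A = leb A.
Proof.
move=> mA; apply/esym/lebesgue_measure_unique => //=; first exact: measurable_funD.
move=> ? _ [[x y]] _ <-; rewrite /pushforward.
have -> : ((fun x => x + a)%R @^-1` `]x, y]%classic = `](x - a)%R, (y - a)%R]%classic)%classic.
  by apply/seteqP; split => z /=; rewrite !in_itv/= => /andP[? ?]; apply/andP; split; lra.
rewrite !lebesgue_measure_itv/= !lte_fin ltrD2r.
by case: ifP => // _; rewrite -!EFinB; congr EFin; ring.
Qed.

Lemma ge0_integral_translate (a : R) (f : measurableTypeR R -> \bar R) :
  measurable_fun setT f -> (forall x, 0 <= f x) ->
  \int[leb]_x f (x + a)%R = \int[leb]_x f x.
Proof.
move=> mf f0.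
have ma : measurable_fun setT (fun x : measurableTypeR R => (x + a)%R : measurableTypeR R).
  exact: measurable_funD.
rewrite -[LHS](@ge0_integral_pushforward _ _ _ _ R _ ma leb setT f)//.
by apply: eq_measure_integral => //= A mA _; exact: lebesgue_measure_translate.
Qed.

End LebesgueTranslation.

Section NormalDensity.
Context {R : realType}.
Local Open Scope ereal_scope.
Notation leb := (@lebesgue_measure R).

Import HBNNSimple.

(** [normal_prob] is given by its density on sets only; simple functions and monotone convergence
    carry this to nonnegative integrands. *)
Lemma ge0_integral_normal_prob (m s : R) (f : measurableTypeR R -> \bar R) :
  measurable_fun setT f -> (forall x, 0 <= f x) ->
  \int[normal_prob m s]_x f x = \int[leb]_x (f x * (normal_pdf m s x)%:E).
Proof.
have mpdf : measurable_fun setT (fun x : measurableTypeR R => (normal_pdf m s x)%:E).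
  by apply/measurable_EFinP; exact: measurable_normal_pdf.
have pdf0 x : 0 <= (normal_pdf m s x)%:E by rewrite lee_fin normal_pdf_ge0.
have step (h : {nnsfun measurableTypeR R >-> R}) :
    \int[normal_prob m s]_x (h x)%:E = \int[leb]_x ((h x)%:E * (normal_pdf m s x)%:E).
  under [LHS]eq_integral do rewrite fimfunE -fsumEFin//.
  rewrite ge0_integral_fsum//; last 2 first.
  - by move=> r; apply/measurable_EFinP; apply: measurableT_comp.
  - by move=> n x _; rewrite nnfun_muleindic_ge0.
  under [RHS]eq_integral => x _.
    rewrite fimfunE -fsumEFin// ge0_mule_fsuml; last by move=> r; rewrite nnfun_muleindic_ge0.
    over.
  rewrite /= ge0_integral_fsum//; last 2 first.
  - move=> r; apply: emeasurable_funM => //.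
    by apply/measurable_EFinP; apply: measurableT_comp.
  - by move=> n x _; rewrite mule_ge0// nnfun_muleindic_ge0.
  apply: eq_fsbigr => r _.
  under [RHS]eq_integral => x _ do rewrite EFinM -muleA.
  (* For negative [r] the fibre of [h] over [r] is empty, and both sides vanish. *)
  have [r0|r0] := leP 0%R r.
    rewrite integralZl_indic_nnsfun// integral_indic// setIT.
    rewrite ge0_integralZl//; last first.
    - by move=> x _; rewrite mule_ge0// lee_fin.
    - by apply: emeasurable_funM => //; apply/measurable_EFinP.
    congr (_ * _); rewrite [LHS]/= /normal_prob [LHS]integral_mkcond.
    apply: eq_integral => x _; rewrite patchE indicE.
    by case: ifP => _; rewrite ?mul1e ?mul0e.
  rewrite preimage_nnfun0//.
  rewrite [RHS]integral0_eq; last first.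
    by move=> x _; rewrite indicE in_set0 mulr0n mul0e mule0.
  by rewrite integral0_eq// => x _; rewrite indicE in_set0 mulr0n mulr0.
move=> mf f0.
pose f_ := nnsfun_approx measurableT mf.
transitivity (lim (\int[normal_prob m s]_x (f_ n x)%:E @[n --> \oo])%E).
  rewrite -monotone_convergence//=.
  - apply: eq_integral => ? /[!inE] xD; apply/esym/cvg_lim => //=.
    exact: cvg_nnsfun_approx.
  - by move=> n; exact/measurable_EFinP/measurable_funTS.
  - by move=> n ? _; rewrite lee_fin.
  - by move=> ? _ ? ? mn; rewrite lee_fin; exact/lefP/nd_nnsfun_approx.
rewrite [RHS](_ : _ = lim
    (\int[leb]_x ((f_ n x)%:E * (normal_pdf m s x)%:E) @[n --> \oo])%E); last first.
  rewrite -monotone_convergence//=.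
  - apply: eq_integral => x _; apply/esym/cvg_lim => //.
    apply: cvgeZr => //.
    exact: cvg_nnsfun_approx.
  - move=> n; apply: emeasurable_funM => //.
    exact/measurable_EFinP/measurable_funTS.
  - by move=> n ? _; rewrite mule_ge0// lee_fin.
  - move=> x _ ? ? mn; apply: lee_wpmul2r => //.
    by rewrite lee_fin; exact/lefP/nd_nnsfun_approx.
by apply: congr_lim; apply/funext => n /=; exact: step.
Qed.

End NormalDensity.

Section Tonelli.
Local Open Scope ereal_scope.
Context d1 d2 (T1 : measurableType d1) (T2 : measurableType d2) (R : realType).
Variables (m1 : {sigma_finite_measure set T1 -> \bar R})
  (m2 : {sigma_finite_measure set T2 -> \bar R}).

Lemma tonelli (f : T1 -> T2 -> \bar R) :
  measurable_fun setT (fun z => f z.1 z.2) -> (forall x y, 0 <= f x y) ->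
  \int[m1]_x \int[m2]_y f x y = \int[m2]_y \int[m1]_x f x y.
Proof.
move=> mf f0; have := @fubini_tonelli _ _ _ _ _ m1 m2 _ mf.
by apply => -[x y] /=.
Qed.

Lemma measurable_integral_snd (f : T1 -> T2 -> \bar R) :
  measurable_fun setT (fun z => f z.1 z.2) -> (forall x y, 0 <= f x y) ->
  measurable_fun setT (fun x => \int[m2]_y f x y).
Proof.
move=> mf f0.
have := @measurable_fun_fubini_tonelli_F _ _ _ _ _ m2 (fun z => f z.1 z.2) mf.
by apply.
Qed.

Lemma ge0_integral_prod (f : T1 * T2 -> \bar R) :
  measurable_fun setT f -> (forall z, 0 <= f z) ->
  \int[m1 \x m2]_z f z = \int[m1]_x \int[m2]_y f (x, y).
Proof. by move=> mf f0; rewrite fubini_tonelli1. Qed.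

End Tonelli.

Lemma measurable_fun2 d d1 d2 d3 (T : measurableType d) (T1 : measurableType d1)
    (T2 : measurableType d2) (T3 : measurableType d3) (f : T1 -> T2 -> T3)
    (u : T -> T1) (v : T -> T2) :
  measurable_fun setT (fun z => f z.1 z.2) ->
  measurable_fun setT u -> measurable_fun setT v ->
  measurable_fun setT (fun t => f (u t) (v t)).
Proof.
move=> mf mu mv.
apply: (@measurableT_comp _ _ _ _ _ _ (fun z => f z.1 z.2) _ (fun t => (u t, v t))) => //.
exact: measurable_fun_pair.
Qed.

Section PlaneRotation.
Context {R : realType}.
Local Open Scope ereal_scope.
Notation leb := (@lebesgue_measure R).
Notation RR := (measurableTypeR R).
Notation gam := (std_normal1 R).

(** Integrating in [x] first turns the shear into a translation by [a * y]. *)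
Lemma lebesgue_shear1 (f : RR -> RR -> \bar R) (a : R) :
  measurable_fun setT (fun z => f z.1 z.2) -> (forall x y, 0 <= f x y) ->
  \int[leb]_x \int[leb]_y f (x + a * y)%R y = \int[leb]_x \int[leb]_y f x y.
Proof.
move=> mf f0; pose f1 x y := f (x + a * y)%R y.
have mf1 : measurable_fun setT (fun z => f1 z.1 z.2).
  apply: measurable_fun2 mf _ _ => //.
  by apply: measurable_funD => //; apply: measurable_funM.
rewrite (tonelli leb leb mf f0) (tonelli leb leb mf1); last by move=> ? ?; exact: f0.
apply: eq_integral => y _.
rewrite (ge0_integral_translate (a * y) (f := fun x : RR => f x y))//.
by apply: measurable_fun2 mf _ _.
Qed.

Lemma lebesgue_shear2 (f : RR -> RR -> \bar R) (a : R) :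
  measurable_fun setT (fun z => f z.1 z.2) -> (forall x y, 0 <= f x y) ->
  \int[leb]_x \int[leb]_y f x (y + a * x)%R = \int[leb]_x \int[leb]_y f x y.
Proof.
move=> mf f0; apply: eq_integral => x _.
rewrite (ge0_integral_translate (a * x) (f := fun y : RR => f x y))//.
by apply: measurable_fun2 mf _ _.
Qed.

(* A rotation by an angle other than pi is a product of three shears. *)
Lemma lebesgue_rotation (f : RR -> RR -> \bar R) (c s : R) :
  (c != -1)%R -> (c ^+ 2 + s ^+ 2 = 1)%R ->
  measurable_fun setT (fun z => f z.1 z.2) -> (forall x y, 0 <= f x y) ->
  \int[leb]_x \int[leb]_y f (c * x + s * y)%R (- s * x + c * y)%R =
  \int[leb]_x \int[leb]_y f x y.
Proof.
(* The tangent of half the angle; it is infinite at the angle pi, the excluded case [c = -1]. *)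
move=> c1 cs mf f0; pose a := (s / (1 + c))%R.
have c10 : (1 + c != 0)%R by rewrite addrC addr_eq0.
have E1 : (1 - s * a = c)%R.
  rewrite /a; apply: (mulIf c10); rewrite mulrBl mulrA divfK//; lra.
have E2 : (a + a * c = s)%R by rewrite /a; field.
pose f1 x y := f (x + a * y)%R y; pose f2 x y := f1 x (y + - s * x)%R.
have mf1 : measurable_fun setT (fun z => f1 z.1 z.2).
  apply: measurable_fun2 mf _ _ => //.
  by apply: measurable_funD => //; apply: measurable_funM.
have mf2 : measurable_fun setT (fun z => f2 z.1 z.2).
  apply: measurable_fun2 mf1 _ _ => //.
  by apply: measurable_funD => //; apply: measurable_funM.
transitivity (\int[leb]_x \int[leb]_y f2 (x + a * y)%R y); last first.
  rewrite (lebesgue_shear1 a mf2); last by move=> ? ?; exact: f0.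
  rewrite (lebesgue_shear2 (f := f1) (- s)%R mf1); last by move=> ? ?; exact: f0.
  exact: (lebesgue_shear1 a mf).
rewrite /f2 /f1.
apply: eq_integral => x _; apply: eq_integral => y _.
have -> : (y + - s * (x + a * y) = - s * x + c * y)%R by rewrite -E1; ring.
have -> : (x + a * y + a * (- s * x + c * y) = (1 - s * a) * x + (a + a * c) * y)%R.
  by ring.
by rewrite E1 E2.
Qed.

(** The joint density depends on [x ^+ 2 + y ^+ 2] only, so it is unchanged by the rotation, as is
    Lebesgue measure. *)
Lemma std_normal1_rotation (f : RR -> RR -> \bar R) (c s : R) :
  (c ^+ 2 + s ^+ 2 = 1)%R ->
  measurable_fun setT (fun z => f z.1 z.2) -> (forall x y, 0 <= f x y) ->
  \int[gam]_x \int[gam]_y f (c * x + s * y)%R (- s * x + c * y)%R =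
  \int[gam]_x \int[gam]_y f x y.
Proof.
pose p x := normal_pdf (0 : R) 1 x.
have p0 x : (0 <= p x)%R by exact: normal_pdf_ge0.
have mp : measurable_fun setT (p : RR -> R) by exact: measurable_normal_pdf.
have toleb (g : RR -> RR -> \bar R) : measurable_fun setT (fun z => g z.1 z.2) ->
    (forall x y, 0 <= g x y) ->
    \int[gam]_x \int[gam]_y g x y =
    \int[leb]_x \int[leb]_y (g x y * (p x * p y)%:E).
  move=> mg g0; rewrite ge0_integral_normal_prob//; last 2 first.
  - exact: measurable_integral_snd.
  - by move=> x; exact: integral_ge0.
  apply: eq_integral => x _; rewrite ge0_integral_normal_prob//; last first.
    by apply: measurable_fun2 mg _ _.
  rewrite -ge0_integralZr//; last 3 first.
  - apply: emeasurable_funM; last exact/measurable_EFinP.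
    by apply: measurable_fun2 mg _ _.
  - by move=> y _; rewrite mule_ge0// lee_fin.
  - by rewrite lee_fin.
  by apply: eq_integral => y _; rewrite -muleA -EFinM [(p y * p x)%R]mulrC.
have main (c' s' : R) (g : RR -> RR -> \bar R) : (c' != -1)%R -> (c' ^+ 2 + s' ^+ 2 = 1)%R ->
    measurable_fun setT (fun z => g z.1 z.2) -> (forall x y, 0 <= g x y) ->
    \int[gam]_x \int[gam]_y g (c' * x + s' * y)%R (- s' * x + c' * y)%R =
    \int[gam]_x \int[gam]_y g x y.
  move=> c1 cs mg g0.
  pose g1 x y := g (c' * x + s' * y)%R (- s' * x + c' * y)%R.
  have mg1 : measurable_fun setT (fun z => g1 z.1 z.2).
    by apply: measurable_fun2 mg _ _; apply: measurable_funD => //; apply: measurable_funM.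
  rewrite (toleb g1 mg1); last by move=> ? ?; exact: g0.
  rewrite (toleb g mg g0).
  rewrite -(lebesgue_rotation (f := fun x y => g x y * (p x * p y)%:E) c1 cs); last 2 first.
  - apply: emeasurable_funM => //; apply/measurable_EFinP.
    by apply: measurable_funM; apply: measurableT_comp mp _.
  - by move=> x y; rewrite mule_ge0// lee_fin mulr_ge0.
  apply: eq_integral => x _; apply: eq_integral => y _.
  rewrite /g1; congr (_ * _%:E); rewrite /p !normal_pdfE//=.
  rewrite mulrACA [RHS]mulrACA; congr (_ * _)%R.
  rewrite /normal_fun -!expRD; congr expR.
  have E : ((c' * x + s' * y) ^+ 2 + (- s' * x + c' * y) ^+ 2 =
            (c' ^+ 2 + s' ^+ 2) * (x ^+ 2 + y ^+ 2))%R by ring.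
  by rewrite !subr0 expr1n -!mulrDl -!opprD E cs mul1r.
move=> cs mf f0; have [c1|c1] := eqVneq c (-1)%R; last exact: main.
have s0 : s = 0%R.
  by apply/eqP; rewrite -sqrf_eq0; apply/eqP; move: cs; rewrite c1 sqrrN expr1n => ?; lra.
(* The remaining angle pi is reached by two quarter turns. *)
pose f1 x y := f (0 * x + 1 * y)%R (- 1 * x + 0 * y)%R.
have mf1 : measurable_fun setT (fun z => f1 z.1 z.2).
  by apply: measurable_fun2 mf _ _; apply: measurable_funD => //; apply: measurable_funM.
have n01 : (0 != -1 :> R)%R by rewrite eq_sym oppr_eq0 oner_eq0.
have e01 : (0 ^+ 2 + 1 ^+ 2 = 1 :> R)%R by rewrite expr0n/= add0r expr1n.
rewrite -(main 0%R 1%R f n01 e01 mf f0).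
rewrite -(main 0%R 1%R f1 n01 e01 mf1); last by move=> ? ?; exact: f0.
apply: eq_integral => x _; apply: eq_integral => y _.
by rewrite c1 s0 /f1; congr f; ring.
Qed.

End PlaneRotation.

(** * Gaussian vectors *)

Section MeasurableCalculus.
Context d1 d2 d3 (T : measurableType d3) (T1 : measurableType d1) (T2 : measurableType d2).

Lemma measurable_fun_fst (u : T -> T1 * T2) :
  measurable_fun setT u -> measurable_fun setT (fun t => (u t).1).
Proof. by move=> mu; apply: measurableT_comp mu; exact: measurable_fst. Qed.

Lemma measurable_fun_snd (u : T -> T1 * T2) :
  measurable_fun setT u -> measurable_fun setT (fun t => (u t).2).
Proof. by move=> mu; apply: measurableT_comp mu; exact: measurable_snd. Qed.

End MeasurableCalculus.

Section Vectors.
Context {R : realType}.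
Notation RR := (measurableTypeR R).
Notation RT n := (n.-tuple RR).

Lemma vecK n : cancel (@vec R n) unvec.
Proof. by move=> x; apply: eq_from_tnth => i; rewrite tnth_mktuple mxE. Qed.

Lemma unvecK n : cancel (@unvec R n) vec.
Proof. by move=> u; apply/matrixP => i j; rewrite mxE tnth_mktuple ord1. Qed.

(* ['cV[R]_n] carries no sigma-algebra of its own: measurability of vectors is
   coordinatewise, and that of functions of a vector goes through [vec]. *)
Definition mvec d (T : measurableType d) n (f : T -> 'cV[R]_n) : Prop :=
  forall i, measurable_fun setT (fun t => f t i 0 : RR).

Definition consv n (x : R) (v : 'cV[R]_n) : 'cV[R]_n.+1 := col_mx (x%:M : 'M[R]_1) v.

Lemma consvEu n (x : R) (v : 'cV[R]_n) (k : 'I_1) : consv x v (lshift n k) 0 = x.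
Proof.
transitivity ((x%:M : 'M[R]_1) k 0); first exact: col_mxEu.
by rewrite ord1 mxE.
Qed.

Lemma consvEd n (x : R) (v : 'cV[R]_n) (k : 'I_n) : consv x v (rshift 1 k) 0 = v k 0.
Proof. exact: col_mxEd. Qed.

Lemma vec_tcons n (x : R) (v : RT n) : vec (tcons (x, v)) = consv x (vec v).
Proof.
apply/matrixP => i j; rewrite ord1 {j} [LHS]mxE.
case: (@split_ordP 1 n i) => k ->.
  by rewrite consvEu ord1.
rewrite consvEd mxE (_ : rshift 1 k = lift ord0 k) ?tnthS//.
exact: val_inj.
Qed.

Section mvec.
Context d (T : measurableType d).

Lemma mvec_unvec n (f : T -> 'cV[R]_n) :
  mvec f -> measurable_fun setT (fun t => unvec (f t) : RT n).
Proof.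
move=> mf; apply/measurable_fun_tnthP => i.
rewrite (_ : _ \o _ = (fun t => f t i 0))//.
by apply/funext => t /=; rewrite tnth_mktuple.
Qed.

Lemma mvec_vec n (f : T -> RT n) : measurable_fun setT f -> mvec (fun t => vec (f t)).
Proof.
move=> mf i; rewrite (_ : (fun _ => _) = (fun t => tnth (f t) i)).
  by apply: (@measurableT_comp _ _ _ _ _ _ (fun x : RT n => tnth x i)) mf => //; exact: measurable_tnth.
by apply/funext => t; rewrite mxE.
Qed.

Lemma mvec_cst n (v : 'cV[R]_n) : mvec (fun _ : T => v).
Proof. by move=> i; exact: measurable_cst. Qed.

Lemma mvecD n (f g : T -> 'cV[R]_n) : mvec f -> mvec g -> mvec (fun t => f t + g t).
Proof.
move=> mf mg i; rewrite (_ : (fun _ => _) = (fun t => f t i 0 + g t i 0)).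
  exact: measurable_funD (mf i) (mg i).
by apply/funext => t; rewrite mxE.
Qed.

Lemma mvecZ n (u : T -> RR) (f : T -> 'cV[R]_n) :
  measurable_fun setT u -> mvec f -> mvec (fun t => u t *: f t).
Proof.
move=> mu mf i; rewrite (_ : (fun _ => _) = (fun t => u t * f t i 0)).
  exact: measurable_funM mu (mf i).
by apply/funext => t; rewrite mxE.
Qed.

Lemma mvecN n (f : T -> 'cV[R]_n) : mvec f -> mvec (fun t => - f t).
Proof.
move=> mf; rewrite (_ : (fun _ => _) = (fun t => -1 *: f t)).
  exact: mvecZ.
by apply/funext => t; rewrite scaleN1r.
Qed.

Lemma mvec_sum n (I : Type) (s : seq I) (f : I -> T -> 'cV[R]_n) :
  (forall i, mvec (f i)) -> mvec (fun t => \sum_(i <- s) f i t).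
Proof.
move=> mf; elim: s => [|i s IH].
  by under eq_fun do rewrite big_nil; exact: mvec_cst.
by under eq_fun do rewrite big_cons; exact: mvecD.
Qed.

Lemma mvec_cons n (u : T -> RR) (f : T -> 'cV[R]_n) :
  measurable_fun setT u -> mvec f -> mvec (fun t => consv (u t) (f t)).
Proof.
move=> mu mf i; case: (@split_ordP 1 n i) => k ->.
  rewrite (_ : (fun _ => _) = u)//.
  by apply/funext => t; exact: consvEu.
rewrite (_ : (fun _ => _) = (fun t => f t k 0)); first exact: mf.
by apply/funext => t; exact: consvEd.
Qed.

Lemma measurable_dot n (f g : T -> 'cV[R]_n) : mvec f -> mvec g ->
  measurable_fun setT (fun t => dot (f t) (g t) : RR).
Proof.
move=> mf mg; rewrite /dot.
by apply: measurable_sum => i; exact: measurable_funM (mf i) (mg i).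
Qed.

Lemma mvec_mulmx n p (A : 'M[R]_(p, n)) (f : T -> 'cV[R]_n) :
  mvec f -> mvec (fun t => A *m f t).
Proof.
move=> mf i; rewrite (_ : (fun _ => _) = (fun t => \sum_j A i j * f t j 0)).
  by apply: measurable_sum => j; exact: measurable_funM (measurable_cst _) (mf j).
by apply/funext => t; rewrite mxE.
Qed.

End mvec.

Definition vmeas d (T : measurableType d) n (F : 'cV[R]_n -> T) : Prop :=
  measurable_fun setT (fun g : RT n => F (vec g)).

Definition vmeas2 d (T : measurableType d) n p (F : 'cV[R]_n -> 'cV[R]_p -> T) : Prop :=
  measurable_fun setT (fun z : RT n * RT p => F (vec z.1) (vec z.2)).

Lemma vmeas_comp d d' (T : measurableType d) (T' : measurableType d') n
    (F : 'cV[R]_n -> T') (f : T -> 'cV[R]_n) :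
  vmeas F -> mvec f -> measurable_fun setT (fun t => F (f t)).
Proof.
move=> mF mf; under eq_fun do rewrite -[f _]unvecK.
by apply: (@measurableT_comp _ _ _ _ _ _ (fun g : RT n => F (vec g))) => //; exact: mvec_unvec.
Qed.

Lemma vmeas2_comp d d' (T : measurableType d) (T' : measurableType d') n p
    (F : 'cV[R]_n -> 'cV[R]_p -> T') (f : T -> 'cV[R]_n) (g : T -> 'cV[R]_p) :
  vmeas2 F -> mvec f -> mvec g -> measurable_fun setT (fun t => F (f t) (g t)).
Proof.
move=> mF mf mg; under eq_fun do rewrite -[f _]unvecK -[g _]unvecK.
by apply: (measurable_fun2 (f := fun x y => F (vec x) (vec y))) => //; exact: mvec_unvec.
Qed.

End Vectors.

(** Follows the shape of the function; subgoals of an unrecognised shape are left to the caller. *)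
Ltac mv :=
  lazymatch goal with
  | |- mvec vec => exact: (mvec_vec (@measurable_id _ _ _))
  | |- mvec (fun _ => vec _) => apply: mvec_vec; mv
  | |- mvec (fun _ => consv _ _) => apply: mvec_cons; mv
  | |- mvec (fun _ => _ *m _) => apply: mvec_mulmx; mv
  | |- mvec (fun _ => _ *: _) => apply: mvecZ; mv
  | |- mvec (fun _ => _ + _) => apply: mvecD; mv
  | |- mvec (fun _ => - _) => apply: mvecN; mv
  | |- mvec (fun _ => _) => first [exact: mvec_cst | apply: mvec_sum => ?; mv | idtac]
  | |- measurable_fun _ (fun _ => fst _) => apply: measurable_fun_fst; mv
  | |- measurable_fun _ (fun _ => snd _) => apply: measurable_fun_snd; mv
  | |- measurable_fun _ (fun _ => (_ + _)%R) => apply: measurable_funD; mv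
  | |- measurable_fun _ (fun _ => (- _)%R) => apply: measurableT_comp; mv
  | |- measurable_fun _ (fun _ => (_ * _)%R) => apply: measurable_funM; mv
  | |- measurable_fun _ (fun _ => dot _ _) => apply: measurable_dot; mv
  | |- measurable_fun _ (fun _ => expR _) => apply: measurableT_comp; mv
  | |- measurable_fun _ (fun _ => EFin _) => apply/measurable_EFinP; mv
  | |- measurable_fun _ (fun x => x) => exact: measurable_id
  | |- measurable_fun _ (fun _ => ?c) => exact: measurable_cst
  | |- measurable_fun _ _ => try done
  | _ => idtac
  end.

Section StdNormal.
Context {R : realType}.
Local Open Scope ereal_scope.
Notation RR := (measurableTypeR R).
Notation RT n := (n.-tuple RR).
Notation gam := (std_normal1 R).
Notation Gam := (@std_normal R).

Lemma integral_std_normalS n (F : 'cV[R]_n.+1 -> \bar R) :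
  vmeas F -> (forall v, 0 <= F v) ->
  \int[Gam n.+1]_g F (vec g) = \int[gam]_x \int[Gam n]_g F (consv x (vec g)).
Proof.
move=> mF F0.
have mF' : measurable_fun setT (fun z => F (vec (tcons z))).
  exact: measurableT_comp mF (@measurable_tcons R n).
have F0' z : 0 <= F (vec (tcons z)) by exact: F0.
transitivity (\int[gam \x Gam n]_z F (vec (tcons z))).
  exact: (ge0_integral_distribution _ mF (fun g => F0 (vec g))).
rewrite (ge0_integral_prod gam (Gam n) mF' F0').
by apply: eq_integral => x _; apply: eq_integral => v _; rewrite vec_tcons.
Qed.

Lemma vmeas_consl n (F : 'cV[R]_n.+1 -> \bar R) x :
  vmeas F -> vmeas (fun v => F (consv x v)).
Proof. move=> mF; apply: vmeas_comp mF _; mv. Qed.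

Lemma measurable_integral_cons d (T : measurableType d) n
   (F : T -> 'cV[R]_n -> \bar R) :
  measurable_fun setT (fun z : T * RT n => F z.1 (vec z.2)) ->
  (forall x v, 0 <= F x v) ->
  measurable_fun setT (fun x => \int[Gam n]_g F x (vec g)).
Proof.
move=> mF F0.
exact: (measurable_integral_snd (Gam n) (f := fun x g => F x (vec g))).
Qed.

Lemma consvD n (x y : R) (u v : 'cV[R]_n) :
  (consv x u + consv y v = consv (x + y) (u + v))%R.
Proof.
apply/matrixP => i j; rewrite ord1 mxE; case: (@split_ordP 1 n i) => k ->.
  by rewrite !consvEu.
by rewrite !consvEd mxE.
Qed.

Lemma consvZ n (a x : R) (u : 'cV[R]_n) : (a *: consv x u = consv (a * x) (a *: u))%R.
Proof.
apply/matrixP => i j; rewrite ord1 mxE; case: (@split_ordP 1 n i) => k ->.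
  by rewrite !consvEu.
by rewrite !consvEd mxE.
Qed.

(** The rotation mixes each coordinate of [X] only with the same coordinate of [Y], so induction on
    [n] reduces the claim to the plane. *)
Lemma std_normal_pair_rotation n (F : 'cV[R]_n -> 'cV[R]_n -> \bar R) (c s : R) :
  (c ^+ 2 + s ^+ 2 = 1)%R -> vmeas2 F -> (forall u v, 0 <= F u v) ->
  \int[Gam n]_X \int[Gam n]_Y
     F (c *: vec X + s *: vec Y)%R (- s *: vec X + c *: vec Y)%R =
  \int[Gam n]_X \int[Gam n]_Y F (vec X) (vec Y).
Proof.
move=> cs; elim: n F => [|n IH] F mF F0.
  apply: eq_integral => X _; apply: eq_integral => Y _.
  by congr F; apply/matrixP => -[].
(* Tonelli brings the two first coordinates outside, where the planar rotation acts on them. *)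
have split (G : 'cV[R]_n.+1 -> 'cV[R]_n.+1 -> \bar R) : vmeas2 G -> (forall u v, 0 <= G u v) ->
    \int[Gam n.+1]_X \int[Gam n.+1]_Y G (vec X) (vec Y) =
    \int[gam]_x \int[gam]_y \int[Gam n]_X \int[Gam n]_Y
      G (consv x (vec X)) (consv y (vec Y)).
  move=> mG G0.
  rewrite (integral_std_normalS (F := fun U => \int[Gam n.+1]_Y G U (vec Y)))//; last 2 first.
  - apply: (measurable_integral_cons (F := fun (x : RT n.+1) v => G (vec x) v)) => //.
  - by move=> v; exact: integral_ge0.
  apply: eq_integral => x _.
  under eq_integral => X _.
    rewrite (integral_std_normalS (F := fun V => G (consv x (vec X)) V))//; last first.
      by apply: vmeas2_comp mG _ _; mv.
    over.
  rewrite (tonelli (Gam n) gam (f := fun (X : RT n) (y : RR) => \int[Gam n]_Y G (consv x (vec X)) (consv y (vec Y))))//.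
  - apply: (measurable_integral_cons (F := fun (z : RT n * RR) v => G (consv x (vec z.1)) (consv z.2 v))) => //.
    by apply: vmeas2_comp mG _ _; mv.
  - by move=> ? ?; exact: integral_ge0.
rewrite (split (fun U V => F (c *: U + s *: V)%R (- s *: U + c *: V)%R))//; last first.
  by apply: vmeas2_comp mF _ _; mv.
rewrite (split F mF F0).
pose H (x y : RR) := \int[Gam n]_X \int[Gam n]_Y F (consv x (vec X)) (consv y (vec Y)).
have mH : measurable_fun setT (fun z => H z.1 z.2).
  apply: (measurable_integral_cons (F := fun (z : RR * RR) v => \int[Gam n]_Y F (consv z.1 v) (consv z.2 (vec Y)))) => //.
    apply: (measurable_integral_cons (F := fun (z : RR * RR * RT n) v => F (consv z.1.1 (vec z.2)) (consv z.1.2 v))) => //.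
    by apply: vmeas2_comp mF _ _; mv.
  by move=> ? ?; exact: integral_ge0.
have H0 x y : 0 <= H x y by apply: integral_ge0 => ? _; exact: integral_ge0.
transitivity (\int[gam]_x \int[gam]_y H x y); last by [].
transitivity (\int[gam]_x \int[gam]_y H (c * x + s * y)%R (- s * x + c * y)%R);
  last exact: (std_normal1_rotation cs mH H0).
apply: eq_integral => x _; apply: eq_integral => y _.
pose F1 U V := F (consv (c * x + s * y)%R U) (consv (- s * x + c * y)%R V).
have mF1 : vmeas2 F1 by apply: vmeas2_comp mF _ _; mv.
have F10 u v : 0 <= F1 u v by exact: F0.
rewrite /H -(IH F1 mF1 F10) /F1.
by apply: eq_integral => X _; apply: eq_integral => Y _; rewrite !consvZ !consvD.
Qed.

End StdNormal.

(** * Dot products, and orthogonal matrices in block form *)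

Section DotProduct.
Context {R : realType}.
Implicit Types n : nat.

Lemma dotC n (u v : 'cV[R]_n) : dot u v = dot v u.
Proof. by apply: eq_bigr => i _; rewrite mulrC. Qed.

Lemma dotDl n (u v w : 'cV[R]_n) : dot (u + v) w = dot u w + dot v w.
Proof. by rewrite -big_split; apply: eq_bigr => i _; rewrite mxE mulrDl. Qed.

Lemma dotZl n a (u v : 'cV[R]_n) : dot (a *: u) v = a * dot u v.
Proof. by rewrite /dot mulr_sumr; apply: eq_bigr => i _; rewrite mxE mulrA. Qed.

Lemma dotDr n (u v w : 'cV[R]_n) : dot u (v + w) = dot u v + dot u w.
Proof. by rewrite dotC dotDl ![dot _ u]dotC. Qed.

Lemma dotZr n a (u v : 'cV[R]_n) : dot u (a *: v) = a * dot u v.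
Proof. by rewrite dotC dotZl dotC. Qed.

Lemma dotNl n (u v : 'cV[R]_n) : dot (- u) v = - dot u v.
Proof. by rewrite -scaleN1r dotZl mulN1r. Qed.

Lemma dotNr n (u v : 'cV[R]_n) : dot u (- v) = - dot u v.
Proof. by rewrite dotC dotNl dotC. Qed.

Lemma dot0l n (u : 'cV[R]_n) : dot 0 u = 0.
Proof. by rewrite -(scale0r u) dotZl mul0r. Qed.

Lemma dot0r n (u : 'cV[R]_n) : dot u 0 = 0.
Proof. by rewrite dotC dot0l. Qed.

Lemma dot_suml n I (s : seq I) (P : pred I) (u : I -> 'cV[R]_n) v :
  dot (\sum_(i <- s | P i) u i) v = \sum_(i <- s | P i) dot (u i) v.
Proof.
by apply: (big_morph (fun x => dot x v)) => [x y|]; [exact: dotDl|exact: dot0l].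
Qed.

Lemma dot_ge0 n (u : 'cV[R]_n) : 0 <= dot u u.
Proof. by apply: sumr_ge0 => i _; rewrite -expr2 sqr_ge0. Qed.

Lemma sqr_norm2 n (u : 'cV[R]_n) : norm2 u ^+ 2 = dot u u.
Proof. by rewrite sqr_sqrtr// dot_ge0. Qed.

Lemma norm2_ge0 n (u : 'cV[R]_n) : 0 <= norm2 u.
Proof. exact: sqrtr_ge0. Qed.

Lemma dot_mx n (u v : 'cV[R]_n) : dot u v = (u^T *m v) 0 0.
Proof. by rewrite mxE; apply: eq_bigr => i _; rewrite mxE. Qed.

Lemma dot_deltal n (i : 'I_n) (v : 'cV[R]_n) : dot (delta_mx i 0) v = v i 0.
Proof. by rewrite dot_mx trmx_delta -rowE mxE. Qed.

Lemma dot_mulmxl n p (A : 'M[R]_(p, n)) (u : 'cV[R]_n) (v : 'cV[R]_p) :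
  dot (A *m u) v = dot u (A^T *m v).
Proof. by rewrite !dot_mx trmx_mul mulmxA. Qed.

Lemma dot_consv n (x y : R) (u v : 'cV[R]_n) :
  dot (consv x u) (consv y v) = x * y + dot u v.
Proof.
rewrite /dot (@big_split_ord _ _ _ 1 n) big_ord1; congr (_ + _).
  by rewrite !consvEu.
by apply: eq_bigr => i _; rewrite !consvEd.
Qed.

Lemma consv00 n : consv 0 0 = 0 :> 'cV[R]_n.+1.
Proof.
apply/matrixP => i j; rewrite ord1 [RHS]mxE; case: (@split_ordP 1 n i) => k ->.
  by rewrite consvEu.
by rewrite consvEd mxE.
Qed.

Lemma consv_eta n (u : 'cV[R]_n.+1) : exists x v, u = consv x v.
Proof.
exists (u 0 0), (\col_i u (rshift 1 i) 0).
apply/matrixP => i j; rewrite ord1; case: (@split_ordP 1 n i) => k ->.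
  by rewrite consvEu; congr (u _ _); apply: val_inj; rewrite /= ord1.
by rewrite consvEd mxE.
Qed.

Definition isometry_mx n (G : 'M[R]_n) : Prop :=
  forall u v, dot (G *m u) (G *m v) = dot u v.

Lemma isometry_mxP n (G : 'M[R]_n) : G^T *m G = 1%:M <-> isometry_mx G.
Proof.
split=> [GG u v|iG].
  by rewrite dot_mulmxl mulmxA GG mul1mx.
apply/matrixP => i j.
have := iG (delta_mx i 0) (delta_mx j 0).
rewrite dot_mulmxl mulmxA -colE !dot_deltal [LHS]mxE => ->.
by rewrite !mxE eqxx andbT.
Qed.

Lemma isometry_mxM n (G H : 'M[R]_n) :
  isometry_mx G -> isometry_mx H -> isometry_mx (G *m H).
Proof. by move=> iG iH u v; rewrite -!mulmxA iG iH. Qed.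

Definition consM n (G : 'M[R]_n) : 'M[R]_n.+1 :=
  block_mx (1%:M : 'M[R]_1) 0 0 G.

Lemma mul_consM n (G : 'M[R]_n) x u : consM G *m consv x u = consv x (G *m u).
Proof. by rewrite /consM /consv (@mul_block_col _ 1 n 1 n) mul1mx !mul0mx addr0 add0r. Qed.

(** Rotation in the plane of the first two axes; the blocks are cut along [consv]. *)
Definition rot01 n (c s : R) : 'M[R]_n.+2 :=
  block_mx (c%:M : 'M[R]_1) (row_mx (s%:M : 'M[R]_1) 0 : 'M[R]_(1, 1 + n))
    (col_mx ((- s)%:M : 'M[R]_1) 0 : 'M[R]_(1 + n, 1))
    (block_mx (c%:M : 'M[R]_1) 0 0 1%:M : 'M[R]_(1 + n)).

Lemma mul_rot01 n (c s x y : R) (u : 'cV[R]_n) :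
  rot01 n c s *m consv x (consv y u) = consv (c * x + s * y) (consv (- s * x + c * y) u).
Proof.
rewrite /rot01 /consv (@mul_block_col _ 1 (1 + n) 1 (1 + n)).
rewrite (@mul_row_col _ 1 1 n) (@mul_block_col _ 1 n 1 n) (@mul_col_mx _ 1 n).
rewrite !mul0mx mul1mx addr0 add0r -!scalar_mxM (@add_col_mx _ 1 n) add0r addr0.
by rewrite -!raddfD.
Qed.

Lemma isometry_consM n (G : 'M[R]_n) : isometry_mx G -> isometry_mx (consM G).
Proof.
move=> iG u v; have [x [u' ->]] := consv_eta u; have [y [v' ->]] := consv_eta v.
by rewrite !mul_consM !dot_consv iG.
Qed.

Lemma isometry_rot01 n (c s : R) : c ^+ 2 + s ^+ 2 = 1 -> isometry_mx (rot01 n c s).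
Proof.
move=> cs u v; have [x [u1 ->]] := consv_eta u; have [x' [u' ->]] := consv_eta u1.
have [y [v1 ->]] := consv_eta v; have [y' [v' ->]] := consv_eta v1.
rewrite !mul_rot01 !dot_consv !addrA; congr (_ + _).
transitivity ((c ^+ 2 + s ^+ 2) * (x * y + x' * y')); first by ring.
by rewrite cs mul1r.
Qed.

End DotProduct.

(** * Invariance of the standard normal law under orthogonal maps *)

Section GaussianInvariance.
Context {R : realType}.
Local Open Scope ereal_scope.
Notation RR := (measurableTypeR R).
Notation RT n := (n.-tuple RR).
Notation gam := (std_normal1 R).
Notation Gam := (@std_normal R).

Lemma integral_std_normal_cst n (k : \bar R) : \int[Gam n]_g k = k.
Proof. exact: integral_cst_prob. Qed.

(** With [r] the square root on the right, rotating the pair by cosine [a / r] and sine [b / r]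
    makes [a X + b Y] equal to [r] times the first component; the second one integrates out. *)
Lemma std_normal_stable n (F : 'cV[R]_n -> \bar R) (a b : R) :
  vmeas F -> (forall v, 0 <= F v) ->
  \int[Gam n]_X \int[Gam n]_Y F (a *: vec X + b *: vec Y)%R =
  \int[Gam n]_X F (Num.sqrt (a ^+ 2 + b ^+ 2) *: vec X)%R.
Proof.
move=> mF F0; set r := Num.sqrt _.
have ab0 : (0 <= a ^+ 2 + b ^+ 2)%R by rewrite addr_ge0// sqr_ge0.
have r2 : (r ^+ 2 = a ^+ 2 + b ^+ 2)%R by rewrite sqr_sqrtr.
have [r0|r0] := eqVneq r 0%R.
  move: r2; rewrite r0 expr0n/= => /esym/eqP.
  rewrite paddr_eq0 ?sqr_ge0// !sqrf_eq0 => /andP[/eqP -> /eqP ->].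
  under eq_integral do under eq_integral do rewrite !scale0r addr0.
  by under [RHS]eq_integral do rewrite scale0r; rewrite !integral_std_normal_cst.
have cs : ((a / r) ^+ 2 + (b / r) ^+ 2 = 1)%R.
  by rewrite !expr_div_n -mulrDl -r2 divff// sqrf_eq0.
pose F2 (U V : 'cV[R]_n) := F (r *: U)%R.
have mF2 : vmeas2 F2 by apply: vmeas_comp mF _; mv.
have F20 u v : 0 <= F2 u v by exact: F0.
have := std_normal_pair_rotation cs mF2 F20.
under eq_integral do under eq_integral do
  rewrite /F2 scalerDr !scalerA mulrC divfK// [(r * _)%R]mulrC divfK//.
move=> ->; apply: eq_integral => X _.
by rewrite /F2 integral_std_normal_cst.
Qed.

Definition law_invariant n (G : 'M[R]_n) : Prop :=
  forall F : 'cV[R]_n -> \bar R, vmeas F -> (forall v, 0 <= F v) ->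
  \int[Gam n]_g F (G *m vec g) = \int[Gam n]_g F (vec g).

Lemma std_normalN n (F : 'cV[R]_n -> \bar R) : vmeas F -> (forall v, 0 <= F v) ->
  \int[Gam n]_g F (- vec g)%R = \int[Gam n]_g F (vec g).
Proof.
move=> mF F0; pose F2 (U V : 'cV[R]_n) := F U.
have mF2 : vmeas2 F2 by apply: vmeas_comp mF _; mv.
have F20 u v : 0 <= F2 u v by exact: F0.
have cs : ((-1) ^+ 2 + 0 ^+ 2 = 1 :> R)%R by rewrite sqrrN expr1n expr0n addr0.
have := std_normal_pair_rotation cs mF2 F20.
under eq_integral do under eq_integral do rewrite /F2 scaleN1r scale0r addr0.
under eq_integral do rewrite integral_std_normal_cst.
by under [in RHS]eq_integral do rewrite integral_std_normal_cst.
Qed.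

Lemma std_normal1N (F : RR -> \bar R) : measurable_fun setT F -> (forall v, 0 <= F v) ->
  \int[gam]_x F (- x)%R = \int[gam]_x F x.
Proof.
move=> mF F0; pose F2 (x y : RR) := F x.
have mF2 : measurable_fun setT (fun z => F2 z.1 z.2) by apply: measurableT_comp mF _.
have cs : ((-1) ^+ 2 + 0 ^+ 2 = 1 :> R)%R by rewrite sqrrN expr1n expr0n addr0.
have := std_normal1_rotation cs mF2 (fun x _ => F0 x).
under eq_integral do under eq_integral do rewrite /F2 mulN1r mul0r addr0.
under eq_integral do rewrite integral_cst_prob.
by under [in RHS]eq_integral do rewrite integral_cst_prob.
Qed.

Lemma vmeas_mulmx n (F : 'cV[R]_n -> \bar R) (G : 'M[R]_n) :
  vmeas F -> vmeas (fun v => F (G *m v)).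
Proof. by move=> mF; apply: vmeas_comp mF _; mv. Qed.

Lemma law_invariantM n (G H : 'M[R]_n) :
  law_invariant G -> law_invariant H -> law_invariant (G *m H).
Proof.
move=> iG iH F mF F0; under eq_integral do rewrite -mulmxA.
by rewrite (iH (fun v => F (G *m v))) ?iG//; exact: vmeas_mulmx.
Qed.

Lemma law_invariant_consM n (G : 'M[R]_n) : law_invariant G -> law_invariant (consM G).
Proof.
move=> iG F mF F0.
rewrite (integral_std_normalS (F := fun v => F (consM G *m v)))//; last exact: vmeas_mulmx.
rewrite integral_std_normalS//; apply: eq_integral => x _.
under eq_integral do rewrite mul_consM.
by rewrite (iG (fun v => F (consv x v)))//; exact: vmeas_consl.
Qed.

Lemma law_invariant_rot01 n (c s : R) :
  (c ^+ 2 + s ^+ 2 = 1)%R -> law_invariant (rot01 n c s).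
Proof.
move=> cs.
have split (F : 'cV[R]_n.+2 -> \bar R) : vmeas F -> (forall v, 0 <= F v) ->
    \int[Gam n.+2]_g F (vec g) =
    \int[gam]_x \int[gam]_y \int[Gam n]_g F (consv x (consv y (vec g))).
  move=> mF F0; rewrite integral_std_normalS//; apply: eq_integral => x _.
  by rewrite (integral_std_normalS (F := fun v => F (consv x v)))//; exact: vmeas_consl.
move=> F mF F0.
rewrite (split (fun v => F (rot01 n c s *m v)) (vmeas_mulmx _ mF)); last by move=> ?; exact: F0.
rewrite (split F mF F0).
pose H (x y : RR) := \int[Gam n]_g F (consv x (consv y (vec g))).
have mH : measurable_fun setT (fun z => H z.1 z.2).
  apply: (measurable_integral_cons (F := fun (z : RR * RR) v => F (consv z.1 (consv z.2 v)))) => //.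
  by apply: vmeas_comp mF _; mv.
have H0 x y : 0 <= H x y by exact: integral_ge0.
rewrite -(std_normal1_rotation cs mH H0).
apply: eq_integral => x _; apply: eq_integral => y _.
by rewrite /H; under eq_integral do rewrite mul_rot01.
Qed.

(** Givens rotations: turn the tail onto its own first axis, then rotate the plane of the first two
    axes. Law invariance is recorded next to isometry because the general case,
    [isometry_law_invariant], is derived from this one. The sign of [r] is left open. *)
Lemma exists_law_invariant_to_axis n (v : 'cV[R]_n.+1) :
  exists (G : 'M[R]_n.+1) (r : R),
    [/\ isometry_mx G, law_invariant G & G *m v = consv r 0].
Proof.
elim: n v => [|n IH] v.
  exists 1%:M%R, (v 0 0)%R; split => [u w|F _ _|]; rewrite ?mul1mx//.
    by under eq_integral do rewrite mul1mx.
  have [x [w ->]] := consv_eta v.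
  have -> : w = 0%R by apply/matrixP => -[].
  congr (consv _ _); rewrite -[LHS](consvEu x (0%R : 'cV[R]_0) ord0).
  by congr (consv _ _ _ _); exact: val_inj.
have [x [w ->]] := consv_eta v.
have [G [r [iG lG Gw]]] := IH w.
have [xr0|xr0] := eqVneq (x ^+ 2 + r ^+ 2)%R 0%R.
  move/eqP: xr0; rewrite paddr_eq0 ?sqr_ge0// !sqrf_eq0 => /andP[/eqP x0 /eqP r0].
  exists (consM G), 0%R; split; [exact: isometry_consM|exact: law_invariant_consM|].
  rewrite mul_consM Gw x0 r0; congr (consv _ _).
  exact: consv00.
set q := Num.sqrt (x ^+ 2 + r ^+ 2)%R.
have q2 : (q ^+ 2 = x ^+ 2 + r ^+ 2)%R by rewrite sqr_sqrtr// addr_ge0// sqr_ge0.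
have q0 : q != 0%R by rewrite -sqrf_eq0 q2.
have cs : ((x / q) ^+ 2 + (r / q) ^+ 2 = 1)%R.
  by rewrite !expr_div_n -mulrDl -q2 divff// sqrf_eq0.
exists (rot01 n (x / q) (r / q) *m consM G), q; split.
- by apply: isometry_mxM; [exact: isometry_rot01|exact: isometry_consM].
- by apply: law_invariantM; [exact: law_invariant_rot01|exact: law_invariant_consM].
rewrite -mulmxA mul_consM Gw mul_rot01.
have -> : (x / q * x + r / q * r = q)%R.
  by apply: (mulIf q0); rewrite -expr2 q2 mulrDl; field.
have -> : (- (r / q) * x + x / q * r = 0)%R by ring.
by congr (consv _ _); exact: consv00.
Qed.

(** Choose [G] taking the image under [O] of the first axis back to that axis. Then [M = G O]
    multiplies the first coordinate by a sign [r] and acts on the orthogonal complement by an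
    isometry [M']. Symmetry of the scalar normal law and the induction hypothesis make [M] law
    invariant, and [O = G^T M]. *)
Theorem isometry_law_invariant n (G : 'M[R]_n) : isometry_mx G -> law_invariant G.
Proof.
elim: n G => [|n IH] O iO F mF F0.
  apply: eq_integral => g _; congr F.
  by apply/matrixP => -[].
have [G [r [iG lG Gv]]] := exists_law_invariant_to_axis (O *m consv 1%R (0 : 'cV[R]_n)).
pose M := G *m O.
have iM : isometry_mx M by exact: isometry_mxM.
have Me : M *m consv 1%R 0 = consv r 0 by rewrite -mulmxA.
have r2 : (r * r = 1)%R.
  have := iM (consv 1%R 0) (consv 1%R 0).
  by rewrite Me !dot_consv dot0l !addr0 mulr1.
have r0 : r != 0%R by apply/eqP => r0; move: r2; rewrite r0 mul0r => /eqP; rewrite eq_sym oner_eq0.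
pose M' : 'M[R]_n := \matrix_(i, j) (M : 'M[R]_(1 + n)) (rshift 1 i) (rshift 1 j).
have MM' u : M *m consv 0%R u = consv 0%R (M' *m u).
  have [y [w E]] := consv_eta (M *m consv 0%R u).
  have y0 : y = 0%R.
    have := iM (consv 1%R 0) (consv 0%R u).
    rewrite Me E !dot_consv !dot0l mulr0 !addr0 => /eqP.
    by rewrite mulf_eq0 (negbTE r0) => /eqP.
  rewrite E y0; congr (consv _ _); apply/matrixP => i j; rewrite ord1.
  have := consvEd y w i; rewrite -E => <-.
  rewrite [LHS]mxE [RHS]mxE (@big_split_ord _ _ _ 1 n) big_ord1 consvEu mulr0 /= add0r.
  by apply: eq_bigr => k _; rewrite consvEd [M' i k]mxE.
have Mc x u : M *m consv x u = consv (r * x)%R (M' *m u).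
  have -> : consv x u = (x *: consv 1%R 0 + consv 0%R u)%R.
    by rewrite consvZ consvD mulr1 addr0 scaler0 add0r.
  by rewrite mulmxDr -scalemxAr Me MM' consvZ consvD scaler0 add0r addr0 mulrC.
have iM' : isometry_mx M'.
  move=> u v; have := iM (consv 0%R u) (consv 0%R v).
  by rewrite !MM' !dot_consv mulr0 !add0r.
have lM : law_invariant M.
  move=> F1 mF1 F10.
  rewrite (integral_std_normalS (F := fun v => F1 (M *m v)) (vmeas_mulmx _ mF1)); last by move=> ?; exact: F10.
  rewrite integral_std_normalS//.
  transitivity (\int[gam]_x \int[Gam n]_g F1 (consv (r * x)%R (vec g))).
    apply: eq_integral => x _.
    under eq_integral do rewrite Mc.
    by rewrite (IH M' iM' (fun v => F1 (consv (r * x)%R v)))//; exact: vmeas_consl.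
  have /orP[/eqP ->|/eqP ->] : ((r == 1) || (r == -1))%R by rewrite -eqf_sqr expr1n expr2 r2.
    by under eq_integral do rewrite mul1r.
  under eq_integral do rewrite mulN1r.
  rewrite (std_normal1N (F := fun x => \int[Gam n]_g F1 (consv x (vec g))))//.
    apply: (measurable_integral_cons (F := fun (x : RR) v => F1 (consv x v))) => //.
    by apply: vmeas_comp mF1 _; mv.
  by move=> ?; exact: integral_ge0.
have GG : G^T *m G = 1%:M by apply/isometry_mxP.
(* Invariance under [G^T] is obtained from that under [G], applied to [F']. *)
pose F' v := F (G^T *m v).
have mF' : vmeas F' by exact: vmeas_mulmx.
have F'0 v : 0 <= F' v by exact: F0.
transitivity (\int[Gam n.+1]_g F' (M *m vec g)).
  by apply: eq_integral => g _; rewrite /F' /M !mulmxA GG mul1mx.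
rewrite (lM _ mF' F'0) -(lG _ mF' F'0).
by apply: eq_integral => g _; rewrite /F' mulmxA GG mul1mx.
Qed.

End GaussianInvariance.

(** * Moments of one standard normal variable *)

Section ScalarGaussian.
Context {R : realType}.
Local Open Scope ereal_scope.
Notation RR := (measurableTypeR R).
Notation gam := (std_normal1 R).

Lemma integral_normal_pdfZ (k m s : R) : (0 <= k)%R ->
  \int[@lebesgue_measure R]_x (k%:E * (normal_pdf m s x)%:E) = k%:E.
Proof.
move=> k0; rewrite (@ge0_integralZl_EFin _ _ _ (@lebesgue_measure R) setT measurableT
    (fun x => (normal_pdf m s x)%:E))//.
- by rewrite integral_normal_pdf mule1.
- by move=> x _; rewrite lee_fin normal_pdf_ge0.
- by apply/measurable_EFinP; exact: measurable_normal_pdf.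
Qed.

(** Completing the square turns the integrand into a multiple of the normal density centred at
    [a]. *)
Lemma std_normal1_mgf (a : R) :
  \int[gam]_x (expR (a * x))%:E = (expR (a ^+ 2 / 2))%:E.
Proof.
have me : measurable_fun setT (fun x : RR => (expR (a * x))%:E).
  by apply/measurable_EFinP; apply: measurableT_comp => //; exact: measurable_funM.
rewrite (ge0_integral_normal_prob 0 1 me); last by move=> x; rewrite lee_fin expR_ge0.
transitivity (\int[@lebesgue_measure R]_x ((expR (a ^+ 2 / 2))%:E * (normal_pdf a 1 x)%:E)).
  apply: eq_integral => x _; rewrite -!EFinM; congr EFin.
  rewrite !normal_pdfE//= mulrCA [RHS]mulrCA; congr (_ * _)%R.
  by rewrite /normal_fun -!expRD; congr expR; field.
exact: integral_normal_pdfZ (expR_ge0 _).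
Qed.

(** [|x|] is at most [expR x + expR (- x)], whose integral is known. *)
Lemma std_normal1_abs_fin : exists2 C : R, (0 <= C)%R & \int[gam]_x `|x|%:E <= C%:E.
Proof.
have m1 (a : R) : measurable_fun setT (fun x : RR => (expR (a * x))%:E).
  by apply/measurable_EFinP; apply: measurableT_comp => //; exact: measurable_funM.
have e0 (a x : R) : 0 <= (expR (a * x))%:E by rewrite lee_fin expR_ge0.
exists (expR (1 ^+ 2 / 2) + expR ((-1) ^+ 2 / 2))%R; first by rewrite addr_ge0// expR_ge0.
have -> : (expR (1 ^+ 2 / 2) + expR ((-1) ^+ 2 / 2))%:E =
    \int[gam]_x (expR (1 * x))%:E + \int[gam]_x (expR (-1 * x))%:E.
  by rewrite (std_normal1_mgf 1) (std_normal1_mgf (-1)).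
have := ge0_integralD gam measurableT (fun x _ => e0 1%R x) (m1 1%R)
  (fun x _ => e0 (-1)%R x) (m1 (-1)%R).
move=> <-; apply: le_ge0_integral => x; first by rewrite lee_fin.
rewrite -EFinD lee_fin mul1r mulN1r.
have := expR_ge1Dx x; have := expR_ge1Dx (- x)%R.
have := expR_ge0 x; have := expR_ge0 (- x)%R.
by case: (ger0P x) => ? ? ? ? ?; lra.
Qed.

(** Since [1 / 2 - 1 / 8 = 3 / 8], the integrand times the density is a multiple of the normal
    density of variance [4 / 3]. *)
Lemma std_normal1_expsq_fin :
  exists2 A : R, (1 <= A)%R & \int[gam]_x (expR (x ^+ 2 / 8))%:E <= A%:E.
Proof.
pose s := Num.sqrt (4 / 3 : R).
have s2 : (s ^+ 2 = 4 / 3)%R by rewrite sqr_sqrtr// divr_ge0.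
have s0 : s != 0%R by rewrite -sqrf_eq0 s2 mulf_neq0// invr_neq0.
pose A := (normal_peak (1 : R) / normal_peak s)%R.
have ps : (0 < normal_peak s)%R by exact: normal_peak_gt0.
have A0 : (0 <= A)%R by rewrite divr_ge0// normal_peak_ge0.
exists (Num.max 1 A)%R; first by rewrite le_max lexx.
have me : measurable_fun setT (fun x : RR => (expR (x ^+ 2 / 8))%:E).
  apply/measurable_EFinP; apply: measurableT_comp => //; apply: measurable_funM => //.
rewrite (ge0_integral_normal_prob 0 1 me); last by move=> x; rewrite lee_fin expR_ge0.
have -> : \int[@lebesgue_measure R]_x ((expR (x ^+ 2 / 8))%:E * (normal_pdf 0 1 x)%:E) = A%:E.
  transitivity (\int[@lebesgue_measure R]_x (A%:E * (normal_pdf 0 s x)%:E)).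
    apply: eq_integral => x _; rewrite -!EFinM; congr EFin.
    rewrite !normal_pdfE//= /A mulrCA [RHS]mulrA divfK ?gt_eqF//; congr (_ * _)%R.
    by rewrite /normal_fun -!expRD s2; congr expR; field.
  exact: integral_normal_pdfZ.
by rewrite lee_fin le_max lexx orbT.
Qed.

(** Positivity comes from the interval from 1 to 2, where the minimum is 1 and the density is at
    least its value at 2. *)
Lemma std_normal1_min_abs : exists2 k : R, (0 < k <= 1)%R &
  \int[gam]_x (Num.min `|x| 1)%:E = k%:E.
Proof.
have m1 : measurable_fun setT (fun x : RR => (Num.min `|x| 1)%:E).
  apply/measurable_EFinP; apply: measurable_minr => //.
have f0 (x : R) : 0 <= (Num.min `|x| 1)%:E by rewrite lee_fin le_min normr_ge0 ler01.
set I := \int[gam]_x _.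
have I0 : 0 <= I by exact: integral_ge0.
have I1 : I <= 1.
  rewrite -[leRHS](integral_cst_prob gam 1); apply: le_ge0_integral => // x.
  by rewrite lee_fin ge_min lexx orbT.
have Ifin : I \is a fin_num by rewrite ge0_fin_numE// (le_lt_trans I1)// ltry.
exists (fine I); last by rewrite fineK.
rewrite -!lee_fin -lte_fin fineK// I1 andbT.
pose c := normal_pdf (0 : R) 1 2.
have c0 : (0 < c)%R.
  by rewrite /c normal_pdfE//= mulr_gt0 ?normal_peak_gt0 ?expR_gt0.
apply: (@lt_le_trans _ _ c%:E); first by rewrite lte_fin.
rewrite /I (ge0_integral_normal_prob 0 1 m1 f0).
have -> : c%:E = \int[@lebesgue_measure R]_(x in `[1%R, 2%R]) c%:E.
  rewrite integral_cst//= lebesgue_measure_itv/= lte_fin ltr1n.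
  by rewrite -EFinD -EFinM; congr EFin; ring.
rewrite integral_mkcond; apply: le_ge0_integral => x; rewrite patchE; case: ifPn => //.
- by move=> _; rewrite lee_fin ltW.
- rewrite inE/= in_itv/= => /andP[x1 x2].
  rewrite -EFinM lee_fin ger0_norm ?(le_trans _ x1)// min_r// mul1r /c.
  rewrite !normal_pdfE//= ler_wpM2l ?normal_peak_ge0// /normal_fun ler_expR.
  rewrite !subr0 expr1n !mulNr lerN2 ler_pM2r; last by rewrite invr_gt0.
  by rewrite ler_sqr ?nnegrE// (le_trans _ x1).
- by move=> _; rewrite mule_ge0// lee_fin normal_pdf_ge0.
Qed.

End ScalarGaussian.

(** * Maxima of Gaussian processes *)

Section MaxWithZero.
Context {R : realType} {I : eqType}.
Implicit Types (s : seq I) (a b : I -> R).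

(** Including 0 keeps maxima nonnegative, also over the empty list, so that their integrals make
    sense without integrability. *)
Definition max0 s a : R := \big[Num.max/0]_(i <- s) a i.

Lemma max0_ge0 s a : 0 <= max0 s a.
Proof.
rewrite /max0; elim: s => [|i s IH]; first by rewrite big_nil.
by rewrite big_cons le_max IH orbT.
Qed.

Lemma max0_ub s a i : i \in s -> a i <= max0 s a.
Proof.
rewrite /max0; elim: s => // j s IH; rewrite inE big_cons le_max.
by case/orP => [/eqP ->|/IH ->]; rewrite ?lexx ?orbT.
Qed.

Lemma max0_le s a c : 0 <= c -> (forall i, i \in s -> a i <= c) -> max0 s a <= c.
Proof.
rewrite /max0; elim: s => [|j s IH] c0 ac; first by rewrite big_nil.
rewrite big_cons ge_max ac ?mem_head//= IH// => i si.
by rewrite ac// inE si orbT.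
Qed.

Lemma max0_attained s a :
  max0 s a = 0 \/ exists2 i, i \in s & max0 s a = a i.
Proof.
rewrite /max0; elim: s => [|j s [IH|[i si IH]]]; first by left; rewrite big_nil.
- rewrite big_cons IH; case: (leP (a j) 0) => _; first by left.
  by right; exists j; rewrite ?mem_head.
- right; rewrite big_cons IH; case: (leP (a j) (a i)) => _.
    by exists i; rewrite ?inE ?si ?orbT.
  by exists j; rewrite ?mem_head.
Qed.

Lemma eq_max0 s a b : a =1 b -> max0 s a = max0 s b.
Proof. by move=> ab; apply: eq_bigr => i _; exact: ab. Qed.

Lemma le_max0 s a b : (forall i, i \in s -> a i <= b i) -> max0 s a <= max0 s b.
Proof.
move=> ab; apply: max0_le; first exact: max0_ge0.
by move=> i si; apply: le_trans (ab i si) _; exact: max0_ub.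
Qed.

Lemma max0Z s c a : 0 <= c -> max0 s (fun i => c * a i) = c * max0 s a.
Proof.
move=> c0; apply/eqP; rewrite eq_le; apply/andP; split.
  apply: max0_le; first by rewrite mulr_ge0 ?max0_ge0.
  by move=> i si; rewrite ler_wpM2l ?max0_ub.
have [->|[i si ->]] := max0_attained s a; first by rewrite mulr0 max0_ge0.
exact: (max0_ub (fun i => c * a i) si).
Qed.

Lemma measurable_max0 d (T : measurableType d) s (a : T -> I -> R) :
  (forall i, measurable_fun setT (a ^~ i)) -> measurable_fun setT (fun t => max0 s (a t)).
Proof.
move=> ma; rewrite /max0; elim: s => [|i s IH].
  by under eq_fun do rewrite big_nil; exact: measurable_cst.
by under eq_fun do rewrite big_cons; exact: measurable_maxr.
Qed.

End MaxWithZero.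

Section Concentration.
Context {R : realType}.
Local Open Scope ereal_scope.
Notation RR := (measurableTypeR R).
Notation RT n := (n.-tuple RR).
Notation Gam := (@std_normal R).

Lemma std_normal_mgf n (u : 'cV[R]_n) :
  \int[Gam n]_g (expR (dot (vec g) u))%:E = (expR (dot u u / 2))%:E.
Proof.
elim: n u => [|n IH] u.
  rewrite (_ : u = 0%R); last by apply/matrixP => -[].
  under eq_integral do rewrite dot0r.
  by rewrite integral_std_normal_cst dot0r mul0r.
have [x [w ->]] := consv_eta u.
have mF k (v : 'cV[R]_k) : vmeas (fun g => (expR (dot g v))%:E).
  by rewrite /vmeas; mv.
have F0 k (v g : 'cV[R]_k) : 0 <= (expR (dot g v))%:E by rewrite lee_fin expR_ge0.
rewrite (integral_std_normalS (mF _ _) (F0 _ _)).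
transitivity (\int[std_normal1 R]_y ((expR (dot w w / 2))%:E * (expR (x * y))%:E)).
  apply: eq_integral => y _.
  rewrite -(IH w) -ge0_integralZr//; first last.
  - exact: mF.
  apply: eq_integral => g _.
  by rewrite dot_consv -EFinM -expRD; congr (expR _)%:E; ring.
rewrite (@ge0_integralZl_EFin _ _ _ _ setT measurableT (fun y : RR => (expR (x * y))%:E)).
- by rewrite std_normal1_mgf -EFinM -expRD dot_consv; congr (expR _)%:E; field.
- by move=> y _; rewrite lee_fin expR_ge0.
- by mv.
- by rewrite expR_ge0.
Qed.

Lemma std_normal_expsq n (A : R) : (0 <= A)%R ->
  \int[std_normal1 R]_x (expR (x ^+ 2 / 8))%:E <= A%:E ->
  \int[Gam n]_g (expR (dot (vec g) (vec g) / 8))%:E <= (A ^+ n)%:E.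
Proof.
move=> A0 hA; elim: n => [|n IH].
  have d0 (g : RT 0) : dot (vec g) (vec g) = 0%R by rewrite /dot big_ord0.
  by under eq_integral do rewrite d0 mul0r expR0; rewrite integral_std_normal_cst expr0.
have mF k : vmeas (fun g : 'cV[R]_k => (expR (dot g g / 8))%:E).
  by rewrite /vmeas; mv.
have F0 k (g : 'cV[R]_k) : 0 <= (expR (dot g g / 8))%:E by rewrite lee_fin expR_ge0.
rewrite (integral_std_normalS (mF _) (F0 _)).
have -> : \int[std_normal1 R]_x \int[Gam n]_g (expR (dot (consv x (vec g)) (consv x (vec g)) / 8))%:E =
    \int[std_normal1 R]_x ((expR (x ^+ 2 / 8))%:E * \int[Gam n]_g (expR (dot (vec g) (vec g) / 8))%:E).
  apply: eq_integral => x _.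
  rewrite -ge0_integralZl//; first last.
  - exact: mF.
  apply: eq_integral => g _.
  by rewrite dot_consv -EFinM -expRD; congr (expR _)%:E; ring.
rewrite ge0_integralZr; first last.
- by apply: integral_ge0 => g _; exact: F0.
- by move=> x _; rewrite lee_fin expR_ge0.
- by apply/measurable_EFinP; apply: measurableT_comp => //; apply: measurable_funM.
- by [].
rewrite exprS EFinM; apply: lee_pmul => //.
  by apply: integral_ge0 => x _; rewrite lee_fin expR_ge0.
by apply: integral_ge0 => x _; exact: F0.
Qed.

Variables (n : nat) (hs : seq 'cV[R]_n).

Definition gmax (v : 'cV[R]_n) : R := max0 hs (dot v).

Lemma gmax_ge0 v : (0 <= gmax v)%R. Proof. exact: max0_ge0. Qed.

Lemma gmaxZ c v : (0 <= c)%R -> gmax (c *: v)%R = (c * gmax v)%R.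
Proof. by move=> c0; rewrite -max0Z//; apply: eq_max0 => h; rewrite dotZl. Qed.

Lemma mvec_gmax d (T : measurableType d) (f : T -> 'cV[R]_n) :
  mvec f -> measurable_fun setT (fun t => gmax (f t)).
Proof.
by move=> mf; apply: measurable_max0 => h; apply: measurable_dot => //; exact: mvec_cst.
Qed.

Variables (t W : R).
Hypotheses (hs_t : forall h, h \in hs -> (dot h h <= t ^+ 2)%R)
  (hW : \int[Gam n]_g (gmax (vec g))%:E <= W%:E).

Let expR0E (x : R) : 0 <= (expR x)%:E. Proof. by rewrite lee_fin expR_ge0. Qed.

(* For fixed [X], the maximizer [h] of [dot X] gives
   [gmax X - gmax (X + Y) <= - dot Y h], a Gaussian of variance at most [t^2]. *)
Lemma gmax_shift (l : R) (X : 'cV[R]_n) : (0 <= l)%R ->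
  \int[Gam n]_Y (expR (l * (gmax X - gmax (X + vec Y)%R)))%:E
    <= (expR (l ^+ 2 * t ^+ 2 / 2))%:E.
Proof.
move=> l0.
have [E|[h hsh E]] := max0_attained hs (dot X).
  apply: (@le_trans _ _ (\int[Gam n]_Y 1)).
    apply: le_ge0_integral => Y; first exact: expR0E.
    rewrite lee_fin -expR0 ler_expR /gmax E sub0r mulrN oppr_le0 mulr_ge0//.
    exact: gmax_ge0.
  rewrite integral_std_normal_cst lee_fin -expR0 ler_expR.
  by rewrite divr_ge0// mulr_ge0 ?sqr_ge0.
apply: (@le_trans _ _ (\int[Gam n]_Y (expR (dot (vec Y) (- l *: h)%R))%:E)).
  apply: le_ge0_integral => Y; first exact: expR0E.
  rewrite lee_fin ler_expR dotZr mulNr -mulrN ler_wpM2l//.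
  rewrite /gmax E lerBlDr addrC -dotNl.
  have := max0_ub (dot (X + vec Y)%R) hsh; rewrite dotDl dotNl; lra.
rewrite std_normal_mgf lee_fin ler_expR ler_pM2r ?invr_gt0//.
by rewrite dotZl dotZr mulrA -expr2 sqrrN ler_wpM2l ?sqr_ge0// hs_t.
Qed.

(** Apply [gmax_shift] to the pair rotated by 45 degrees, [U = c (X + Y)] and [V = c (Y - X)]: then
    [U + V = 2 c Y], and homogeneity of [gmax] turns [gmax U - gmax (U + V)] into [c] times the
    exponent's bracket. Dividing [l] by [c] doubles the variance term. *)
Lemma gmax_shift_rotated (l : R) : (0 <= l)%R ->
  \int[Gam n]_X \int[Gam n]_Y (expR (l * (gmax (vec X + vec Y)%R - 2 * gmax (vec Y))))%:E
    <= (expR (l ^+ 2 * t ^+ 2))%:E.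
Proof.
move=> l0; pose c : R := ((Num.sqrt 2)^-1)%R.
have c0 : (0 < c)%R by rewrite invr_gt0 sqrtr_gt0.
have c2 : (c ^+ 2 = 2^-1)%R by rewrite exprVn sqr_sqrtr.
have cs : (c ^+ 2 + c ^+ 2 = 1)%R by rewrite c2; field.
pose l' := (l / c)%R.
pose G (U V : 'cV[R]_n) := (expR (l' * (gmax U - gmax (U + V)%R)))%:E.
have mG : vmeas2 G.
  rewrite /vmeas2 /G; apply/measurable_EFinP; apply: measurableT_comp => //.
  apply: measurable_funM => //; apply: measurable_funB; apply: mvec_gmax; mv.
have G0 u v : 0 <= G u v by exact: expR0E.
have l'0 : (0 <= l')%R by rewrite divr_ge0// ltW.
have -> : (l ^+ 2 * t ^+ 2 = l' ^+ 2 * t ^+ 2 / 2)%R.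
  by rewrite /l' expr_div_n c2 invrK; field.
apply: (@le_trans _ _ (\int[Gam n]_X (expR (l' ^+ 2 * t ^+ 2 / 2))%:E)); last first.
  by rewrite integral_std_normal_cst.
apply: (@le_trans _ _ (\int[Gam n]_X \int[Gam n]_Y G (vec X) (vec Y))); last first.
  by apply: le_ge0_integral => X; [exact: integral_ge0|exact: gmax_shift].
rewrite -(std_normal_pair_rotation cs mG G0) le_eqVlt; apply/orP; left; apply/eqP.
apply: eq_integral => X _; apply: eq_integral => Y _.
rewrite /G.
have -> : (c *: vec X + c *: vec Y + (- c *: vec X + c *: vec Y) = (2 * c) *: vec Y)%R.
  by rewrite addrACA -scalerDl subrr scale0r add0r -scalerDl; congr (_ *: _); ring.
rewrite -scalerDr !gmaxZ ?mulr_ge0// ?ltW//.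
by congr (expR _)%:E; rewrite /l'; field; rewrite gt_eqF.
Qed.

(** Jensen's inequality, by integrating the tangent line of the exponential at [- (l * W)]; the term
    linear in [gmax] is moved to the other side so that all integrands are nonnegative. *)
Lemma gmax_mgf_neg (l : R) : (0 <= l)%R -> (0 <= W)%R ->
  (expR (- (l * W)))%:E <= \int[Gam n]_g (expR (- (l * gmax (vec g))))%:E.
Proof.
move=> l0 W0.
have mg : measurable_fun setT (fun g : RT n => gmax (vec g)) by apply: mvec_gmax; mv.
have mE : measurable_fun setT (fun g : RT n => (expR (- (l * gmax (vec g))))%:E).
  apply/measurable_EFinP; apply: measurableT_comp => //; apply: measurableT_comp => //.
  exact: measurable_funM.
have mK : measurable_fun setT (fun g : RT n => (expR (- (l * W)) * l * gmax (vec g))%:E).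
  by apply/measurable_EFinP; apply: measurable_funM.
have e0 := expR_ge0 (- (l * W)).
have K0 g : 0 <= (expR (- (l * W)) * l * gmax g)%:E by rewrite lee_fin !mulr_ge0 ?gmax_ge0.
have : (expR (- (l * W)) * (1 + l * W))%:E <=
    \int[Gam n]_g ((expR (- (l * gmax (vec g))))%:E + (expR (- (l * W)) * l * gmax (vec g))%:E).
  rewrite -[leLHS](integral_std_normal_cst n); apply: le_ge0_integral => g.
    by rewrite lee_fin mulr_ge0// addr_ge0// mulr_ge0.
  rewrite -EFinD lee_fin.
  have -> : (- (l * gmax (vec g)) = - (l * W) + (l * W - l * gmax (vec g)))%R by ring.
  rewrite expRD -mulrA -mulrDr ler_wpM2l//.
  by have := expR_ge1Dx (l * W - l * gmax (vec g)); lra.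
rewrite (ge0_integralD (Gam n) measurableT (fun g _ => expR0E _) mE (fun g _ => K0 _) mK).
have -> : \int[Gam n]_g (expR (- (l * W)) * l * gmax (vec g))%:E =
    (expR (- (l * W)) * l)%:E * \int[Gam n]_g (gmax (vec g))%:E.
  rewrite -ge0_integralZl_EFin//.
  - by move=> g _; rewrite lee_fin gmax_ge0.
  - exact/measurable_EFinP.
  - by rewrite mulr_ge0.
have c0 : 0 <= (expR (- (l * W)) * l)%:E by rewrite lee_fin mulr_ge0.
have := lee_wpmul2l c0 hW.
move=> /(leeD2l (\int[Gam n]_g (expR (- (l * gmax (vec g))))%:E)) h1 h2.
have {h1 h2} := le_trans h2 h1.
rewrite -EFinM -leeBlDr// -EFinB; congr (_ <= _); congr EFin; ring.
Qed.

(** For independent [X], [Y], [gmax X - 2 gmax Y] is the sum of the two differences controlled by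
    [gmax_shift] and [gmax_shift_rotated], both applied with [q = 2 l]. Its exponential moment
    factors, and the factor in [Y] is bounded below by [gmax_mgf_neg]. This elementary route to
    concentration costs a factor 2 on the mean. *)
Lemma gmax_mgf (l : R) : (0 <= l)%R -> (0 <= W)%R ->
  \int[Gam n]_g (expR (l * gmax (vec g)))%:E <= (expR (2 * l * W + 4 * l ^+ 2 * t ^+ 2))%:E.
Proof.
move=> l0 W0; pose q := (2 * l)%R.
have q0 : (0 <= q)%R by rewrite mulr_ge0.
have mg : measurable_fun setT (fun g : RT n => gmax (vec g)) by apply: mvec_gmax; mv.
have mX : measurable_fun setT (fun z : RT n * RT n => gmax (vec z.1)) by apply: mvec_gmax; mv.
have mY : measurable_fun setT (fun z : RT n * RT n => gmax (vec z.2)) by apply: mvec_gmax; mv.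
have mXY : measurable_fun setT (fun z : RT n * RT n => gmax (vec z.1 + vec z.2)%R).
  by apply: mvec_gmax; mv.
pose a (X Y : RT n) := (q * (gmax (vec X) - gmax (vec X + vec Y)%R))%R.
pose b (X Y : RT n) := (q * (gmax (vec X + vec Y)%R - 2 * gmax (vec Y)))%R.
have ma : measurable_fun setT (fun z => (expR (a z.1 z.2))%:E).
  by apply/measurable_EFinP; apply: measurableT_comp => //; apply: measurable_funM => //; exact: measurable_funB.
have mb : measurable_fun setT (fun z => (expR (b z.1 z.2))%:E).
  apply/measurable_EFinP; apply: measurableT_comp => //; apply: measurable_funM => //.
  by apply: measurable_funB => //; apply: measurable_funM.
have B : \int[Gam n]_X \int[Gam n]_Y (expR (l * (gmax (vec X) - 2 * gmax (vec Y))))%:E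
    <= (expR (q ^+ 2 * t ^+ 2))%:E.
  apply: (@le_trans _ _ (\int[Gam n]_X \int[Gam n]_Y
     ((2^-1)%:E * ((expR (a X Y))%:E + (expR (b X Y))%:E)))).
    apply: le_ge0_integral => X; first by apply: integral_ge0.
    apply: le_ge0_integral => Y; first exact: expR0E.
    rewrite -EFinD -EFinM lee_fin.
    have -> : (l * (gmax (vec X) - 2 * gmax (vec Y)) = a X Y / 2 + b X Y / 2)%R.
      by rewrite /a /b /q; field.
    rewrite expRD.
    have ea : expR (a X Y) = (expR (a X Y / 2) ^+ 2)%R.
      by rewrite -expRM_natl; congr expR; field.
    have eb : expR (b X Y) = (expR (b X Y / 2) ^+ 2)%R.
      by rewrite -expRM_natl; congr expR; field.
    (* The exponential of a half-sum is at most the mean of the exponentials, so no joint law of the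
       two differences is needed. *)
    rewrite ea eb; have := sqr_ge0 (expR (a X Y / 2) - expR (b X Y / 2)); nra.
  have s0 X Y : 0 <= (expR (a X Y))%:E + (expR (b X Y))%:E by rewrite adde_ge0.
  have msec : measurable_fun setT (fun z => (expR (a z.1 z.2))%:E + (expR (b z.1 z.2))%:E).
    exact: emeasurable_funD.
  under eq_integral => X _.
    rewrite (@ge0_integralZl_EFin _ _ _ _ setT measurableT (fun Y => (expR (a X Y))%:E + (expR (b X Y))%:E))//; last first.
      by apply: (measurable_fun2 (f := fun X Y => (expR (a X Y))%:E + (expR (b X Y))%:E)).
    rewrite (ge0_integralD (Gam n) measurableT (fun Y _ => expR0E _) _ (fun Y _ => expR0E _)); last 2 first.
    - by apply: (measurable_fun2 (f := fun X Y => (expR (a X Y))%:E)).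
    - by apply: (measurable_fun2 (f := fun X Y => (expR (b X Y))%:E)).
    over.
  have mIa : measurable_fun setT (fun X => \int[Gam n]_Y (expR (a X Y))%:E).
    exact: (measurable_integral_snd (Gam n) (f := fun X Y => (expR (a X Y))%:E)).
  have mIb : measurable_fun setT (fun X => \int[Gam n]_Y (expR (b X Y))%:E).
    exact: (measurable_integral_snd (Gam n) (f := fun X Y => (expR (b X Y))%:E)).
  have Ia0 X : 0 <= \int[Gam n]_Y (expR (a X Y))%:E by exact: integral_ge0.
  have Ib0 X : 0 <= \int[Gam n]_Y (expR (b X Y))%:E by exact: integral_ge0.
  rewrite ge0_integralZl_EFin//; last 2 first.
  - by move=> X _; rewrite adde_ge0.
  - exact: emeasurable_funD.
  rewrite (ge0_integralD (Gam n) measurableT (fun X _ => Ia0 X) mIa (fun X _ => Ib0 X) mIb).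
  have hb := gmax_shift_rotated q0.
  have ha : \int[Gam n]_X \int[Gam n]_Y (expR (a X Y))%:E <= (expR (q ^+ 2 * t ^+ 2))%:E.
    rewrite -[leRHS](integral_std_normal_cst n); apply: le_ge0_integral => // X.
    apply: le_trans (gmax_shift _ q0) _; rewrite lee_fin ler_expR.
    by have : (0 <= q ^+ 2 * t ^+ 2)%R by [rewrite mulr_ge0 ?sqr_ge0|]; lra.
  have h2 : 0 <= (2^-1)%:E :> \bar R by rewrite lee_fin invr_ge0.
  apply: le_trans (lee_wpmul2l h2 (leeD ha hb)) _.
  by rewrite -EFinD -EFinM lee_fin; lra.
have := gmax_mgf_neg q0 W0.
have mq : measurable_fun setT (fun Y : RT n => (expR (- (q * gmax (vec Y))))%:E).
  apply/measurable_EFinP; apply: measurableT_comp => //; apply: measurableT_comp => //.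
  exact: measurable_funM.
have E X : \int[Gam n]_Y (expR (l * (gmax (vec X) - 2 * gmax (vec Y))))%:E =
    (expR (l * gmax (vec X)))%:E * \int[Gam n]_Y (expR (- (q * gmax (vec Y))))%:E.
  rewrite -(ge0_integralZl_EFin (Gam n) measurableT (fun Y _ => expR0E _) mq (expR_ge0 _)).
  apply: eq_integral => Y _; rewrite -EFinM -expRD; congr (expR _)%:E.
  by rewrite /q; ring.
move: B; under eq_integral do rewrite E.
rewrite ge0_integralZr//; last 2 first.
- by apply/measurable_EFinP; apply: measurableT_comp => //; exact: measurable_funM.
- by apply: integral_ge0 => Y _; exact: expR0E.
set J := \int[Gam n]_g _; set N := \int[Gam n]_Y _ => B hN.
have N0 : 0 <= N by exact: integral_ge0.
have := le_trans (lee_wpmul2l N0 hN) B.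
have ep := expR_gt0 (- (q * W)).
rewrite muleC -lee_pdivlMl// -EFinM -expRN -expRD => /le_trans; apply.
rewrite lee_fin ler_expR /q; lra.
Qed.

End Concentration.

(** * Independent samples *)

Section Iid.
Context {R : realType} d (T : measurableType d) (rho : probability T R).
Local Open Scope ereal_scope.

Definition gcons m (z : T * m.-tuple T) : m.+1.-tuple T := [tuple of z.1 :: z.2].

Lemma measurable_gcons m : measurable_fun setT (@gcons m).
Proof. exact: measurable_cons. Qed.

HB.instance Definition _ m :=
  @isMeasurableFun.Build _ _ _ _ (@gcons m) (@measurable_gcons m).

Fixpoint iid_prob m : probability (m.-tuple T) R :=
  match m with
  | 0%N => \d_[tuple]
  | m'.+1 => distribution (rho \x iid_prob m')%E (@gcons m')
  end.

Lemma integral_iidS m (F : m.+1.-tuple T -> \bar R) :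
  measurable_fun setT F -> (forall v, 0 <= F v) ->
  \int[iid_prob m.+1]_v F v = \int[rho]_x \int[iid_prob m]_v F (gcons (x, v)).
Proof.
move=> mF F0.
have mF' : measurable_fun setT (fun z => F (gcons z)).
  exact: measurableT_comp mF (@measurable_gcons m).
transitivity (\int[rho \x iid_prob m]_z F (gcons z)).
  exact: (ge0_integral_distribution _ mF F0).
exact: (ge0_integral_prod rho (iid_prob m) mF' (fun z => F0 _)).
Qed.

Lemma sum_gcons (V : nmodType) m (f : 'I_m.+1 -> T -> V) x (v : m.-tuple T) :
  (\sum_(i < m.+1) f i (tnth (gcons (x, v)) i) =
  f ord0 x + \sum_(i < m) f (lift ord0 i) (tnth v i))%R.
Proof.
rewrite big_ord_recl; congr (_ + _)%R.
by apply: eq_bigr => i _; rewrite tnthS.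
Qed.

End Iid.

Section MoreMeasurable.
Context {R : realType}.

Lemma mvec_comp d d' (T : measurableType d) (T' : measurableType d') n
    (f : T' -> 'cV[R]_n) (u : T -> T') :
  mvec f -> measurable_fun setT u -> mvec (fun t => f (u t)).
Proof. by move=> mf mu i; exact: measurableT_comp (mf i) mu. Qed.

Lemma measurable_fun_tnth d d' (T : measurableType d) (T' : measurableType d') m
    (u : T -> m.-tuple T') i :
  measurable_fun setT u -> measurable_fun setT (fun t => tnth (u t) i).
Proof. by move=> mu; exact: measurableT_comp (measurable_tnth i) mu. Qed.

End MoreMeasurable.

(** [mv] extended to tuple and matrix entries, squares, scalar sums and maxima, and to vector
    functions whose measurability is in the context. *)
Ltac mv2 :=
  lazymatch goal with
  | |- mvec vec => exact: (mvec_vec (@measurable_id _ _ _))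
  | |- mvec (fun _ => vec _) => apply: mvec_vec; mv2
  | |- mvec (fun _ => consv _ _) => apply: mvec_cons; mv2
  | |- mvec (fun _ => _ *m _) => apply: mvec_mulmx; mv2
  | |- mvec (fun _ => _ *: _) => apply: mvecZ; mv2
  | |- mvec (fun _ => _ + _) => apply: mvecD; mv2
  | |- mvec (fun _ => - _) => apply: mvecN; mv2
  | |- mvec (fun _ => \sum_(_ <- _ | _) _) => apply: mvec_sum => ?; mv2
  | |- mvec (fun _ => _) =>
      first [exact: mvec_cst
            | match goal with H : mvec ?f |- mvec (fun t => ?f _) => apply: (mvec_comp H); mv2 end
            | idtac]
  | |- measurable_fun _ (fun _ => fst _) => apply: measurable_fun_fst; mv2
  | |- measurable_fun _ (fun _ => snd _) => apply: measurable_fun_snd; mv2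
  | |- measurable_fun _ (fun _ => tnth _ _) => apply: measurable_fun_tnth; mv2
  | |- measurable_fun _ (fun _ => (_ + _)%R) => apply: measurable_funD; mv2
  | |- measurable_fun _ (fun _ => (- _)%R) => apply: measurableT_comp; mv2
  | |- measurable_fun _ (fun _ => (_ * _)%R) => apply: measurable_funM; mv2
  | |- measurable_fun _ (fun _ => (_ ^+ 2)%R) => apply: measurable_funM; mv2
  | |- measurable_fun _ (fun _ => fun_of_matrix _ _ _) =>
      match goal with |- measurable_fun _ (fun t => fun_of_matrix (@?f t) ?i _) =>
        let H := fresh in have H : mvec f; [mv2 | exact: (H i)] end
  | |- measurable_fun _ (fun _ => \sum_(_ <- _ | _) _) => apply: measurable_sum => ?; mv2
  | |- measurable_fun _ (fun _ => dot _ _) => apply: measurable_dot; mv2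
  | |- measurable_fun _ (fun _ => max0 _ _) => apply: measurable_max0 => ?; mv2
  | |- measurable_fun _ (fun _ => gmax _ _) => apply: mvec_gmax; mv2
  | |- measurable_fun _ (fun _ => expR _) => apply: measurableT_comp; mv2
  | |- measurable_fun _ (fun _ => EFin _) => apply/measurable_EFinP; mv2
  | |- measurable_fun _ (fun x => x) => exact: measurable_id
  | |- measurable_fun _ (fun _ => ?c) => exact: measurable_cst
  | |- measurable_fun _ _ => try done
  | _ => idtac
  end.

(** * Linear, quadratic and clipped functionals of Gaussian samples *)

Section GaussianSamples.
Context {R : realType} d (T : measurableType d) (rho : probability T R).
Local Open Scope ereal_scope.
Notation RR := (measurableTypeR R).
Notation RT n := (n.-tuple RR).
Notation Gam := (@std_normal R).
Variables (n : nat) (z : T -> 'cV[R]_n).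
Hypotheses (mz : mvec z)
  (zlaw : forall F : 'cV[R]_n -> \bar R, vmeas F -> (forall v, 0 <= F v) ->
     \int[rho]_x F (z x) = \int[Gam n]_g F (vec g)).
Notation iid := (iid_prob rho).

(** The extra Gaussian term of size [tau] makes the induction close: by stability it absorbs one
    sample [c_i z_i], becoming a term of size [sqrt (tau^2 + c_i^2)]. *)
Lemma iid_linear m (c : 'I_m -> R) (tau : R) (F : 'cV[R]_n -> \bar R) :
  vmeas F -> (forall v, 0 <= F v) ->
  \int[iid m]_v \int[Gam n]_g F (tau *: vec g + \sum_(i < m) c i *: z (tnth v i))%R =
  \int[Gam n]_g F (Num.sqrt (tau ^+ 2 + \sum_(i < m) c i ^+ 2) *: vec g)%R.
Proof.
move=> mF F0; elim: m c tau => [|m IH] c tau.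
  under eq_integral do under eq_integral do rewrite big_ord0 addr0.
  rewrite integral_cst_prob big_ord0 addr0.
  have := std_normal_stable tau 0%R mF F0; rewrite expr0n addr0 => <-.
  apply: eq_integral => X _; under eq_integral do rewrite scale0r addr0.
  by rewrite integral_cst_prob.
pose G (v : m.+1.-tuple T) := \int[Gam n]_g F (tau *: vec g + \sum_(i < m.+1) c i *: z (tnth v i))%R.
have mG : measurable_fun setT G.
  apply: (measurable_integral_cons (F := fun v g => F (tau *: g + \sum_(i < m.+1) c i *: z (tnth v i))%R)) => //.
  by apply: vmeas_comp mF _; mv2.
have G0 v : 0 <= G v by exact: integral_ge0.
rewrite (integral_iidS rho mG G0).
pose s (v : m.-tuple T) := (\sum_(i < m) c (lift ord0 i) *: z (tnth v i))%R.
have ms : mvec s by rewrite /s; mv2.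
transitivity (\int[rho]_x \int[iid m]_v \int[Gam n]_g F (tau *: vec g + (c ord0 *: z x + s v))%R).
  apply: eq_integral => x _; apply: eq_integral => v _; apply: eq_integral => g _.
  by rewrite (sum_gcons (fun i t => c i *: z t)%R).
rewrite (tonelli rho (iid m) (f := fun x v => \int[Gam n]_g F (tau *: vec g + (c ord0 *: z x + s v))%R)); first last.
- by move=> x v; exact: integral_ge0.
- apply: (measurable_integral_cons (F := fun (y : T * m.-tuple T) g => F (tau *: g + (c ord0 *: z y.1 + s y.2))%R)) => //.
  by apply: vmeas_comp mF _; mv2.
pose tau' := Num.sqrt ((c ord0) ^+ 2 + tau ^+ 2)%R.
transitivity (\int[iid m]_v \int[Gam n]_g F (tau' *: vec g + s v)%R).
  apply: eq_integral => v _.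
  have mFs : vmeas (fun u => F (u + s v)%R) by apply: vmeas_comp mF _; mv2.
  rewrite -(std_normal_stable _ _ mFs (fun u => F0 _)).
  pose H u := \int[Gam n]_g F (tau *: vec g + (c ord0 *: u + s v))%R.
  have mH : vmeas H.
    apply: (measurable_integral_cons (F := fun (y : RT n) g => F (tau *: g + (c ord0 *: vec y + s v))%R)) => //.
    by apply: vmeas_comp mF _; mv2.
  have H0 u : 0 <= H u by exact: integral_ge0.
  rewrite (zlaw mH H0); apply: eq_integral => X _; apply: eq_integral => Y _.
  by rewrite addrCA addrA.
rewrite IH; apply: eq_integral => g _; congr (F (Num.sqrt _ *: _)%R).
rewrite sqr_sqrtr ?addr_ge0 ?sqr_ge0// big_ord_recl.
by rewrite [(_ + tau ^+ 2)%R]addrC addrA.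
Qed.

Lemma iid_linear0 m (c : 'I_m -> R) (F : 'cV[R]_n -> \bar R) :
  vmeas F -> (forall v, 0 <= F v) ->
  \int[iid m]_v F (\sum_(i < m) c i *: z (tnth v i))%R =
  \int[Gam n]_g F (Num.sqrt (\sum_(i < m) c i ^+ 2) *: vec g)%R.
Proof.
move=> mF F0; have := iid_linear c 0%R mF F0.
rewrite expr0n add0r => <-; apply: eq_integral => v _.
by under eq_integral do rewrite scale0r add0r; rewrite integral_cst_prob.
Qed.

Variables (hs : seq 'cV[R]_n) (t W : R).
Hypotheses (t0 : (0 < t)%R) (W0 : (0 <= W)%R)
  (hs_t : forall h, h \in hs -> (dot h h <= t ^+ 2)%R)
  (hW : \int[Gam n]_g (gmax hs (vec g))%:E <= W%:E).

Definition quad m (v : m.-tuple T) (h : 'cV[R]_n) : R := \sum_(i < m) dot (z (tnth v i)) h ^+ 2.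

(* [exp (l^2 |Z h|^2 / 2)] is the Gaussian average over [gam] in R^m of
   [exp (l <Z^T gam, h>)]; the supremum over [h] passes inside the average,
   where [Z^T gam] has the law of [|gam| g]. *)
Lemma iid_quad_exp m (A : R) : (0 <= A)%R ->
  \int[std_normal1 R]_x (expR (x ^+ 2 / 8))%:E <= A%:E ->
  \int[iid m]_v (expR (max0 hs (quad v) / (98 * t ^+ 2)))%:E <=
    (expR (W ^+ 2 / t ^+ 2) * A ^+ m)%:E.
Proof.
(* With [l = 1 / (7 t)], [gmax_mgf] gives the exponent [2 (r / 7) (W / t) + 4 r^2 / 49], at most
   [W^2 / t^2 + 5 r^2 / 49]; here [5 / 49 < 1 / 8], as [std_normal_expsq] requires. The [98] of the
   statement is [2 * 7^2]. *)
move=> A0 hA; pose l := ((7 * t)^-1)%R.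
have l0 : (0 < l)%R by rewrite invr_gt0 mulr_gt0.
have e0 (x : R) : 0 <= (expR x)%:E by rewrite lee_fin expR_ge0.
pose y (v : m.-tuple T) (u : 'cV[R]_m) := (\sum_(i < m) u i 0 *: z (tnth v i))%R.
have my : mvec (fun p : m.-tuple T * RT m => y p.1 (vec p.2)) by rewrite /y; mv2.
have mE : measurable_fun setT (fun p : m.-tuple T * RT m => (expR (l * gmax hs (y p.1 (vec p.2))))%:E).
  by mv2.
apply: (@le_trans _ _ (\int[iid m]_v \int[Gam m]_g (expR (l * gmax hs (y v (vec g))))%:E)).
  apply: le_ge0_integral => v; first exact: e0.
  have [->|[h hsh ->]] := max0_attained hs (quad v).
    rewrite mul0r expR0 -[leLHS](integral_std_normal_cst m); apply: le_ge0_integral => g //.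
    by rewrite lee_fin -expR0 ler_expR mulr_ge0 ?gmax_ge0 ?ltW.
  pose u : 'cV[R]_m := (\col_i (l * dot (z (tnth v i)) h))%R.
  have -> : (quad v h / (98 * t ^+ 2) = dot u u / 2)%R.
    have -> : dot u u = (\sum_(i < m) (l * dot (z (tnth v i)) h) ^+ 2)%R.
      by apply: eq_bigr => i _; rewrite [(u i 0)%R]mxE expr2.
    rewrite !mulr_suml; apply: eq_bigr => i _; rewrite /l.
    by field; rewrite gt_eqF.
  rewrite -std_normal_mgf; apply: le_ge0_integral => g; first exact: e0.
  rewrite lee_fin ler_expR.
  have -> : (dot (vec g) u = l * dot (y v (vec g)) h)%R.
    rewrite dot_suml mulr_sumr; apply: eq_bigr => i _.
    by rewrite dotZl [(u i 0)%R]mxE mulrCA.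
  by apply: ler_wpM2l; [exact: ltW|exact: (max0_ub (dot (y v (vec g))) hsh)].
rewrite (tonelli (iid m) (Gam m) mE); last by move=> *; exact: e0.
apply: (@le_trans _ _ (\int[Gam m]_g ((expR (W ^+ 2 / t ^+ 2))%:E * (expR (dot (vec g) (vec g) / 8))%:E))).
  apply: le_ge0_integral => g; first by apply: integral_ge0 => v _; exact: e0.
  have mF : vmeas (fun u => (expR (l * gmax hs u))%:E) by rewrite /vmeas; mv2.
  rewrite (iid_linear0 (fun i => vec g i 0)%R mF (fun u => e0 _)).
  have -> : (\sum_(i < m) (vec g i 0) ^+ 2 = dot (vec g) (vec g))%R.
    by apply: eq_bigr => i _; rewrite expr2.
  set r := Num.sqrt _; have r2 : (r ^+ 2 = dot (vec g) (vec g))%R by exact: sqr_norm2.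
  have r0 : (0 <= r)%R by exact: sqrtr_ge0.
  under eq_integral do rewrite gmaxZ// mulrA.
  have lr0 : (0 <= l * r)%R by rewrite mulr_ge0// ltW.
  apply: le_trans (gmax_mgf hs_t hW lr0 W0) _.
  rewrite -EFinM -expRD lee_fin ler_expR -r2 /l.
  have -> : (W ^+ 2 / t ^+ 2 = (W / t) ^+ 2)%R by rewrite expr_div_n.
  have -> : (2 * ((7 * t)^-1 * r) * W = 2 * (r / 7) * (W / t))%R by field; rewrite gt_eqF.
  have -> : (4 * ((7 * t)^-1 * r) ^+ 2 * t ^+ 2 = 4 / 49 * r ^+ 2)%R by field; rewrite gt_eqF.
  by have := sqr_ge0 (r / 7 - W / t); have := sqr_ge0 r; nra.
rewrite ge0_integralZl_EFin ?expR_ge0//; last by mv2.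
by rewrite EFinM lee_wpmul2l// std_normal_expsq.
Qed.

Section OneStep.
Variables (phi : T -> 'cV[R]_n -> R) (kappa : 'cV[R]_n -> R).
Hypotheses (mphi : forall h, measurable_fun setT (phi ^~ h))
  (phi0 : forall x h, (0 <= phi x h)%R)
  (phi_lip : forall x h h', (`|phi x h - phi x h'| <= `|dot (z x) h - dot (z x) h'|)%R)
  (phi_le : forall x h, (`|phi x h| <= `|dot (z x) h|)%R)
  (kappaE : forall h, \int[rho]_x (phi x h)%:E = (kappa h)%:E).

(** Contraction principle for one sign. At maximizers [h1], [h2] of the two left-hand maxima, the
    Lipschitz bound replaces [phi x h1 - phi x h2] by plus or minus the difference of the dot
    products; the sign decides which of them is tested in which right-hand maximum. The bounds on
    [phi] itself treat the maxima equal to the added 0. *)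
Lemma contraction (A : 'cV[R]_n -> R) x :
  (max0 hs (fun h => A h + 2 * phi x h) + max0 hs (fun h => A h - 2 * phi x h) <=
   max0 hs (fun h => A h + 2 * dot (z x) h) + max0 hs (fun h => A h - 2 * dot (z x) h))%R.
Proof.
set f1 := fun h => (A h + 2 * dot (z x) h)%R; set f2 := fun h => (A h - 2 * dot (z x) h)%R.
have n1 := max0_ge0 hs f1; have n2 := max0_ge0 hs f2.
have abs_le (a b : R) : (`|a| <= `|b| -> a <= b \/ a <= - b)%R.
  by case: (ger0P a); case: (ger0P b) => ? ? ?; [left|right|left|right]; lra.
have [->|[h1 s1 ->]] := max0_attained hs (fun h => A h + 2 * phi x h)%R;
  have [->|[h2 s2 ->]] := max0_attained hs (fun h => A h - 2 * phi x h)%R.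
- by rewrite addr0 addr_ge0.
- have := max0_ub f1 s2; have := max0_ub f2 s2; have := phi0 x h2; rewrite /f1 /f2.
  have := abs_le _ _ (phi_le x h2) => -[] ? ? ? ?; lra.
- have := max0_ub f1 s1; have := max0_ub f2 s1; rewrite /f1 /f2.
  have := abs_le _ _ (phi_le x h1) => -[] ? ? ?; lra.
- have := max0_ub f1 s1; have := max0_ub f2 s1; have := max0_ub f1 s2; have := max0_ub f2 s2.
  rewrite /f1 /f2; have := abs_le _ _ (phi_lip x h1 h2) => -[] ? ? ? ? ?; lra.
Qed.

(** [A + kappa - phi] is half the sum of [A + 2 kappa] and [A - 2 phi]. The first is at most the
    mean of [M1] by Jensen, the second at most [M2]. After integration [contraction] applies, and
    [D1], [D2] have equal means because the Gaussian vector is symmetric. *)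
Lemma symmetrization_step (A : 'cV[R]_n -> R) :
  \int[rho]_x (max0 hs (fun h => A h + (kappa h - phi x h)))%:E <=
  \int[Gam n]_g (max0 hs (fun h => A h + 2 * dot (vec g) h))%:E.
Proof.
pose M1 x := max0 hs (fun h => A h + 2 * phi x h)%R.
pose M2 x := max0 hs (fun h => A h - 2 * phi x h)%R.
pose D1 u := max0 hs (fun h => A h + 2 * dot u h)%R.
pose D2 u := max0 hs (fun h => A h - 2 * dot u h)%R.
have mM1 : measurable_fun setT (fun x => (M1 x)%:E).
  by apply/measurable_EFinP; apply: measurable_max0 => h; mv2.
have mM2 : measurable_fun setT (fun x => (M2 x)%:E).
  by apply/measurable_EFinP; apply: measurable_max0 => h; mv2.
have mD1 : vmeas (fun u => (D1 u)%:E) by rewrite /vmeas /D1; mv2.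
have mD2 : vmeas (fun u => (D2 u)%:E) by rewrite /vmeas /D2; mv2.
have M10 x : 0 <= (M1 x)%:E by rewrite lee_fin max0_ge0.
have M20 x : 0 <= (M2 x)%:E by rewrite lee_fin max0_ge0.
have D10 x : 0 <= (D1 x)%:E by rewrite lee_fin max0_ge0.
have D20 x : 0 <= (D2 x)%:E by rewrite lee_fin max0_ge0.
have half0 : (0 <= 2^-1 :> R)%R by rewrite invr_ge0.
pose J := \int[rho]_x (M1 x)%:E.
have J0 : 0 <= J by exact: integral_ge0.
have step x : (max0 hs (fun h => A h + (kappa h - phi x h)))%:E <=
    (2^-1)%:E * (J + (M2 x)%:E).
  have [->|[h hsh ->]] := max0_attained hs (fun h => A h + (kappa h - phi x h))%R.
    by apply: mule_ge0; [rewrite lee_fin|exact: adde_ge0].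
  have h1 : (A h + 2 * kappa h)%:E <= J.
    (* [A h] may be negative; its two parts are put on opposite sides to keep the integrands
       nonnegative. *)
    pose ep : R := Num.max (A h) 0%R; pose en : R := Num.max (- A h)%R 0%R.
    have epn : (A h = ep - en)%R by rewrite /ep /en; case: (leP (A h) 0%R); case: (leP (- A h)%R 0%R); lra.
    have ep0 : (0 <= ep)%R by rewrite le_max lexx orbT.
    have en0 : (0 <= en)%R by rewrite le_max lexx orbT.
    have : \int[rho]_x (ep%:E + 2%:E * (phi x h)%:E) <= \int[rho]_x ((M1 x)%:E + en%:E).
      apply: le_ge0_integral => x'; first by rewrite adde_ge0 ?mule_ge0 ?lee_fin.
      rewrite -EFinM -!EFinD lee_fin; have := max0_ub (fun h => A h + 2 * phi x' h)%R hsh.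
      by rewrite /M1 epn; lra.
    have mp : measurable_fun setT (fun x => (phi x h)%:E) by apply/measurable_EFinP.
    have en0' : 0 <= en%:E by rewrite lee_fin.
    have ep0' : 0 <= ep%:E by rewrite lee_fin.
    have p0' x' : 0 <= (phi x' h)%:E by rewrite lee_fin.
    have p2 x' : 0 <= 2%:E * (phi x' h)%:E by rewrite mule_ge0// lee_fin.
    have mp2 : measurable_fun setT (fun x' => 2%:E * (phi x' h)%:E).
      exact: emeasurable_funM.
    rewrite (ge0_integralD rho measurableT (fun x _ => M10 x) mM1 (fun _ _ => en0') (measurable_cst _)).
    rewrite (ge0_integralD rho measurableT (fun _ _ => ep0') (measurable_cst _) (fun x _ => p2 x) mp2).
    rewrite (ge0_integralZl_EFin rho measurableT (fun x _ => p0' x) mp)//.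
    rewrite kappaE !integral_cst_prob -/J -EFinM -EFinD -leeBlDr//.
    by rewrite -EFinB epn; congr (_ <= _); congr EFin; ring.
  have h2 : (A h - 2 * phi x h)%:E <= (M2 x)%:E.
    by rewrite lee_fin; exact: (max0_ub (fun h => A h - 2 * phi x h)%R hsh).
  apply: le_trans (lee_wpmul2l _ (leeD h1 h2)); last by rewrite lee_fin.
  by rewrite -EFinD -EFinM lee_fin; lra.
apply: (@le_trans _ _ (\int[rho]_x ((2^-1)%:E * (J + (M2 x)%:E)))).
  by apply: le_ge0_integral => // x; rewrite lee_fin max0_ge0.
have JM0 x : 0 <= J + (M2 x)%:E by rewrite adde_ge0.
have mJM : measurable_fun setT (fun x => J + (M2 x)%:E).
  by apply: emeasurable_funD => //; exact: measurable_cst.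
rewrite (ge0_integralZl_EFin rho measurableT (fun x _ => JM0 x) mJM half0).
rewrite (ge0_integralD rho measurableT (fun x _ => J0) (measurable_cst _) (fun x _ => M20 x) mM2).
rewrite integral_cst_prob /J -(ge0_integralD rho measurableT (fun x _ => M10 x) mM1 (fun x _ => M20 x) mM2).
have h3 : \int[rho]_x ((M1 x)%:E + (M2 x)%:E) <= \int[rho]_x ((D1 (z x))%:E + (D2 (z x))%:E).
  apply: le_ge0_integral => x; first by rewrite adde_ge0.
  by rewrite -!EFinD lee_fin; exact: contraction.
have half0' : 0 <= (2^-1)%:E :> \bar R by rewrite lee_fin.
apply: le_trans (lee_wpmul2l half0' h3) _.
rewrite (zlaw (F := fun u => (D1 u)%:E + (D2 u)%:E)); last 2 first.
- exact: emeasurable_funD.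
- by move=> u; rewrite adde_ge0.
rewrite (ge0_integralD (Gam n) measurableT (fun g _ => D10 _) mD1 (fun g _ => D20 _) mD2).
have <- : \int[Gam n]_g (D1 (vec g))%:E = \int[Gam n]_g (D2 (vec g))%:E.
  rewrite -(std_normalN mD1 D10); apply: eq_integral => g _; congr (_%:E).
  by apply: eq_max0 => h; rewrite dotNl mulrN.
set I := \int[Gam n]_g _; have I0 : 0 <= I by exact: integral_ge0.
case: I I0 => [r| |] // I0; last by rewrite leey.
by rewrite -EFinD -EFinM lee_fin; lra.
Qed.

(** Each sample is exchanged for [2 g] with [g] a fresh Gaussian vector, which stability merges with
    [tau g]: every step adds 4 to [tau ^+ 2]. The samples still to be treated play the part of [A]
    in [symmetrization_step]. *)
Lemma symmetrization_iter m (tau : R) : (0 <= tau)%R ->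
  \int[iid m]_v \int[Gam n]_g
    (max0 hs (fun h => tau * dot (vec g) h + \sum_(i < m) (kappa h - phi (tnth v i) h)))%:E <=
  \int[Gam n]_g (gmax hs (Num.sqrt (tau ^+ 2 + 4 * m%:R) *: vec g)%R)%:E.
Proof.
elim: m tau => [|m IH] tau tau0.
  rewrite mulr0 addr0 sqrtr_sqr ger0_norm//.
  apply: (@le_trans _ _ (\int[iid 0]_v \int[Gam n]_g (gmax hs (tau *: vec g)%R)%:E)).
    apply: le_ge0_integral => v; first by apply: integral_ge0 => g _; rewrite lee_fin max0_ge0.
    apply: le_ge0_integral => g; first by rewrite lee_fin max0_ge0.
    by rewrite lee_fin; apply: le_max0 => h _; rewrite big_ord0 addr0 dotZl.
  by rewrite integral_cst_prob.
pose S m (v : m.-tuple T) h := (\sum_(i < m) (kappa h - phi (tnth v i) h))%R.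
have mS k d' (T' : measurableType d') (u : T' -> k.-tuple T) h :
    measurable_fun setT u -> measurable_fun setT (fun x => S k (u x) h).
  move=> mu; apply: measurable_sum => i; apply: measurable_funB; first exact: measurable_cst.
  by apply: measurableT_comp (mphi h) _; mv2.
pose G (v : m.+1.-tuple T) := \int[Gam n]_g (max0 hs (fun h => tau * dot (vec g) h + S m.+1 v h))%:E.
have mG : measurable_fun setT G.
  apply: (measurable_integral_cons (F := fun v g => (max0 hs (fun h => tau * dot g h + S m.+1 v h))%:E)).
    by mv2; apply: mS; mv2.
  by move=> *; rewrite lee_fin max0_ge0.
have G0 v : 0 <= G v by apply: integral_ge0 => g _; rewrite lee_fin max0_ge0.
rewrite (integral_iidS rho mG G0).
pose H x (p : m.-tuple T * RT n) :=
  (max0 hs (fun h => (tau * dot (vec p.2) h + S m p.1 h) + (kappa h - phi x h)))%:E.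
have H0 x p : 0 <= H x p by rewrite lee_fin max0_ge0.
have mH : measurable_fun setT (fun q : T * (m.-tuple T * RT n) => H q.1 q.2).
  apply/measurable_EFinP; apply: measurable_max0 => h; apply: measurable_funD.
    by mv2; apply: mS; mv2.
  apply: measurable_funB; first exact: measurable_cst.
  by apply: measurableT_comp (mphi h) _; mv2.
have -> : \int[rho]_x \int[iid m]_v G (gcons (x, v)) =
    \int[iid m]_v \int[Gam n]_g \int[rho]_x H x (v, g).
  transitivity (\int[rho]_x \int[iid m]_v \int[Gam n]_g H x (v, g)).
    apply: eq_integral => x _; apply: eq_integral => v _; apply: eq_integral => g _.
    congr (_%:E); apply: eq_max0 => h.
    by rewrite /S (sum_gcons (fun _ y => kappa h - phi y h)%R) addrA addrAC.
  rewrite (tonelli rho (iid m) (f := fun x v => \int[Gam n]_g H x (v, g))); first last.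
  - by move=> x v; exact: integral_ge0.
  - apply: (measurable_integral_snd (Gam n) (f := fun (q : T * m.-tuple T) g => H q.1 (q.2, g))) => //.
    apply: (measurable_fun2 (f := H)) => //; first by mv2.
    by apply: measurable_fun_pair; mv2.
  apply: eq_integral => v _.
  rewrite (tonelli rho (Gam n) (f := fun x g => H x (v, g)))//.
  apply: (measurable_fun2 (f := H)) => //.
  by apply: measurable_fun_pair; mv2.
pose tau' := Num.sqrt (tau ^+ 2 + 2 ^+ 2)%R.
have tau'2 : (tau' ^+ 2 = tau ^+ 2 + 4)%R.
  by rewrite sqr_sqrtr ?addr_ge0 ?sqr_ge0// -natrX.
have -> : (tau ^+ 2 + 4 * m.+1%:R = tau' ^+ 2 + 4 * m%:R)%R.
  by rewrite tau'2 -natr1; ring.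
apply: le_trans (IH tau' (sqrtr_ge0 _)).
apply: le_ge0_integral => v.
  by apply: integral_ge0 => g _; apply: integral_ge0 => x _; exact: H0.
pose F u := (max0 hs (fun h => dot u h + S m v h))%:E.
have mF : vmeas F by rewrite /vmeas /F; mv2.
have F0 u : 0 <= F u by rewrite lee_fin max0_ge0.
have := std_normal_stable tau 2 mF F0; rewrite -/tau' => E.
have {}E : \int[Gam n]_X \int[Gam n]_Y F (tau *: vec X + 2 *: vec Y)%R =
   \int[Gam n]_g (max0 hs (fun h => tau' * dot (vec g) h + \sum_(i < m) (kappa h - phi (tnth v i) h)))%:E.
  rewrite E; apply: eq_integral => g _; congr (_%:E); apply: eq_max0 => h.
  by rewrite dotZl.
rewrite -E; apply: le_ge0_integral => g.
  by apply: integral_ge0 => x _; exact: H0.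
apply: le_trans (symmetrization_step _) _.
apply: le_ge0_integral => g'; first by rewrite lee_fin max0_ge0.
rewrite lee_fin; apply: le_max0 => h _.
by rewrite dotDl !dotZl addrAC.
Qed.

Lemma symmetrization m :
  \int[iid m]_v (max0 hs (fun h => \sum_(i < m) (kappa h - phi (tnth v i) h)))%:E <=
  (2 * Num.sqrt m%:R * W)%:E.
Proof.
have := symmetrization_iter m (lexx 0%R).
under eq_integral => v _.
  under eq_integral => g _ do under eq_max0 => h do rewrite mul0r add0r.
  rewrite integral_cst_prob; over.
move=> /le_trans; apply.
rewrite expr0n add0r sqrtrM// (_ : 4 = 2 ^+ 2)%R ?sqrtr_sqr ?ger0_norm//; last by rewrite -natrX.
under eq_integral do rewrite gmaxZ ?mulr_ge0 ?sqrtr_ge0// EFinM.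
rewrite ge0_integralZl_EFin ?mulr_ge0 ?sqrtr_ge0//; last 2 first.
- by move=> *; rewrite lee_fin gmax_ge0.
- by mv2.
by rewrite [leRHS]EFinM lee_wpmul2l// lee_fin mulr_ge0 ?sqrtr_ge0.
Qed.

End OneStep.

End GaussianSamples.

(** * Markov's inequality, second moments and multiplier sums *)

Section Markov.
Context {R : realType} d (T : measurableType d) (P : probability T R).
Local Open Scope ereal_scope.

Lemma measurable_cst_le (f : T -> R) (a : R) :
  measurable_fun setT f -> measurable [set x | (a <= f x)%R].
Proof.
move=> mf; rewrite -[X in measurable X]setTI.
by apply: measurable_fun_le => //; exact: measurable_cst.
Qed.

Lemma measurable_le_cst (f : T -> R) (a : R) :
  measurable_fun setT f -> measurable [set x | (f x <= a)%R].
Proof.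
move=> mf; rewrite -[X in measurable X]setTI.
by apply: measurable_fun_le => //; exact: measurable_cst.
Qed.

Lemma markov_bound (f : T -> R) (a B : R) :
  measurable_fun setT f -> (forall x, (0 <= f x)%R) -> (0 < a)%R ->
  \int[P]_x (f x)%:E <= B%:E -> P [set x | (a <= f x)%R] <= (B / a)%:E.
Proof.
move=> mf f0 a0 hB.
have mA : measurable [set x | (a <= f x)%R].
  exact: measurable_cst_le.
rewrite mulrC EFinM lee_pdivlMl//.
apply: le_trans hB.
have -> : a%:E * P [set x | (a <= f x)%R] = \int[P]_x (a * \1_[set x | (a <= f x)%R] x)%:E.
  under eq_integral do rewrite EFinM.
  rewrite (ge0_integralZl_EFin P measurableT (f1 := fun x => (\1_[set x | (a <= f x)%R] x)%:E)).
  - by rewrite integral_indic// setIT.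
  - by move=> x _; rewrite lee_fin indicE.
  - exact/measurable_EFinP/measurable_indic.
  - exact: ltW.
apply: le_ge0_integral => x; rewrite lee_fin indicE; last first.
  by case: (boolP (x \in _)); rewrite ?mulr0// inE/= mulr1.
by rewrite mulr_ge0// ltW.
Qed.

End Markov.

Section IidSums.
Context {R : realType} d (T : measurableType d) (rho : probability T R).
Local Open Scope ereal_scope.
Notation RR := (measurableTypeR R).
Notation RT n := (n.-tuple RR).
Notation Gam := (@std_normal R).
Notation iid := (iid_prob rho).

Lemma iid_second_moment (phi : T -> RR) (e2 : R) m :
  measurable_fun setT phi -> rho.-integrable setT (EFin \o phi) ->
  \int[rho]_x (phi x)%:E = 0 -> \int[rho]_x (phi x ^+ 2)%:E = e2%:E ->
  \int[iid m]_v ((\sum_(i < m) phi (tnth v i)) ^+ 2)%:E = (m%:R * e2)%:E.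
Proof.
move=> mphi iphi E1 E2; elim: m => [|m IH].
  by under eq_integral do rewrite big_ord0 expr0n/=; rewrite integral_cst_prob mul0r.
pose S k (v : k.-tuple T) := (\sum_(i < k) phi (tnth v i))%R.
have mS k : measurable_fun setT (S k).
  by apply: measurable_sum => i; apply: measurableT_comp mphi _; mv2.
have mG : measurable_fun setT (fun v : m.+1.-tuple T => (S m.+1 v ^+ 2)%:E).
  by apply/measurable_EFinP; apply: measurable_funM; exact: mS.
have G0 (v : m.+1.-tuple T) : 0 <= (S m.+1 v ^+ 2)%:E by rewrite lee_fin sqr_ge0.
rewrite (integral_iidS rho mG G0).
have -> : \int[rho]_x \int[iid m]_v (S m.+1 (gcons (x, v)) ^+ 2)%:E =
    \int[rho]_x \int[iid m]_v ((phi x + S m v) ^+ 2)%:E.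
  apply: eq_integral => x _; apply: eq_integral => v _.
  by rewrite /S (sum_gcons (fun _ y => phi y)).
rewrite (tonelli rho (iid m) (f := fun x v => ((phi x + S m v) ^+ 2)%:E)); first last.
- by move=> *; rewrite lee_fin sqr_ge0.
- apply/measurable_EFinP; apply: measurable_funM; apply: measurable_funD;
    by [apply: measurableT_comp mphi _|apply: measurableT_comp (mS m) _].
have i2 : rho.-integrable setT (fun x => (phi x ^+ 2)%:E).
  apply/integrableP; split; first by apply/measurable_EFinP; apply: measurable_funM.
  under eq_integral => x _ do rewrite gee0_abs ?lee_fin ?sqr_ge0//.
  by rewrite E2 ltry.
have step v : \int[rho]_x ((phi x + S m v) ^+ 2)%:E = e2%:E + (S m v ^+ 2)%:E.
  set s := S m v.
  transitivity (\int[rho]_x ((phi x ^+ 2)%:E + ((2 * s)%:E * (phi x)%:E + (s ^+ 2)%:E))).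
    by apply: eq_integral => x _; rewrite -EFinM -!EFinD; congr EFin; ring.
  have ic : rho.-integrable setT (fun _ : T => (s ^+ 2)%:E).
    exact: finite_measure_integrable_cst.
  have i1 : rho.-integrable setT (fun x => (2 * s)%:E * (phi x)%:E).
    exact: integrableZl.
  rewrite integralD//; last exact: integrableD.
  by rewrite integralD// integralZl// E1 E2 mule0 add0e integral_cst_prob.
under eq_integral do rewrite step.
rewrite (ge0_integralD (iid m) measurableT); first last.
- by apply/measurable_EFinP; apply: measurable_funM; exact: mS.
- by move=> v _; rewrite lee_fin sqr_ge0.
- exact: measurable_cst.
- move=> v _; rewrite -E2; apply: integral_ge0 => x _; rewrite lee_fin; exact: sqr_ge0.
by rewrite integral_cst_prob IH -EFinD -natr1; congr EFin; ring.
Qed.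

Variables (n : nat) (q : T -> 'cV[R]_n) (c : T -> RR).
Hypotheses (mq : mvec q) (mc : measurable_fun setT c)
  (qlaw : forall F : RR -> 'cV[R]_n -> \bar R,
     measurable_fun setT (fun y : RR * RT n => F y.1 (vec y.2)) ->
     (forall y v, 0 <= F y v) ->
     \int[rho]_x F (c x) (q x) = \int[rho]_x \int[Gam n]_g F (c x) (vec g)).
Variables (hs : seq 'cV[R]_n) (W s2 : R).
Hypotheses (W0 : (0 <= W)%R) (hW : \int[Gam n]_g (gmax hs (vec g))%:E <= W%:E)
  (s20 : (0 <= s2)%R) (hs2 : \int[rho]_x (c x ^+ 2)%:E <= s2%:E).

(** Given the multipliers, the sum is a Gaussian vector of size the root of [tau^2 + sum c_i^2].
    Bounding [sqrt u] by [(u + a^2) / (2 a)] makes the estimate affine in the squares, so that each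
    step needs only the second moment of [c]; [a] is chosen at the end. *)
Lemma iid_multiplier_iter m (tau a : R) : (0 < a)%R -> (0 <= tau)%R ->
  \int[iid m]_v \int[Gam n]_g
     (gmax hs (tau *: vec g + \sum_(i < m) c (tnth v i) *: q (tnth v i))%R)%:E <=
  (W * ((m%:R * s2 + tau ^+ 2 + a ^+ 2) / (2 * a)))%:E.
Proof.
move=> a0; elim: m tau => [|m IH] tau tau0.
  under eq_integral do under eq_integral do rewrite big_ord0 addr0 gmaxZ// EFinM.
  rewrite integral_cst_prob ge0_integralZl_EFin//; last 2 first.
  - by move=> *; rewrite lee_fin gmax_ge0.
  - by mv2.
  have t0' : 0 <= tau%:E by rewrite lee_fin.
  apply: le_trans (lee_wpmul2l t0' hW) _.
  rewrite -EFinM lee_fin mul0r add0r mulrC ler_wpM2l//.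
  rewrite ler_pdivlMr ?mulr_gt0//.
  by have := sqr_ge0 (tau - a); nra.
pose F u := (gmax hs u)%:E.
have mF : vmeas F by rewrite /vmeas /F; mv2.
have F0 u : 0 <= F u by rewrite lee_fin gmax_ge0.
pose G (v : m.+1.-tuple T) := \int[Gam n]_g F (tau *: vec g + \sum_(i < m.+1) c (tnth v i) *: q (tnth v i))%R.
have mcq k (i : 'I_k) : mvec (fun v : k.-tuple T => (c (tnth v i) *: q (tnth v i))%R).
  by apply: mvecZ; [apply: measurableT_comp mc _; mv2|mv2].
have msum k : mvec (fun v : k.-tuple T => (\sum_(i < k) c (tnth v i) *: q (tnth v i))%R).
  by apply: mvec_sum => i; exact: mcq.
have mG : measurable_fun setT G.
  apply: (measurable_integral_cons (F := fun v g => F (tau *: g + \sum_(i < m.+1) c (tnth v i) *: q (tnth v i))%R)) => //.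
  apply: vmeas_comp mF _; apply: mvecD; first by mv2.
  by apply: (mvec_comp (msum _)); mv2.
have G0 v : 0 <= G v by exact: integral_ge0.
rewrite (integral_iidS rho mG G0).
pose s (v : m.-tuple T) := (\sum_(i < m) c (tnth v i) *: q (tnth v i))%R.
have ms : mvec s by exact: msum.
pose H x v := \int[Gam n]_g F (tau *: vec g + (c x *: q x + s v))%R.
pose K (x : T) (v : m.-tuple T) := \int[Gam n]_g F (Num.sqrt (c x ^+ 2 + tau ^+ 2) *: vec g + s v)%R.
have H0 x v : 0 <= H x v by exact: integral_ge0.
have K0 x v : 0 <= K x v by exact: integral_ge0.
have mtau : measurable_fun setT (fun x => Num.sqrt (c x ^+ 2 + tau ^+ 2) : RR).
  apply: (measurableT_comp (f := @Num.sqrt R)).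
    exact: continuous_measurable_fun (@sqrt_continuous R).
  by apply: measurable_funD => //; apply: measurable_funM.
apply: (@le_trans _ _ (\int[rho]_x \int[iid m]_v H x v)).
  rewrite le_eqVlt; apply/orP; left; apply/eqP.
  apply: eq_integral => x _; apply: eq_integral => v _; apply: eq_integral => g _.
  by rewrite (sum_gcons (fun _ y => c y *: q y)%R).
have -> : \int[rho]_x \int[iid m]_v H x v = \int[rho]_x \int[iid m]_v K x v.
  rewrite (tonelli rho (iid m) (f := H) _ H0); last first.
    apply: (measurable_integral_cons (F := fun (y : T * m.-tuple T) g => F (tau *: g + (c y.1 *: q y.1 + s y.2))%R)) => //.
    apply: vmeas_comp mF _; apply: mvecD; first by mv2.
    apply: mvecD; last by mv2.
    by apply: mvecZ; [apply: measurableT_comp mc _; mv2|mv2].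
  rewrite (tonelli rho (iid m) (f := K) _ K0); last first.
    apply: (measurable_integral_cons (F := fun (y : T * m.-tuple T) g => F (Num.sqrt (c y.1 ^+ 2 + tau ^+ 2) *: g + s y.2)%R)) => //.
    apply: vmeas_comp mF _; apply: mvecD; last by mv2.
    by apply: mvecZ; [apply: measurableT_comp mtau _; mv2|mv2].
  apply: eq_integral => v _.
  have mFs : vmeas (fun u => F (u + s v)%R) by apply: vmeas_comp mF _; mv2.
  rewrite /H (qlaw (F := fun y u => \int[Gam n]_g F (tau *: vec g + (y *: u + s v))%R)); last 2 first.
  - apply: (measurable_integral_cons (F := fun (y : RR * RT n) g => F (tau *: g + (y.1 *: vec y.2 + s v))%R)) => //.
    by apply: vmeas_comp mF _; mv2.
  - by move=> *; exact: integral_ge0.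
  apply: eq_integral => x _.
  rewrite /K -(std_normal_stable _ _ mFs (fun u => F0 _)).
  apply: eq_integral => X _; apply: eq_integral => Y _.
  by rewrite addrCA addrA.
have B0 : (0 <= W / (2 * a))%R by rewrite divr_ge0// mulr_ge0// ltW.
have mc2 : measurable_fun setT (fun x => (c x ^+ 2)%:E).
  by apply/measurable_EFinP; apply: measurable_funM.
pose C := (m%:R * s2 + tau ^+ 2 + a ^+ 2)%R.
have C0 : (0 <= C)%R by rewrite !addr_ge0 ?sqr_ge0// mulr_ge0.
apply: (@le_trans _ _ (\int[rho]_x ((W / (2 * a))%:E * ((c x ^+ 2)%:E + C%:E)))).
  apply: le_ge0_integral => x; first by apply: integral_ge0 => v _; exact: K0.
  apply: le_trans (IH _ (sqrtr_ge0 _)) _.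
  rewrite sqr_sqrtr ?addr_ge0 ?sqr_ge0// -EFinD -EFinM lee_fin /C.
  by rewrite mulrA [(W * _)%R]mulrC -!mulrA; lra.
have c20 x : 0 <= (c x ^+ 2)%:E by rewrite lee_fin; exact: sqr_ge0.
have C0' : 0 <= C%:E by rewrite lee_fin.
have cC x : 0 <= (c x ^+ 2)%:E + C%:E by rewrite adde_ge0.
have mcC : measurable_fun setT (fun x => (c x ^+ 2)%:E + C%:E).
  by apply: emeasurable_funD => //; exact: measurable_cst.
rewrite (ge0_integralZl_EFin rho measurableT (fun x _ => cC x) mcC B0).
rewrite (ge0_integralD rho measurableT (fun x _ => c20 x) mc2 (fun _ _ => C0') (measurable_cst _)).
rewrite integral_cst_prob.
have B0' : 0 <= (W / (2 * a))%:E by rewrite lee_fin.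
apply: le_trans (lee_wpmul2l B0' (leeD2r _ hs2)) _.
rewrite -EFinD -EFinM lee_fin /C -natr1.
by rewrite le_eqVlt; apply/orP; left; apply/eqP; field; rewrite gt_eqF.
Qed.

Lemma iid_multiplier m (a : R) : (0 < a)%R -> (m%:R * s2 <= a ^+ 2)%R ->
  \int[iid m]_v (gmax hs (\sum_(i < m) c (tnth v i) *: q (tnth v i))%R)%:E <= (W * a)%:E.
Proof.
move=> a0 ha; have := iid_multiplier_iter m a0 (lexx 0%R).
under eq_integral => v _.
  under eq_integral => g _ do rewrite scale0r add0r.
  rewrite integral_cst_prob; over.
move=> /le_trans; apply; rewrite lee_fin ler_wpM2l// expr0n addr0.
by rewrite ler_pdivrMr ?mulr_gt0//; nra.
Qed.

End IidSums.

(** * The canonical sample *)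

Section CanonicalSample.
Context {R : realType} d (S : measurableType d) (Q : probability S R).
Local Open Scope ereal_scope.
Notation RR := (measurableTypeR R).
Notation RT n := (n.-tuple RR).
Notation gam := (std_normal1 R).
Notation Gam := (@std_normal R).
Variable n : nat.
Notation T := (RT n.+1 * S)%type.
Notation rho := (Gam n.+1 \x Q).

Definition sample_vec (x : T) : 'cV[R]_n.+1 := vec x.1.
Definition sample_head (x : T) : RR := (vec x.1 (lshift n (ord0 : 'I_1)) 0)%R.
Definition sample_tail (x : T) : 'cV[R]_n := (\col_i vec x.1 (rshift 1 i) 0)%R.

Lemma sample_vecE x : sample_vec x = consv (sample_head x) (sample_tail x).
Proof.
rewrite /sample_vec /sample_head /sample_tail.
have [y [v ->]] := consv_eta (vec x.1); rewrite consvEu; congr (consv _ _).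
by apply/matrixP => i j; rewrite ord1 [RHS]mxE consvEd.
Qed.

Lemma mvec_sample_vec : mvec sample_vec. Proof. by rewrite /sample_vec; mv2. Qed.

Lemma measurable_sample_head : measurable_fun setT sample_head.
Proof. exact: (mvec_sample_vec _). Qed.

Lemma mvec_sample_tail : mvec sample_tail.
Proof.
move=> i; rewrite (_ : (fun _ => _) = (fun x => sample_vec x (rshift 1 i) 0%R)); last first.
  by apply/funext => x; rewrite mxE.
exact: mvec_sample_vec.
Qed.

Lemma integral_sample_vec (F : 'cV[R]_n.+1 -> \bar R) :
  vmeas F -> (forall v, 0 <= F v) ->
  \int[rho]_x F (sample_vec x) = \int[Gam n.+1]_g F (vec g).
Proof.
move=> mF F0.
rewrite (ge0_integral_prod (Gam n.+1) Q (f := fun x => F (sample_vec x))); last 2 first.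
- exact: vmeas_comp mF mvec_sample_vec.
- by move=> x; exact: F0.
by apply: eq_integral => g _; exact: (integral_cst_prob Q (F (vec g))).
Qed.

(** The observation depends only on the first coordinate and the seed; this separates them from the
    remaining coordinates, which are independent of them. *)
Lemma integral_sample_split (F : RR -> S -> 'cV[R]_n -> \bar R) :
  measurable_fun setT (fun y : RR * S * RT n => F y.1.1 y.1.2 (vec y.2)) ->
  (forall s w v, 0 <= F s w v) ->
  \int[rho]_x F (sample_head x) x.2 (sample_tail x) =
  \int[gam \x Q]_y \int[Gam n]_g F y.1 y.2 (vec g).
Proof.
move=> mF F0.
have mtl : measurable_fun setT (fun x => unvec (sample_tail x) : RT n).
  exact: mvec_unvec mvec_sample_tail.
have mF' : measurable_fun setT (fun x : T => F (sample_head x) x.2 (sample_tail x)).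
  under eq_fun do rewrite -[sample_tail _]unvecK.
  have mhd : measurable_fun setT (fun x : T => (sample_head x, x.2)).
    by apply: measurable_fun_pair => //; exact: measurable_sample_head.
  exact: (measurable_fun2 (f := fun (y : RR * S) (g : RT n) => F y.1 y.2 (vec g)) mF mhd mtl).
rewrite (ge0_integral_prod (Gam n.+1) Q (f := fun x : T => F (sample_head x) x.2 (sample_tail x)) mF'); last by move=> x; exact: F0.
pose H (v : 'cV[R]_n.+1) := \int[Q]_w F (v (lshift n (ord0 : 'I_1)) 0%R) w (\col_i v (rshift 1 i) 0%R).
have mH : vmeas H.
  exact: (measurable_integral_snd Q (f := fun (g : RT n.+1) w => F (sample_head (g, w)) w (sample_tail (g, w)))).
have H0 v : 0 <= H v by exact: integral_ge0.
rewrite [LHS](integral_std_normalS mH H0).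
have Hc x v : H (consv x v) = \int[Q]_w F x w v.
  rewrite /H consvEu; apply: eq_integral => w _; congr F.
  by apply/matrixP => i j; rewrite ord1 mxE consvEd.
under eq_integral => x _ do under eq_integral => g _ do rewrite Hc.
have mF2 : measurable_fun setT (fun y => \int[Gam n]_g F y.1 y.2 (vec g)).
  exact: (measurable_integral_cons (F := fun (y : RR * S) g => F y.1 y.2 g)).
rewrite (ge0_integral_prod gam Q (f := fun y => \int[Gam n]_g F y.1 y.2 (vec g)) mF2); last first.
  by move=> y; exact: integral_ge0.
apply: eq_integral => x _.
have mFx : measurable_fun setT (fun z : RT n * S => F x z.2 (vec z.1)).
  have mp : measurable_fun setT (fun z : RT n * S => (x, z.2) : RR * S).
    by apply: measurable_fun_pair => //; exact: measurable_cst.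
  exact: (measurable_fun2 (f := fun (y : RR * S) (g : RT n) => F y.1 y.2 (vec g)) mF mp measurable_fst).
exact: (tonelli (Gam n) Q (f := fun (g : RT n) w => F x w (vec g)) mFx).
Qed.

Lemma integral_sample_head (F : RR -> S -> \bar R) :
  measurable_fun setT (fun y => F y.1 y.2) -> (forall s w, 0 <= F s w) ->
  \int[rho]_x F (sample_head x) x.2 = \int[gam \x Q]_y F y.1 y.2.
Proof.
move=> mF F0.
rewrite (integral_sample_split (F := fun s w _ => F s w))//; last first.
  by apply: measurable_fun2 mF _ _ => //; mv2.
by apply: eq_integral => y _; rewrite integral_cst_prob.
Qed.

Lemma integral_sample_indep (c0 : RR -> S -> RR) (F : RR -> 'cV[R]_n -> \bar R) :
  measurable_fun setT (fun y => c0 y.1 y.2) ->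
  measurable_fun setT (fun y : RR * RT n => F y.1 (vec y.2)) ->
  (forall y v, 0 <= F y v) ->
  \int[rho]_x F (c0 (sample_head x) x.2) (sample_tail x) =
  \int[rho]_x \int[Gam n]_g F (c0 (sample_head x) x.2) (vec g).
Proof.
move=> mc mF F0.
rewrite (integral_sample_split (F := fun s w v => F (c0 s w) v))//; last first.
  apply: (measurable_fun2 (f := fun y (g : RT n) => F y (vec g)) mF) => //.
  by apply: measurable_fun2 mc _ _; mv2.
rewrite (integral_sample_head (F := fun s w => \int[Gam n]_g F (c0 s w) (vec g)))//.
- apply: (measurable_integral_cons (F := fun (y : RR * S) g => F (c0 y.1 y.2) g)) => //.
  apply: (measurable_fun2 (f := fun y (g : RT n) => F y (vec g)) mF) => //.
  by apply: measurable_fun2 mc _ _; mv2.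
- by move=> *; exact: integral_ge0.
Qed.

Definition tailv (h : 'cV[R]_n.+1) : 'cV[R]_n := (\col_i h (rshift 1 i) 0)%R.

Lemma consv_tailv (h : 'cV[R]_n.+1) : h = consv (h (lshift n (ord0 : 'I_1)) 0%R) (tailv h).
Proof.
have [x [u ->]] := consv_eta h; rewrite consvEu; congr (consv _ _).
by apply/matrixP => i j; rewrite ord1 mxE consvEd.
Qed.

(* Averaging over the sign of the first coordinate. *)
Lemma gmax_tail (hs : seq 'cV[R]_n.+1) :
  \int[Gam n]_g (gmax (map tailv hs) (vec g))%:E <= \int[Gam n.+1]_g (gmax hs (vec g))%:E.
Proof.
pose F v := (gmax hs v)%:E.
have mF : vmeas F by rewrite /vmeas /F; mv2.
have F0 v : 0 <= F v by rewrite lee_fin gmax_ge0.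
have I0 x : 0 <= \int[Gam n]_g F (consv x (vec g)) by exact: integral_ge0.
have mI : measurable_fun setT (fun x : RR => \int[Gam n]_g F (consv x (vec g))).
  apply: (measurable_integral_cons (F := fun (x : RR) v => F (consv x v))) => //.
  by apply: vmeas_comp mF _; mv2.
rewrite (integral_std_normalS mF F0).
have half0 : (0 <= 2^-1 :> R)%R by rewrite invr_ge0.
have -> : \int[gam]_x \int[Gam n]_g F (consv x (vec g)) =
    \int[gam]_x ((2^-1)%:E * (\int[Gam n]_g F (consv x (vec g)) + \int[Gam n]_g F (consv (- x)%R (vec g)))).
  have mIN : measurable_fun setT (fun x : RR => \int[Gam n]_g F (consv (- x)%R (vec g))).
    by apply: (measurableT_comp mI).
  rewrite ge0_integralZl_EFin//; last 2 first.
  - by move=> x _; rewrite adde_ge0.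
  - exact: emeasurable_funD.
  rewrite (ge0_integralD gam measurableT (fun x _ => I0 x) mI (fun x _ => I0 _) mIN).
  rewrite (std_normal1N mI I0).
  set I := \int[gam]_x _; have : 0 <= I by exact: integral_ge0.
  case: I => [r| |]// _; first by rewrite -EFinD -EFinM; congr EFin; field.
  by rewrite addye// gt0_muley// lte_fin invr_gt0.
rewrite -[leLHS](integral_cst_prob gam); apply: le_ge0_integral => x.
  by apply: integral_ge0 => g _; rewrite lee_fin gmax_ge0.
have mc y : measurable_fun setT (fun g : RT n => F (consv y (vec g))) by exact: vmeas_consl.
rewrite -(ge0_integralD (Gam n) measurableT (fun g _ => F0 _) (mc x) (fun g _ => F0 _) (mc (- x)%R)).
rewrite -ge0_integralZl_EFin//; last 2 first.
- by move=> g _; rewrite adde_ge0.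
- exact: emeasurable_funD.
apply: le_ge0_integral => g; first by rewrite lee_fin gmax_ge0.
rewrite /F -EFinD -EFinM lee_fin; apply: max0_le.
  by rewrite mulr_ge0// addr_ge0// gmax_ge0.
move=> _ /mapP[h hsh ->].
have := max0_ub (dot (consv x (vec g))) hsh; have := max0_ub (dot (consv (- x)%R (vec g))) hsh.
rewrite -/(gmax hs _) -/(gmax hs _) [in dot _ h](consv_tailv h) dot_consv => h1.
rewrite [in dot _ h](consv_tailv h) dot_consv; lra.
Qed.

End CanonicalSample.

(** * Deviation bounds over a finite family of directions *)

Section FiniteFamily.
Context {R : realType} d (S : measurableType d) (Q : probability S R).
Local Open Scope ereal_scope.
Notation RR := (measurableTypeR R).
Notation RT n := (n.-tuple RR).
Notation gam := (std_normal1 R).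
Notation Gam := (@std_normal R).
Variable n : nat.
Notation T := (RT n.+1 * S)%type.
Notation rho := (Gam n.+1 \x Q).
Notation iid := (iid_prob rho).
Notation z := (@sample_vec R _ S n).

(** [c0] and [b0] stand for the score and the indicator of the retained samples, as functions of the
    first coordinate and the seed. *)
Variables (c0 b0 : RR -> S -> RR) (sigma eta k A t : R).
Hypotheses (mc0 : measurable_fun setT (fun y => c0 y.1 y.2))
  (mb0 : measurable_fun setT (fun y => b0 y.1 y.2))
  (b01 : forall s w, (0 <= b0 s w <= 1)%R)
  (c0_mean : \int[gam \x Q]_y (c0 y.1 y.2 * y.1)%:E = 0)
  (c0_sq : \int[gam \x Q]_y (c0 y.1 y.2 ^+ 2)%:E = (sigma ^+ 2)%:E)
  (c0_sqs : \int[gam \x Q]_y (c0 y.1 y.2 ^+ 2 * y.1 ^+ 2)%:E = (eta ^+ 2)%:E)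
  (kE : \int[gam]_x (Num.min `|x| 1)%:E = k%:E)
  (b0_mean : \int[gam \x Q]_y (1 - b0 y.1 y.2)%:E <= (k / 2)%:E)
  (A0 : (0 <= A)%R) (hA : \int[gam]_x (expR (x ^+ 2 / 8))%:E <= A%:E)
  (t0 : (0 < t)%R).

Definition coef (x : T) : RR := c0 (sample_head x) x.2.
Definition keep (x : T) : RR := b0 (sample_head x) x.2.
(** Clipping at [t] makes the mean finite and keeps the dependence on the dot product 1-Lipschitz,
    as the contraction principle demands. *)
Definition clip (x : T) (h : 'cV[R]_n.+1) : R := (keep x * Num.min `|dot (z x) h| t)%R.

Lemma measurable_coef : measurable_fun setT coef.
Proof. by apply: measurable_fun2 mc0 _ _ => //; exact: measurable_sample_head. Qed.

Lemma measurable_keep : measurable_fun setT keep.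
Proof. by apply: measurable_fun2 mb0 _ _ => //; exact: measurable_sample_head. Qed.

Lemma measurable_clip h : measurable_fun setT (clip ^~ h).
Proof.
apply: measurable_funM; first exact: measurable_keep.
apply: measurable_minr; last exact: measurable_cst.
apply: measurableT_comp => //.
by apply: measurable_dot; [exact: mvec_sample_vec|exact: mvec_cst].
Qed.

Lemma keep01 x : (0 <= keep x <= 1)%R. Proof. exact: b01. Qed.

Lemma clip_ge0 x h : (0 <= clip x h)%R.
Proof.
have /andP[k0 _] := keep01 x.
by rewrite mulr_ge0// le_min normr_ge0 ltW.
Qed.

Lemma min_norm_lip (a b : R) :
  (`|Num.min `|a| t - Num.min `|b| t| <= `|a - b|)%R.
Proof.
have := lerB_dist a b; have := lerB_dist b a; rewrite [`|b - a|%R]distrC => h1 h2.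
rewrite ler_norml.
by case: (leP `|a|%R t); case: (leP `|b|%R t) => ? ?; apply/andP; split; lra.
Qed.

Lemma clip_lip x h h' : (`|clip x h - clip x h'| <= `|dot (z x) h - dot (z x) h'|)%R.
Proof.
have /andP[k0 k1] := keep01 x.
rewrite /clip -mulrBr normrM (ger0_norm k0).
apply: le_trans (min_norm_lip _ _); rewrite -[leRHS]mul1r ler_wpM2r//.
Qed.

Lemma clip_le x h : (`|clip x h| <= `|dot (z x) h|)%R.
Proof.
have := clip_lip x h 0; rewrite dot0r subr0 (_ : clip x 0 = 0%R) ?subr0//.
by rewrite /clip dot0r normr0 min_l ?mulr0// ltW.
Qed.

Lemma clip_fin h : \int[rho]_x (clip x h)%:E \is a fin_num.
Proof.
rewrite ge0_fin_numE; last by apply: integral_ge0 => x _; rewrite lee_fin clip_ge0.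
apply: (@le_lt_trans _ _ (\int[rho]_x t%:E)); last by rewrite integral_cst_prob ltry.
apply: le_ge0_integral => x; first by rewrite lee_fin clip_ge0.
have /andP[k0 k1] := keep01 x.
rewrite lee_fin /clip.
have : (Num.min `|dot (z x) h| t <= t)%R by rewrite ge_min lexx orbT.
have : (0 <= Num.min `|dot (z x) h| t)%R by rewrite le_min normr_ge0 ltW.
set u := Num.min _ _; nra.
Qed.

Definition clip_mean h : R := fine (\int[rho]_x (clip x h)%:E).

Lemma clip_meanE h : \int[rho]_x (clip x h)%:E = (clip_mean h)%:E.
Proof. by rewrite fineK// clip_fin. Qed.

(** Rotating [h] onto the first axis leaves the scalar mean of [min(t |x|, t)]. *)
Lemma std_normal_min_dot (h : 'cV[R]_n.+1) : (dot h h = t ^+ 2)%R ->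
  \int[Gam n.+1]_g (Num.min `|dot (vec g) h| t)%:E = (t * k)%:E.
Proof.
move=> ht; have [G [r [iG lG Gh]]] := exists_law_invariant_to_axis h.
have r2 : (r ^+ 2 = t ^+ 2)%R.
  by have := iG h h; rewrite Gh dot_consv dot0l addr0 ht expr2.
have rt : (`|r| = t)%R.
  by apply/eqP; rewrite -(eqrXn2 (n := 2))// ?ltW// -normrX ger0_norm ?sqr_ge0 ?r2.
pose F (v : 'cV[R]_n.+1) := (Num.min `|dot v (consv r 0%R)| t)%:E.
have mF : vmeas F.
  apply/measurable_EFinP; apply: measurable_minr; last exact: measurable_cst.
  by apply: measurableT_comp => //; mv2.
have F0 v : 0 <= F v by rewrite lee_fin le_min normr_ge0 ltW.
transitivity (\int[Gam n.+1]_g F (G *m vec g)).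
  by apply: eq_integral => g _; rewrite /F -Gh iG.
rewrite (lG _ mF F0) (integral_std_normalS mF F0).
transitivity (\int[gam]_x (t%:E * (Num.min `|x| 1)%:E)).
  apply: eq_integral => x _; rewrite /F.
  under eq_integral => g _ do rewrite dot_consv dot0r addr0 normrM rt.
  rewrite integral_cst_prob -EFinM minr_pMr ?ltW// mulr1 mulrC //.
have m1 : measurable_fun setT (fun x : RR => (Num.min `|x| 1)%:E).
  by apply/measurable_EFinP; apply: measurable_minr.
have f0 (x : RR) : 0 <= (Num.min `|x| 1)%:E by rewrite lee_fin le_min normr_ge0 ler01.
by rewrite (ge0_integralZl_EFin gam measurableT (fun x _ => f0 x) m1 (ltW t0)) kE.
Qed.

(** Without [keep] the mean is [t * k]; a discarded sample costs at most [t], and the mean of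
    [1 - keep] is at most [k / 2]. *)
Lemma clip_mean_ge (h : 'cV[R]_n.+1) : (dot h h = t ^+ 2)%R ->
  (t * k / 2 <= clip_mean h)%R.
Proof.
move=> ht.
pose F (v : 'cV[R]_n.+1) := (Num.min `|dot v h| t)%:E.
have mF : vmeas F.
  apply/measurable_EFinP; apply: measurable_minr; last exact: measurable_cst.
  by apply: measurableT_comp => //; mv2.
have F0 v : 0 <= F v by rewrite lee_fin le_min normr_ge0 ltW.
have E1 : \int[rho]_x F (z x) = (t * k)%:E.
  by rewrite integral_sample_vec// std_normal_min_dot.
have d0 x : 0 <= (1 - keep x)%:E by rewrite lee_fin subr_ge0; have /andP[] := keep01 x.
have td0 x : 0 <= t%:E * (1 - keep x)%:E by rewrite mule_ge0// lee_fin ltW.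
have md : measurable_fun setT (fun x => (1 - keep x)%:E).
  apply/measurable_EFinP; apply: measurable_funB; first exact: measurable_cst.
  exact: measurable_keep.
have E2 : \int[rho]_x (1 - keep x)%:E <= (k / 2)%:E.
  rewrite (@integral_sample_head R _ S Q n (fun s w => (1 - b0 s w)%:E))//.
    by apply/measurable_EFinP; apply: measurable_funB => //; exact: measurable_cst.
  by move=> s w; rewrite lee_fin subr_ge0; have /andP[] := b01 s w.
have : \int[rho]_x F (z x) <= \int[rho]_x ((clip x h)%:E + t%:E * (1 - keep x)%:E).
  apply: le_ge0_integral => // x; rewrite /F -EFinM -EFinD lee_fin /clip.
  have /andP[k0 k1] := keep01 x.
  have : (Num.min `|dot (z x) h| t <= t)%R by rewrite ge_min lexx orbT.
  set u := Num.min _ _; nra.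
have cp0 x : 0 <= (clip x h)%:E by rewrite lee_fin clip_ge0.
have mcl : measurable_fun setT (fun x => (clip x h)%:E) by apply/measurable_EFinP; exact: measurable_clip.
have mtd : measurable_fun setT (fun x => t%:E * (1 - keep x)%:E) by exact: emeasurable_funM.
rewrite E1 (ge0_integralD rho measurableT (fun x _ => cp0 x) mcl (fun x _ => td0 x) mtd) clip_meanE.
rewrite (ge0_integralZl_EFin rho measurableT (fun x _ => d0 x) md (ltW t0)).
have t0' : 0 <= t%:E by rewrite lee_fin ltW.
move=> /le_trans/(_ (leeD2l _ (lee_wpmul2l t0' E2))).
by rewrite -EFinM -EFinD lee_fin; lra.
Qed.

Variables (m : nat) (theta Lam eps a W : R).

(** The three uniform estimates from which the risk increment is bounded below. The last asks for
    half of the mean bound [t * k / 2], the rest being left to fluctuations. *)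
Definition good (v : m.-tuple T) (h : 'cV[R]_n.+1) : Prop :=
  [/\ - (2 * m%:R * theta * t ^+ 2) <= \sum_(i < m) coef (tnth v i) * dot (z (tnth v i)) h,
      quad z v h <= Lam * t ^+ 2 * m%:R &
      m%:R * (t * k / 4) <= \sum_(i < m) clip (tnth v i) h]%R.

Lemma measurable_tnth_fun d' (T' : measurableType d') (f : T -> T') i :
  measurable_fun setT f -> measurable_fun setT (fun v : m.-tuple T => f (tnth v i)).
Proof. by move=> mf; apply: measurableT_comp mf _; exact: measurable_tnth. Qed.

Lemma measurable_quad h : measurable_fun setT (fun v : m.-tuple T => quad z v h).
Proof.
apply: measurable_sum => i.
apply: (measurable_tnth_fun (f := fun x => dot (z x) h ^+ 2)%R).
apply: (@measurable_funX _ _ _ setT (fun x => dot (z x) h) 2).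
by apply: measurable_dot; [exact: mvec_sample_vec|exact: mvec_cst].
Qed.

Lemma measurable_good h : measurable [set v | good v h].
Proof.
have E : [set v | good v h] =
  [set v : m.-tuple T | (- (2 * m%:R * theta * t ^+ 2) <= \sum_(i < m) coef (tnth v i) * dot (z (tnth v i)) h)%R] `&`
  [set v | (quad z v h <= Lam * t ^+ 2 * m%:R)%R] `&`
  [set v : m.-tuple T | (m%:R * (t * k / 4) <= \sum_(i < m) clip (tnth v i) h)%R].
  by apply/seteqP; split=> v /= => [[? ? ?]|[[? ?] ?]]; split.
rewrite E; apply: measurableI; first apply: measurableI.
- apply: measurable_cst_le.
  apply: measurable_sum => i.
  apply: (measurable_tnth_fun (f := fun x => coef x * dot (z x) h)%R).
  apply: measurable_funM; first exact: measurable_coef.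
  by apply: measurable_dot; [exact: mvec_sample_vec|exact: mvec_cst].
- apply: measurable_le_cst.
  exact: measurable_quad.
- apply: measurable_cst_le.
  by apply: measurable_sum => i; apply: (measurable_tnth_fun (f := clip ^~ h)); exact: measurable_clip.
Qed.

Variable hs : seq 'cV[R]_n.+1.
(** [N1] to [N4] make each of the four deviations below have probability at most [eps / 4]: [N1] by
    Chebyshev's inequality, the others by Markov's. [a] bounds the root mean square of the
    multiplier vector. *)
Hypotheses (m0 : (0 < m)%N) (theta0 : (0 < theta)%R) (k0 : (0 < k)%R)
  (W0 : (0 <= W)%R) (a0 : (0 < a)%R)
  (hs_t : forall h, h \in hs -> (dot h h = t ^+ 2)%R)
  (hW : \int[Gam n.+1]_g (gmax hs (vec g))%:E <= W%:E)
  (N1 : (4 * eta ^+ 2 <= eps * (m%:R * theta ^+ 2 * t ^+ 2))%R)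
  (N2a : (m%:R * sigma ^+ 2 <= a ^+ 2)%R)
  (N2b : (4 * (W * a) <= eps * (m%:R * theta * t ^+ 2))%R)
  (N3 : (4 * (expR (W ^+ 2 / t ^+ 2) * A ^+ m) <= eps * expR (Lam * m%:R / 98))%R)
  (N4 : (32 * W <= eps * (Num.sqrt m%:R * t * k))%R).

Let mR0 : (0 < m%:R :> R)%R. Proof. by rewrite ltr0n. Qed.

Let hs_t' h : h \in hs -> (dot h h <= t ^+ 2)%R. Proof. by move=> /hs_t ->. Qed.

Lemma head_deviation :
  iid m [set v | (m%:R * theta * t) ^+ 2 <=
     (\sum_(i < m) coef (tnth v i) * sample_head (tnth v i)) ^+ 2]%R <= (eps / 4)%:E.
Proof.
pose phi (x : T) : RR := (coef x * sample_head x)%R.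
have mphi : measurable_fun setT phi.
  by apply: measurable_funM; [exact: measurable_coef|exact: measurable_sample_head].
have mcs : measurable_fun setT (fun y : RR * S => (c0 y.1 y.2 * y.1)%R).
  by apply: measurable_funM.
have E2 : \int[rho]_x (phi x ^+ 2)%:E = (eta ^+ 2)%:E.
  rewrite -c0_sqs -(@integral_sample_head R _ S Q n (fun s w => (c0 s w ^+ 2 * s ^+ 2)%:E)).
  - by apply: eq_integral => x _; rewrite /phi exprMn.
  - apply/measurable_EFinP; under eq_fun do rewrite -exprMn.
    exact: (measurable_funX 2 mcs).
  - by move=> s w; rewrite lee_fin mulr_ge0 ?sqr_ge0.
have iphi : rho.-integrable setT (EFin \o phi).
  apply/integrableP; split; first exact/measurable_EFinP.
  apply: (@le_lt_trans _ _ (\int[rho]_x (1 + (phi x ^+ 2)%:E))).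
    apply: le_ge0_integral => x; first exact: abse_ge0.
    rewrite /= -EFinD lee_fin; have := sqr_ge0 (phi x); case: (ger0P (phi x)) => ? ?; nra.
  rewrite (ge0_integralD rho measurableT); first last.
  - apply/measurable_EFinP; exact: (measurable_funX 2 mphi).
  - by move=> x _; rewrite lee_fin sqr_ge0.
  - exact: measurable_cst.
  - by [].
  by rewrite integral_cst_prob E2 -EFinD ltry.
(* [integral_sample_head] concerns nonnegative integrands, so the centering is transported through
   positive and negative parts. *)
have E1 : \int[rho]_x (phi x)%:E = 0.
  rewrite integralE.
  have Ep : \int[rho]_x (EFin \o phi)^\+ x = \int[gam \x Q]_y (fun y => (c0 y.1 y.2 * y.1)%:E)^\+ y.
    transitivity (\int[rho]_x (fun s w => maxe (c0 s w * s)%:E 0) (sample_head x) x.2).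
      by apply: eq_integral => x _; rewrite funepos.unlock.
    transitivity (\int[gam \x Q]_y (fun s w => maxe (c0 s w * s)%:E 0) y.1 y.2); last first.
      by apply: eq_integral => y _; rewrite funepos.unlock.
    apply: (@integral_sample_head R _ S Q n (fun s w => maxe (c0 s w * s)%:E 0)).
      have := @measurable_funepos _ _ _ setT (fun y : RR * S => (c0 y.1 y.2 * y.1)%:E).
      by rewrite funepos.unlock; apply; exact/measurable_EFinP.
    by move=> s w; rewrite le_max lexx orbT.
  have En : \int[rho]_x (EFin \o phi)^\- x = \int[gam \x Q]_y (fun y => (c0 y.1 y.2 * y.1)%:E)^\- y.
    transitivity (\int[rho]_x (fun s w => maxe (- (c0 s w * s)%:E) 0) (sample_head x) x.2).
      by apply: eq_integral => x _; rewrite funeneg.unlock.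
    transitivity (\int[gam \x Q]_y (fun s w => maxe (- (c0 s w * s)%:E) 0) y.1 y.2); last first.
      by apply: eq_integral => y _; rewrite funeneg.unlock.
    apply: (@integral_sample_head R _ S Q n (fun s w => maxe (- (c0 s w * s)%:E) 0)).
      have := @measurable_funeneg _ _ _ setT (fun y : RR * S => (c0 y.1 y.2 * y.1)%:E).
      by rewrite funeneg.unlock; apply; exact/measurable_EFinP.
    by move=> s w; rewrite le_max lexx orbT.
  by rewrite Ep En -integralE.
have E := iid_second_moment m mphi iphi E1 E2.
have mS : measurable_fun setT (fun v : m.-tuple T => (\sum_(i < m) phi (tnth v i)) ^+ 2)%R.
  apply: measurable_funX; apply: measurable_sum => i.
  exact: (measurable_tnth_fun (f := phi)).
have th0 : (0 < (m%:R * theta * t) ^+ 2)%R by rewrite exprn_gt0// !mulr_gt0.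
have Sg0 (v : m.-tuple T) : (0 <= (\sum_(i < m) phi (tnth v i)) ^+ 2)%R by exact: sqr_ge0.
have EB : \int[iid m]_v ((\sum_(i < m) phi (tnth v i)) ^+ 2)%:E <= (m%:R * eta ^+ 2)%:E by rewrite E.
apply: le_trans (markov_bound mS Sg0 th0 EB) _.
rewrite lee_fin ler_pdivrMr// [leRHS]mulrAC ler_pdivlMr//.
have -> : (m%:R * eta ^+ 2 * 4 = m%:R * (4 * eta ^+ 2))%R by ring.
have -> : (eps * (m%:R * theta * t) ^+ 2 = m%:R * (eps * (m%:R * theta ^+ 2 * t ^+ 2)))%R by ring.
by rewrite ler_wpM2l// ltW.
Qed.

(** The minus sign appears because the linear term has to be bounded from below. *)
Lemma tail_deviation :
  iid m [set v | m%:R * theta * t ^+ 2 <=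
    gmax (map (@tailv R n) hs) (\sum_(i < m) (- coef (tnth v i)) *: sample_tail (tnth v i))]%R <= (eps / 4)%:E.
Proof.
pose c (x : T) : RR := (- coef x)%R.
have mc : measurable_fun setT c by apply: measurableT_comp => //; exact: measurable_coef.
have hW' := le_trans (gmax_tail hs) hW.
have s20 : (0 <= sigma ^+ 2)%R by exact: sqr_ge0.
have hs2 : \int[rho]_x (c x ^+ 2)%:E <= (sigma ^+ 2)%:E.
  rewrite -c0_sq -(@integral_sample_head R _ S Q n (fun s w => (c0 s w ^+ 2)%:E)).
  - by under eq_integral do rewrite sqrrN.
  - by apply/measurable_EFinP; exact: (measurable_funX 2 mc0).
  - by move=> s w; rewrite lee_fin sqr_ge0.
have mc0N : measurable_fun setT (fun y : RR * S => (- c0 y.1 y.2)%R : RR).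
  by apply: measurableT_comp.
have qlaw F mF F0 := @integral_sample_indep R _ S Q n (fun s w => (- c0 s w)%R) F mc0N mF F0.
have EB := iid_multiplier (@mvec_sample_tail R _ S n) mc qlaw W0 hW' s20 hs2 a0 N2a.
have mS : measurable_fun setT (fun v : m.-tuple T =>
    gmax (map (@tailv R n) hs) (\sum_(i < m) c (tnth v i) *: sample_tail (tnth v i))%R).
  apply: mvec_gmax; apply: mvec_sum => i; apply: mvecZ; first exact: (measurable_tnth_fun (f := c)).
  by apply: (mvec_comp (@mvec_sample_tail R _ S n)); exact: measurable_tnth.
have th0 : (0 < m%:R * theta * t ^+ 2)%R by rewrite !mulr_gt0// exprn_gt0.
apply: le_trans (markov_bound mS _ th0 EB) _; first by move=> v; exact: gmax_ge0.
by rewrite lee_fin ler_pdivrMr// [leRHS]mulrAC ler_pdivlMr// mulrC.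
Qed.

Lemma quad_deviation :
  iid m [set v | expR (Lam * m%:R / 98) <= expR (max0 hs (quad z v) / (98 * t ^+ 2))]%R <= (eps / 4)%:E.
Proof.
have EB := iid_quad_exp (@mvec_sample_vec R _ S n) (@integral_sample_vec R _ S Q n) t0 W0 hs_t' hW m A0 hA.
have mS : measurable_fun setT (fun v : m.-tuple T => expR (max0 hs (quad z v) / (98 * t ^+ 2))).
  apply: measurableT_comp => //; apply: measurable_funM; last exact: measurable_cst.
  by apply: measurable_max0 => h; exact: measurable_quad.
apply: le_trans (markov_bound mS _ (expR_gt0 _) EB) _; first by move=> v; exact: expR_ge0.
by rewrite lee_fin ler_pdivrMr ?expR_gt0// [leRHS]mulrAC ler_pdivlMr// mulrC.
Qed.

(** [symmetrization] bounds the mean by [2 sqrt m W]; comparison with [eps / 4] times the threshold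
    [m t k / 4] gives the 32 of [N4]. *)
Lemma clip_deviation :
  iid m [set v | m%:R * (t * k / 4) <=
    max0 hs (fun h => \sum_(i < m) (clip_mean h - clip (tnth v i) h))]%R <= (eps / 4)%:E.
Proof.
have EB := symmetrization (@integral_sample_vec R _ S Q n) hW
  measurable_clip clip_ge0 clip_lip clip_le clip_meanE m.
have mS : measurable_fun setT (fun v : m.-tuple T =>
    max0 hs (fun h => \sum_(i < m) (clip_mean h - clip (tnth v i) h))%R).
  apply: measurable_max0 => h; apply: measurable_sum => i; apply: measurable_funB.
    exact: measurable_cst.
  exact: (measurable_tnth_fun (f := clip ^~ h) _ (measurable_clip h)).
have th0 : (0 < m%:R * (t * k / 4))%R by rewrite mulr_gt0// divr_gt0// mulr_gt0.
apply: le_trans (markov_bound mS _ th0 EB) _; first by move=> v; exact: max0_ge0.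
rewrite lee_fin ler_pdivrMr//.
have sm : (m%:R = Num.sqrt m%:R * Num.sqrt m%:R :> R)%R by rewrite -expr2 sqr_sqrtr.
have sm0 : (0 <= Num.sqrt m%:R :> R)%R by exact: sqrtr_ge0.
have E : (eps / 4 * (m%:R * (t * k / 4)) = Num.sqrt m%:R * (eps * (Num.sqrt m%:R * t * k)) / 16)%R.
  by rewrite [in LHS]sm; field.
by have := ler_wpM2l sm0 N4; rewrite E; lra.
Qed.

Lemma finite_good :
  iid m [set v | ~ (forall h, h \in hs -> good v h)] <= eps%:E.
Proof.
set B1 := [set v : m.-tuple T | ((m%:R * theta * t) ^+ 2 <=
     (\sum_(i < m) coef (tnth v i) * sample_head (tnth v i)) ^+ 2)%R].
set B2 := [set v : m.-tuple T | (m%:R * theta * t ^+ 2 <=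
    gmax (map (@tailv R n) hs) (\sum_(i < m) (- coef (tnth v i)) *: sample_tail (tnth v i)))%R].
set B3 := [set v : m.-tuple T | (expR (Lam * m%:R / 98) <= expR (max0 hs (quad z v) / (98 * t ^+ 2)))%R].
set B4 := [set v : m.-tuple T | (m%:R * (t * k / 4) <=
    max0 hs (fun h => \sum_(i < m) (clip_mean h - clip (tnth v i) h)))%R].
have sub : [set v | ~ (forall h, h \in hs -> good v h)] `<=` (B1 `|` B2) `|` (B3 `|` B4).
  move=> v; apply: contra_notP => nB h hsh.
  have [n1 n2 n3 n4] : [/\ ~ B1 v, ~ B2 v, ~ B3 v & ~ B4 v].
    by split=> Bv; apply: nB; [left; left|left; right|right; left|right; right].
  split.
  (* The first coordinate of [h] is at most [t] in absolute value, so the head sum contributes at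
     most [m theta t^2]; the tail contributes as much, whence the 2 in [good]. *)
  - have h0 : (`|h (lshift n (ord0 : 'I_1)) 0| <= t)%R.
      rewrite -(ler_pXn2r (n := 2)) ?nnegrE ?(ltW t0)// -normrX ger0_norm ?sqr_ge0//.
      have := hs_t hsh; rewrite {1 2}(consv_tailv h) dot_consv => <-.
      by rewrite expr2 lerDl dot_ge0.
    have {}n1 : (`|\sum_(i < m) coef (tnth v i) * sample_head (tnth v i)| < m%:R * theta * t)%R.
      have th0 : (0 <= m%:R * theta * t)%R by rewrite !mulr_ge0 ?ltW.
      rewrite ltNge; apply/negP => h1; apply: n1; rewrite /B1/=.
      by rewrite -[leRHS]ger0_norm ?sqr_ge0// normrX ler_pXn2r ?nnegrE.
    have {n2} n2 : (\sum_(i < m) - (coef (tnth v i) * dot (sample_tail (tnth v i)) (tailv h)) < m%:R * theta * t ^+ 2)%R.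
      rewrite ltNge; apply/negP => h1; apply: n2; rewrite /B2/=.
      apply: le_trans h1 _; set u := (\sum_(i < m) - coef _ *: _)%R.
      have -> : (\sum_(i < m) - (coef (tnth v i) * dot (sample_tail (tnth v i)) (tailv h)) = dot u (tailv h))%R.
        by rewrite dot_suml; apply: eq_bigr => i _; rewrite dotZl mulNr.
      by apply: (max0_ub (dot u)); apply: map_f.
    have E : (\sum_(i < m) coef (tnth v i) * dot (z (tnth v i)) h =
       (\sum_(i < m) coef (tnth v i) * sample_head (tnth v i)) * h (lshift n (ord0 : 'I_1)) 0 -
       \sum_(i < m) - (coef (tnth v i) * dot (sample_tail (tnth v i)) (tailv h)))%R.
      rewrite mulr_suml -sumrN -big_split; apply: eq_bigr => i _ /=.
      by rewrite sample_vecE {1}(consv_tailv h) dot_consv; ring.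
    have : (`|(\sum_(i < m) coef (tnth v i) * sample_head (tnth v i)) * h (lshift n (ord0 : 'I_1)) 0| <= m%:R * theta * t * t)%R.
      by rewrite normrM ler_pM// ltW.
    rewrite ler_norml => /andP[h1 _].
    by rewrite E; rewrite -mulrA -expr2 in h1; lra.
  - have {}n3 : (max0 hs (quad z v) / (98 * t ^+ 2) < Lam * m%:R / 98)%R.
      by rewrite ltNge; apply/negP => h1; apply: n3; rewrite /B3/= ler_expR.
    have t2 : (0 < t ^+ 2)%R by rewrite exprn_gt0.
    move: n3; rewrite ltr_pdivrMr ?mulr_gt0// => /ltW n3.
    apply: le_trans (max0_ub (quad z v) hsh) _; apply: le_trans n3 _.
    by rewrite le_eqVlt; apply/orP; left; apply/eqP; field.
  - have {n4} n4 : (\sum_(i < m) (clip_mean h - clip (tnth v i) h) < m%:R * (t * k / 4))%R.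
      rewrite ltNge; apply/negP => h1; apply: n4; rewrite /B4/=; apply: le_trans h1 _.
      exact: (max0_ub (fun h => \sum_(i < m) (clip_mean h - clip (tnth v i) h))%R hsh).
    have := clip_mean_ge (hs_t hsh).
    move: n4; rewrite big_split sumrN/= sumr_const card_ord -mulr_natl.
    have := mR0; nra.
have mB1 : measurable B1.
  apply: measurable_cst_le.
  apply: measurable_funX; apply: measurable_sum => i.
  apply: (measurable_tnth_fun (f := fun x => coef x * sample_head x)%R).
  by apply: measurable_funM; [exact: measurable_coef|exact: measurable_sample_head].
have mB2 : measurable B2.
  apply: measurable_cst_le.
  apply: mvec_gmax; apply: mvec_sum => i; apply: mvecZ.
    apply: (measurable_tnth_fun (f := fun x => - coef x)%R).
    by apply: measurableT_comp => //; exact: measurable_coef.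
  by apply: (mvec_comp (@mvec_sample_tail R _ S n)); exact: measurable_tnth.
have mB3 : measurable B3.
  apply: measurable_cst_le.
  apply: measurableT_comp => //; apply: measurable_funM; last exact: measurable_cst.
  by apply: measurable_max0 => h; exact: measurable_quad.
have mB4 : measurable B4.
  apply: measurable_cst_le.
  apply: measurable_max0 => h; apply: measurable_sum => i; apply: measurable_funB.
    exact: measurable_cst.
  exact: (measurable_tnth_fun (f := clip ^~ h) _ (measurable_clip h)).
have mbad : measurable [set v | ~ (forall h, h \in hs -> good v h)].
  have -> : [set v | ~ (forall h, h \in hs -> good v h)] = ~` \big[setI/setT]_(h <- hs) [set v | good v h].
    congr (~` _); apply/seteqP; split => v /=; rewrite -bigcap_seq.
      by move=> gv h /= /gv.
    by move=> gv h /gv.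
  by apply: measurableC; apply: bigsetI_measurable => h _; exact: measurable_good.
have m12 := measurableU _ _ mB1 mB2; have m34 := measurableU _ _ mB3 mB4.
have mall := measurableU _ _ m12 m34.
have := @le_measure _ _ _ (iid m) _ _ (mem_set mbad) (mem_set mall) sub.
move=> /le_trans; apply; apply: (le_trans (measureU2 (iid m) m12 m34)).
have -> : eps%:E = ((eps / 4)%:E + (eps / 4)%:E) + ((eps / 4)%:E + (eps / 4)%:E).
  by rewrite -!EFinD; congr EFin; field.
apply: leeD.
  apply: (le_trans (measureU2 (iid m) mB1 mB2)).
  by apply: leeD; [exact: head_deviation|exact: tail_deviation].
apply: (le_trans (measureU2 (iid m) mB3 mB4)).
by apply: leeD; [exact: quad_deviation|exact: clip_deviation].
Qed.

End FiniteFamily.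

(** * From finite families to arbitrary sets *)

Section DenseSequence.
Context {R : realType} (V : pseudoMetricType R).

(** A subset of a separable space is separable: for each centre [q c] and radius [1 / (j + 1)], pick
    a point of [A] in the ball if there is one, and the default [x0] otherwise. *)
Lemma dense_sequence (C : countType) (q : C -> V) (A : set V) (x0 : V) :
  (forall x (e : R), 0 < e -> exists c, ball (q c) e x) -> A x0 ->
  exists s : nat -> V, (forall k, A (s k)) /\
    forall x, A x -> forall e : R, 0 < e -> exists k, ball x e (s k).
Proof.
move=> qd Ax0.
pose near_pt (c : C) (j : nat) (y : V) := A y /\ ball (q c) (j.+1%:R^-1) y.
pose pt (cj : C * nat) : V :=
  match pselect (exists y, near_pt cj.1 cj.2 y) with
  | left h => projT1 (cid h) | right _ => x0 end.
have Apt cj : A (pt cj).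
  by rewrite /pt; case: pselect => // h; case: (projT2 (cid h)).
exists (fun k => if @unpickle (C * nat)%type k is Some cj then pt cj else x0); split.
  by move=> k; case: unpickle.
move=> x Ax e e0.
(* Both [x] and the selected point lie in the ball around [q c], hence twice the radius. *)
have [j je] : exists j, 2 / j.+1%:R < e :> R.
  exists (Num.truncn (2 / e)); rewrite ltr_pdivrMr// mulrC -ltr_pdivrMr//.
  by rewrite truncnS_gt.
have j0 : 0 < j.+1%:R^-1 :> R by rewrite invr_gt0.
have [c cx] := qd x _ j0.
exists (pickle (c, j)); rewrite pickleK /pt; case: pselect => [h|]; last by case; exists x.
have [_ ch] := projT2 (cid h).
have le_e : j.+1%:R^-1 + j.+1%:R^-1 <= e by rewrite -mulr2n -[leLHS]mulr_natl ltW.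
apply: (le_ball le_e).
by apply: ball_triangle ch; exact: ball_sym.
Qed.

Lemma continuous_ge_dense (A : set V) (s : nat -> V) (f : V -> R) (c : R) x :
  continuous f -> (forall x, A x -> forall e : R, 0 < e -> exists k, ball x e (s k)) ->
  (forall k, c <= f (s k)) -> A x -> c <= f x.
Proof.
move=> cf sd cs Ax; rewrite leNgt; apply/negP => fxc.
have : \forall y \near x, f y < c by exact: (cvgr_lt (f x) (cf x) c fxc).
move=> /nbhs_ballP[e /= e0 he].
have [k /he/=] := sd x Ax e e0.
by rewrite ltNge cs.
Qed.

End DenseSequence.

Section DenseVectors.
Context {R : realType}.

Lemma dense_sequence_R (A : set R) (x0 : R) : A x0 ->
  exists s : nat -> R, (forall k, A (s k)) /\
    forall x, A x -> forall e : R, 0 < e -> exists k, ball x e (s k).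
Proof.
apply: (@dense_sequence R R rat (fun c => ratr c) A x0) => x e e0.
have [c] := @rat_in_itvoo R (x - e) (x + e) ltac:(lra).
rewrite in_itv/= => /andP[h1 h2]; exists c.
by rewrite -ball_normE/= ltr_norml; apply/andP; split; lra.
Qed.

Lemma dense_sequence_cV n (A : set 'cV[R]_n) (x0 : 'cV[R]_n) : A x0 ->
  exists s : nat -> 'cV[R]_n, (forall k, A (s k)) /\
    forall x, A x -> forall e : R, 0 < e -> exists k, ball x e (s k).
Proof.
apply: (@dense_sequence R 'cV[R]_n 'cV[rat]_n (fun c : 'cV[rat]_n => map_mx ratr c) A x0) => x e e0.
have h i : exists c : rat, `|ratr c - x i 0| < e.
  have [c] := @rat_in_itvoo R (x i 0 - e) (x i 0 + e) ltac:(lra).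
  rewrite in_itv/= => /andP[h1 h2]; exists c.
  by rewrite ltr_norml; apply/andP; split; lra.
exists (\col_i projT1 (cid (h i))); split=> // i j.
rewrite !mxE ord1 -ball_normE/=.
exact: (projT2 (cid (h i))).
Qed.

Lemma continuous_dotr n (u : 'cV[R]_n) : continuous (dot u).
Proof.
move=> h; rewrite /dot.
have H (s : seq 'I_n) : (fun v : 'cV[R]_n => \sum_(i <- s) u i 0 * v i 0) @ h --> \sum_(i <- s) u i 0 * h i 0.
  elim: s => [|i s IH].
    rewrite big_nil (_ : (fun v : 'cV[R]_n => _) = (fun=> 0)); first exact: (@cvg_cst R 0 'cV[R]_n (nbhs h) (nbhs_filter (h : 'cV[R]_n))).
    by apply/funext => v; rewrite big_nil.
  rewrite big_cons (_ : (fun v : 'cV[R]_n => _) =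
      (fun v : 'cV[R]_n => u i 0 * v i 0 + \sum_(j <- s) u j 0 * v j 0)); last first.
    by apply/funext => v; rewrite big_cons.
  have FF := nbhs_filter (h : 'cV[R]_n).
  apply: cvgD IH; apply: cvgM; first exact: cvg_cst.
  exact: coord_continuous.
exact: H.
Qed.

End DenseVectors.

Section CountableFamily.
Context {R : realType} d (T : measurableType d) (P : probability T R).

(** The failure events of the first [K] points increase to the failure event of the whole sequence,
    and the bound does not depend on [K]. *)
Lemma countable_bad_prob (V : choiceType) (G : V -> set T) (s : nat -> V) (eps : R) :
  (forall h, measurable (G h)) ->
  (forall hs : seq V, (forall h, h \in hs -> exists k, h = s k) ->
     (P [set v | ~ (forall h, h \in hs -> G h v)] <= eps%:E)%E) ->
  (P [set v | ~ (forall k, G (s k) v)] <= eps%:E)%E.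
Proof.
move=> mG hP.
pose F K := [set v | ~ (forall h, h \in [seq s i | i <- iota 0 K] -> G h v)].
have mF K : measurable (F K).
  have -> : F K = ~` \big[setI/setT]_(h <- [seq s i | i <- iota 0 K]) G h.
    congr (~` _); apply/seteqP; split => v /=; rewrite -bigcap_seq.
      by move=> gv h /= /gv.
    by move=> gv h /gv.
  by apply: measurableC; apply: bigsetI_measurable => h _.
have FU : \bigcup_K F K = [set v | ~ (forall k, G (s k) v)].
  apply/seteqP; split => [v [K _ FKv] /= Gv|v /= nG].
    by apply: FKv => _ /mapP[i _ ->].
  have [k nGk] : exists k, ~ G (s k) v by apply/existsNP.
  exists k.+1 => // h; apply: nGk; apply: h; apply: map_f.
  by rewrite mem_iota add0n leq0n ltnSn.
rewrite -FU.
have mFU : measurable (\bigcup_K F K) by exact: bigcupT_measurable.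
have ndF : {homo F : n m / (n <= m)%N >-> (n <= m)%O}.
  move=> n m nm; apply/subsetPset => v /= Fn Fm; apply: Fn => _ /mapP[i + ->].
  rewrite mem_iota => /andP[_ i_n]; apply: Fm; apply: map_f.
  by rewrite mem_iota leq0n add0n (leq_trans i_n).
have cv := @nondecreasing_cvg_mu _ _ _ P _ mF mFU ndF.
rewrite -(cvg_lim _ cv)//; apply: lime_le; first by apply/cvg_ex; eexists; exact: cv.
apply: nearW => K; apply: hP => _ /mapP[i _ ->]; by exists i.
Qed.

End CountableFamily.

(** * Identification of the law of an independent sample *)

Section ProductLaw.
Context {R : realType} d1 d2 (T1 : measurableType d1) (T2 : measurableType d2)
  (P1 : probability T1 R) (P2 : probability T2 R).
Notation T := (T1 * T2)%type.
Notation rho := (P1 \x P2)%E.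
Local Open Scope ereal_scope.

Lemma iid_prob_rect m (C : 'I_m -> set T) : (forall i, measurable (C i)) ->
  iid_prob rho m [set v | forall i, C i (tnth v i)] = \prod_(i < m) rho (C i).
Proof.
elim: m C => [|m IH] C mC.
  rewrite big_ord0 /= diracE mem_set//.
  by move=> -[].
have -> : [set v | forall i, C i (tnth v i)] =
    [set v : m.+1.-tuple T | C ord0 (tnth v ord0) /\ forall i, C (lift ord0 i) (tnth v (lift ord0 i))].
  apply/seteqP; split => v /= => [Cv|[C0 Cv] i]; first by split.
  by case: (unliftP ord0 i) => [j|] ->.
rewrite /= /distribution /pushforward.
have -> : @gcons _ T m @^-1` [set v : m.+1.-tuple T | C ord0 (tnth v ord0) /\
      forall i, C (lift ord0 i) (tnth v (lift ord0 i))] =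
    C ord0 `*` [set v : m.-tuple T | forall i, C (lift ord0 i) (tnth v i)].
  apply/seteqP; split => -[x v] /= [C0 Cv]; split=> // i.
    by have := Cv i; rewrite tnthS.
  by rewrite tnthS.
rewrite product_measure1E//; last first.
  rewrite (_ : [set v | _] = \bigcap_(i in [set: 'I_m]) ((fun v : m.-tuple T => tnth v i) @^-1` C (lift ord0 i))).
    apply: fin_bigcap_measurable => // i _.
    by rewrite -[X in measurable X]setTI; exact: measurable_tnth.
  by apply/seteqP; split => v /= h i; [move=> _|]; exact: h.
rewrite big_ord_recl; congr (_ * _).
exact: (IH (fun i => C (lift ord0 i))).
Qed.

(** Independence prescribes the law on rectangles only; they are stable under intersection and
    generate the product sigma-algebra, so they determine it. *)
Lemma iid_prob_unique m (mu : {measure set (m.-tuple T) -> \bar R}) :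
  (forall (A : 'I_m -> set T1) (B : 'I_m -> set T2),
    (forall i, measurable (A i)) -> (forall i, measurable (B i)) ->
    mu [set v | forall i, A i (tnth v i).1 /\ B i (tnth v i).2] =
    \prod_(i < m) (P1 (A i) * P2 (B i))) ->
  forall E, measurable E -> mu E = iid_prob rho m E.
Proof.
move=> hmu.
pose G : set (set (m.-tuple T)) := [set X | exists A B,
  [/\ (forall i, measurable (A i)), (forall i, measurable (B i)) &
     X = [set v : m.-tuple T | forall i : 'I_m, A i (tnth v i).1 /\ B i (tnth v i).2]]].
have GT : G setT.
  exists (fun=> setT), (fun=> setT); split => //.
  by apply/seteqP; split.
have mrect A B : measurable A -> measurable B -> measurable ([set x : T | A x.1 /\ B x.2]).
  by move=> mA mB; exact: measurableX.
have Gmeas X : G X -> measurable X.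
  move=> [A [B [mA mB ->]]].
  rewrite (_ : [set v | _] = \bigcap_(i in [set: 'I_m])
      ((fun v : m.-tuple T => tnth v i) @^-1` [set x : T | A i x.1 /\ B i x.2])).
    apply: fin_bigcap_measurable => // i _.
    by rewrite -[X in measurable X]setTI; apply: measurable_tnth => //; exact: mrect.
  by apply/seteqP; split => v /= h i; [move=> _|]; exact: h.
have gen : @measurable _ (m.-tuple T) = <<s G >>.
  apply/seteqP; split; last by apply: smallest_sub => //; exact: sigma_algebra_measurable.
  apply: smallest_sub; first exact: smallest_sigma_algebra.
  move=> X; rewrite -bigcup_seq => -[i _ [C mC <-]].
  (* The sets whose preimage under the [i]-th coordinate is generated by [G] form a sigma-algebra,
     so it suffices to test products [A x B], with [setT] at the other indices. *)
  pose F := image_set_system setT (fun v : m.-tuple T => tnth v i) <<s G >>.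
  have sF : sigma_algebra setT F by apply: sigma_algebra_image; exact: smallest_sigma_algebra.
  have sub : <<s [set A `*` B | A in measurable & B in measurable] >> `<=` F.
    apply: smallest_sub => // _ [A mA [B mB <-]]; rewrite /F /image_set_system/= setTI.
    apply: sub_sigma_algebra.
    exists (fun j => if j == i then A else setT), (fun j => if j == i then B else setT); split.
    - by move=> j; case: ifP.
    - by move=> j; case: ifP.
    - apply/seteqP; split => v /=.
        by move=> [Av Bv] j; case: eqP => [->|].
      by move=> /(_ i); rewrite eqxx.
  by apply: sub; rewrite -measurable_prod_measurableType.
have GI : setI_closed G.
  move=> _ _ [A [B [mA mB ->]]] [A' [B' [mA' mB' ->]]].
  exists (fun i => A i `&` A' i), (fun i => B i `&` B' i); split.
  - by move=> i; exact: measurableI.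
  - by move=> i; exact: measurableI.
  - apply/seteqP; split => v /=.
      by move=> [h1 h2] i; have [? ?] := h1 i; have [? ?] := h2 i.
    by move=> h; split=> i; have [[? ?] [? ?]] := h i.
have eqG X : G X -> mu X = iid_prob rho m X.
  move=> [A [B [mA mB ->]]]; rewrite hmu//.
  rewrite (@iid_prob_rect m (fun i => [set x : T | A i x.1 /\ B i x.2])); last by move=> i; exact: mrect.
  apply: eq_bigr => i _.
  by rewrite (_ : [set x : T | _] = A i `*` B i)// product_measure1E.
apply: (@measure_unique _ _ _ G (fun=> setT)) => //.
- by apply/seteqP; split => // x _; exists 0%N.
- by move=> k; rewrite eqG// -ge0_fin_numE ?measure_ge0// fin_num_measure.
Qed.

End ProductLaw.

Section LinearLaw.
Context {R : realType}.
Local Open Scope ereal_scope.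
Notation RT n := (n.-tuple (measurableTypeR R)).

Lemma std_normal_isometry_set n (O : 'M[R]_n) (B : set (RT n)) :
  isometry_mx O -> measurable B ->
  std_normal n [set g | B (unvec (O *m vec g))] = std_normal n B.
Proof.
move=> iO mB.
have mU : measurable_fun setT (fun g : RT n => unvec (O *m vec g) : RT n).
  by apply: mvec_unvec; mv2.
have mB' : measurable [set g : RT n | B (unvec (O *m vec g))].
  by rewrite -[X in measurable X]setTI; exact: mU.
pose F (v : 'cV[R]_n) : \bar R := (\1_B (unvec v : RT n))%:E.
have mF : vmeas F.
  rewrite /vmeas /F; under eq_fun do rewrite vecK.
  exact/measurable_EFinP/measurable_indic.
have F0 v : 0 <= F v by rewrite lee_fin indicE.
have := isometry_law_invariant iO mF F0.
rewrite /F; under [in RHS]eq_integral do rewrite vecK.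
rewrite [RHS]integral_indic// setIT => <-.
transitivity (\int[std_normal n]_g (\1_[set g : RT n | B (unvec (O *m vec g))] g)%:E); last by apply: eq_integral.
by rewrite integral_indic// setIT.
Qed.

End LinearLaw.

(** * Convex losses *)

Section ConvexCalculus.
Context {R : realType}.
Implicit Types f : R -> R.

Lemma convex_chord f (v x s : R) : convex_function [set: R^o] (f : R^o -> R^o) ->
  0 <= s <= 1 -> f (v + s * x) - f v <= s * (f (v + x) - f v).
Proof.
move=> cf /andP[s0 s1].
have : f (s * (v + x) + (1 - s) * v) <= s * f (v + x) + (1 - s) * f v.
  exact: (cf (Itv01 s0 s1) (v + x) v (in_setT _) (in_setT _)).
have -> : s * (v + x) + (1 - s) * v = v + s * x by ring.
by move=> h; lra.
Qed.

(** By [convex_chord], difference quotients at [v] towards [v + x] never exceed the full chord slope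
    for positive [x], nor fall below it for negative [x]; the same bound passes to their limit. *)
Lemma convex_tangent f (v x : R) : convex_function [set: R^o] (f : R^o -> R^o) ->
  derivable f v 1 -> derive1 f v * x <= f (v + x) - f v.
Proof.
move=> cf df; have [->|x0] := eqVneq x 0; first by rewrite mulr0 addr0 subrr.
rewrite leNgt; apply/negP => lt.
have cv : h^-1 *: (f (h *: 1 + v) - f v) @[h --> 0^'] --> derive1 f v.
  by rewrite derive1E; exact: df.
have small (e : R) : 0 < e -> exists s : R, [/\ 0 < s, s <= 1 & `|s * x| < e].
  move=> e0; exists (Num.min 1 (e / (2 * `|x|))).
  have ax : 0 < `|x| by rewrite normr_gt0.
  have q0 : 0 < e / (2 * `|x|) by rewrite divr_gt0// mulr_gt0.
  split; [by rewrite lt_min ltr01|by rewrite ge_min lexx|].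
  rewrite normrM ger0_norm ?le_min ?ler01 ?ltW//.
  apply: (@le_lt_trans _ _ (e / (2 * `|x|) * `|x|)).
    by rewrite ler_wpM2r// ge_min lexx orbT.
  have -> : e / (2 * `|x|) * `|x| = e / 2 by field; rewrite gt_eqF.
  by rewrite ltr_pdivrMr// ltr_pMr// ltr1n.
have slope (s : R) : 0 < s -> s <= 1 ->
    f (s * x *: 1 + v) - f v <= s * (f (v + x) - f v).
  move=> s0 s1; have := @convex_chord f v x s cf; rewrite (ltW s0) s1 => /(_ isT).
  by rewrite [_ *: 1]mulr1 [s * x + v]addrC.
have [xp|xn|xe] := ltgtP 0 x; last by rewrite xe eqxx in x0.
- have : \forall h \near 0^', (f (v + x) - f v) / x < h^-1 *: (f (h *: 1 + v) - f v).
    by apply: (cvgr_gt _ cv); rewrite ltr_pdivrMr.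
  move=> /nbhs_ballP[e /= e0 he]; have [s [s0 s1 sx]] := small e e0.
  have sx0 : 0 < s * x by rewrite mulr_gt0.
  have := he (s * x); rewrite -ball_normE/= sub0r normrN => /(_ sx); rewrite gt_eqF// => /(_ isT).
  rewrite [_ *: (_ - _)]mulrC ltr_pdivlMr// => h1.
  have := slope s s0 s1; have -> : s * (f (v + x) - f v) = (f (v + x) - f v) / x * (s * x).
    by field.
  lra.
- have : \forall h \near 0^', h^-1 *: (f (h *: 1 + v) - f v) < (f (v + x) - f v) / x.
    by apply: (cvgr_lt _ cv); rewrite ltr_ndivlMr.
  move=> /nbhs_ballP[e /= e0 he]; have [s [s0 s1 sx]] := small e e0.
  have sx0 : s * x < 0 by rewrite pmulr_rlt0.
  have := he (s * x); rewrite -ball_normE/= sub0r normrN => /(_ sx); rewrite lt_eqF// => /(_ isT).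
  rewrite [_ *: (_ - _)]mulrC ltr_ndivrMr// => h1.
  have := slope s s0 s1; have -> : s * (f (v + x) - f v) = (f (v + x) - f v) / x * (s * x).
    by field.
  lra.
Qed.

Lemma derivable_is_derive1 f (v : R) : derivable f v 1 -> is_derive v 1 f (derive1 f v).
Proof. by move=> df; rewrite derive1E; exact: derivableP. Qed.

Lemma derivable_continuous f : (forall v : R, derivable f v 1) -> continuous f.
Proof. by move=> df v; apply: differentiable_continuous; apply/derivable1_diffP. Qed.

Lemma mvt f (df : R -> R) (a b : R) : (forall u : R, is_derive u 1 f (df u)) -> a < b ->
  exists2 c, a < c < b & f b - f a = df c * (b - a).
Proof.
move=> hdf ab.
have [|c] := @MVT R f df a b ab (fun u _ => hdf u).
  apply: continuous_subspaceT; apply: derivable_continuous => v.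
  exact: ex_derive.
by rewrite in_itv/= => cab E; exists c.
Qed.

(** Curvature is only available within [tau] of [v]. Inside, subtracting the tangent and the
    quadratic leaves [g], and two applications of the mean value theorem give [g v <= g (v + y)].
    Outside, convexity propagates the bound reached at distance [tau]. *)
Lemma strong_convexity_remainder f (v x tau C : R) :
  convex_function [set: R^o] (f : R^o -> R^o) ->
  (forall u : R, derivable f u 1) -> (forall u : R, derivable (derive1 f) u 1) ->
  0 < tau -> 0 <= C -> (forall u, `|u - v| <= tau -> C <= derive1 (derive1 f) u) ->
  C / 2 * Num.min `|x| tau ^+ 2 <= f (v + x) - f v - derive1 f v * x.
Proof.
move=> cf df d2f tau0 C0 hC.
have d1 u := derivable_is_derive1 (df u).
have d2 u := derivable_is_derive1 (d2f u).
pose g u := f u - derive1 f v * u - C / 2 * (u - v) ^+ 2.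
have dg (u : R) : is_derive u 1 g (derive1 f u - derive1 f v - C * (u - v)).
  have -> : g = (f - derive1 f v *: id - (C / 2) *: ((id - cst v) ^+ 2)) :> (R -> R).
    by apply/funext => w; rewrite /g.
  have d1u := d1 u.
  apply: is_derive_eq.
  rewrite /= subr0 expr1 /GRing.scale/= !mulr1.
  by have -> : (id - cst v) u = u - v :> R by []; field.
have local (y : R) : `|y| <= tau -> C / 2 * y ^+ 2 <= f (v + y) - f v - derive1 f v * y.
  move=> ytau; suff : g v <= g (v + y).
    have -> : g v = f v - derive1 f v * v by rewrite /g; ring.
    have -> : g (v + y) = f (v + y) - derive1 f v * (v + y) - C / 2 * y ^+ 2 by rewrite /g; ring.
    by move=> h; lra.
  have [y0|y0|<-] := ltgtP 0 y; last by rewrite addr0.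
  - rewrite ger0_norm ?(ltW y0)// in ytau.
    have vy : v < v + y by rewrite ltrDl.
    have [c /andP[c1 c2] E] := mvt dg vy.
    have [c' /andP[c3 c4] E'] := mvt d2 c1.
    have : C <= derive1 (derive1 f) c' by apply: hC; rewrite ger0_norm; lra.
    rewrite -[g v <= _]subr_ge0 E => h; apply: mulr_ge0; last by lra.
    by rewrite E' -mulrBl mulr_ge0//; lra.
  - rewrite ltr0_norm// in ytau.
    have vy : v + y < v by lra.
    have [c /andP[c1 c2] E] := mvt dg vy.
    have [c' /andP[c3 c4] E'] := mvt d2 c2.
    have hc : C <= derive1 (derive1 f) c' by apply: hC; rewrite ltr0_norm; lra.
    have E2 : derive1 f c - derive1 f v = derive1 (derive1 f) c' * (c - v) by lra.
    rewrite -subr_le0 E E2 -mulrBl.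
    have -> : (derive1 (derive1 f) c' - C) * (c - v) * (v - (v + y)) = - ((derive1 (derive1 f) c' - C) * (v - c) * (- y)) by ring.
    by rewrite oppr_le0 !mulr_ge0//; lra.
(* For [s = tau / |x|], the remainder at [s x] is at most [s] times that at [x], hence at most the
   latter, which is nonnegative by the tangent inequality. *)
have [xtau|xtau] := leP `|x| tau.
  by rewrite -normrX ger0_norm ?sqr_ge0//; exact: local.
have ax : 0 < `|x| by apply: lt_trans xtau.
pose s := tau / `|x|.
have s0 : 0 < s by rewrite divr_gt0.
have s1 : s <= 1 by rewrite ler_pdivrMr// mul1r ltW.
have sx : `|s * x| = tau by rewrite normrM gtr0_norm// divfK// gt_eqF.
have := local (s * x); rewrite sx lexx => /(_ isT).
rewrite -[(s * x) ^+ 2]ger0_norm ?sqr_ge0// normrX sx => h1.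
have tang := convex_tangent x cf (df v).
have := @convex_chord f v x s cf; rewrite (ltW s0) s1 => /(_ isT) h2.
nra.
Qed.

End ConvexCalculus.

Section LossFacts.
Context {R : realType} (Y : set R) (L : R -> R -> R) (CL : R).
Hypotheses (cL : convex_C2_loss Y L) (lipL : loss1_lipschitz Y L CL) (CL0 : 0 < CL).

Lemma loss1_continuous y : Y y -> continuous (loss1 L ^~ y).
Proof. by move=> /cL[_ _ d2 _]; exact: derivable_continuous. Qed.

(** The difference of the two losses has derivative at most [CL * |y' - y|] by the Lipschitz
    assumption. *)
Lemma loss_increment_perturb v x y y' : Y y -> Y y' ->
  `|(L (v + x) y' - L v y') - (L (v + x) y - L v y)| <= CL * `|y' - y| * `|x|.
Proof.
move=> Yy Yy'; have [_ d1 _ _] := cL Yy; have [_ d1' _ _] := cL Yy'.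
pose g u := L u y' - L u y.
have dg (u : R) : is_derive u 1 g (loss1 L u y' - loss1 L u y).
  by apply: is_deriveB; apply: derivable_is_derive1.
have key a b : a < b -> `|g b - g a| <= CL * `|y' - y| * (b - a).
  move=> ab; have [c _ ->] := mvt dg ab.
  rewrite normrM (ger0_norm (x := b - a)); last by lra.
  by rewrite ler_wpM2r//; [lra|exact: lipL].
have -> : (L (v + x) y' - L v y') - (L (v + x) y - L v y) = g (v + x) - g v.
  by rewrite /g; ring.
have [x0|x0|<-] := ltgtP 0 x; last by rewrite addr0 subrr !normr0 mulr0.
- have /key : v < v + x by lra.
  by rewrite (gtr0_norm x0); have -> : v + x - v = x by ring.
- have /key : v + x < v by lra.
  by rewrite distrC (ltr0_norm x0); have -> : v - (v + x) = - x by ring.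
Qed.

(** [loss1 L] is continuous in its first argument only for outputs in [Y]. With [s] dense in [Y],
    the Lipschitz assumption gives [loss1 L u h < c] exactly when
    [loss1 L u (s k) + CL |h - s k| < c] for some [k], a countable union of measurable sets. *)
Lemma measurable_loss1 d (T : measurableType d) (u h : T -> R) :
  measurable_fun setT u -> measurable_fun setT h -> (forall z, Y (h z)) ->
  measurable_fun setT (fun z => loss1 L (u z) (h z)).
Proof.
move=> mu mh Yh.
have [[y0 Y0]|nY] := pselect (exists y, Y y); last first.
  move=> _ B mB; rewrite (_ : _ `&` _ = set0)//.
  by apply/seteqP; split => // z _; apply: nY; exists (h z).
have [s [Ys sd]] := dense_sequence_R Y0.
apply: (measurability _ (RGenInftyO.measurableE R)) => //.
move=> _ [_ [c ->] <-]; rewrite setTI.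
have -> : (fun z => loss1 L (u z) (h z)) @^-1` `]-oo, c[ =
    \bigcup_k [set z | loss1 L (u z) (s k) + CL * `|h z - s k| < c].
  apply/seteqP; split => z /=; rewrite in_itv/=.
    move=> lc; pose e := (c - loss1 L (u z) (h z)) / (2 * CL).
    have e0 : 0 < e by rewrite divr_gt0 ?mulr_gt0// subr_gt0.
    have [k] := sd (h z) (Yh z) e e0; rewrite -ball_normE/= => hk.
    exists k => //=.
    have := lipL (u z) (Ys k) (Yh z); rewrite ler_norml => /andP[_ l1].
    have : CL * `|h z - s k| < CL * e by rewrite ltr_pM2l.
    have -> : CL * e = (c - loss1 L (u z) (h z)) / 2 by rewrite /e; field; rewrite gt_eqF.
    rewrite [`|s k - h z|]distrC in l1.
    by move=> ?; lra.
  move=> [k _ /= lc].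
  have := lipL (u z) (Yh z) (Ys k); rewrite ler_norml => /andP[_ l1]; lra.
apply: bigcup_measurable => k _.
have mg : measurable_fun setT (fun z => loss1 L (u z) (s k) + CL * `|h z - s k|).
  apply: measurable_funD.
    apply: (measurableT_comp _ mu).
    exact: continuous_measurable_fun (loss1_continuous (Ys k)).
  apply: measurable_funM; first exact: measurable_cst.
  apply: measurableT_comp; first exact: normr_measurable.
  exact: measurable_funB mh (measurable_cst _).
have := mg measurableT _ (measurable_itv `]-oo, c[); rewrite setTI.
by under eq_set do rewrite /= in_itv/=.
Qed.

(** Samples with [b i = 1] contribute the curvature bound, the others the tangent inequality. The
    noise products are split with the weight [lam], which is later [C2]. *)
Lemma empirical_gap m (C tau lam : R) (v x y y' b : 'I_m -> R) :
  (forall i, Y (y i)) -> (forall i, Y (y' i)) -> 0 <= C -> 0 < tau -> 0 < lam ->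
  (forall i, b i = 0 \/ b i = 1) ->
  (forall i, b i = 1 -> forall u, `|u - v i| <= tau -> C <= loss2 L u (y i)) ->
  \sum_i loss1 L (v i) (y i) * x i + C / 2 * \sum_i (b i * Num.min `|x i| tau) ^+ 2
   - CL / 2 * (lam * \sum_i `|y' i - y i| ^+ 2 + lam^-1 * \sum_i x i ^+ 2)
  <= \sum_i (L (v i + x i) (y' i) - L (v i) (y' i)).
Proof.
move=> Yy Yy' C0 tau0 lam0 b01 hb.
rewrite !mulr_sumr -!big_split/= mulr_sumr -sumrB; apply: ler_sum => i _.
have [cv d1 d2 _] := cL (Yy i).
have key : C / 2 * (b i * Num.min `|x i| tau) ^+ 2 <=
    L (v i + x i) (y i) - L (v i) (y i) - loss1 L (v i) (y i) * x i.
  have [b0|b1] := b01 i.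
    by rewrite b0 mul0r expr0n mulr0 subr_ge0; exact: convex_tangent.
  rewrite b1 mul1r.
  apply: (strong_convexity_remainder (f := L ^~ (y i))) => // u hu.
  exact: (hb i b1 u hu).
have := loss_increment_perturb (v i) (x i) (Yy i) (Yy' i).
rewrite ler_norml => /andP[h1 _].
have am : CL * `|y' i - y i| * `|x i| <=
    CL / 2 * (lam * `|y' i - y i| ^+ 2 + lam^-1 * x i ^+ 2).
  have -> : x i ^+ 2 = `|x i| ^+ 2 by rewrite -normrX ger0_norm ?sqr_ge0.
  have h : 0 <= lam^-1 * (lam * `|y' i - y i| - `|x i|) ^+ 2.
    by rewrite mulr_ge0 ?sqr_ge0// invr_ge0 ltW.
  have E : lam^-1 * (lam * `|y' i - y i| - `|x i|) ^+ 2 =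
    lam * `|y' i - y i| ^+ 2 + lam^-1 * `|x i| ^+ 2 - 2 * (`|y' i - y i| * `|x i|).
    by field; rewrite gt_eqF.
  rewrite E in h; have := mulr_ge0 (ltW CL0) h; lra.
lra.
Qed.

End LossFacts.

(** * Whitening *)

Section Width.
Context {R : realType}.
Local Open Scope ereal_scope.
Notation RR := (measurableTypeR R).
Notation Gam := (@std_normal R).

Let sup_dot n (D : set 'cV[R]_n) (t : R) (v : 'cV[R]_n) :=
  ereal_sup [set (dot v x)%:E | x in D `&` [set x | (norm2 x <= t)%R]].

Lemma sup_dot_ge0 n (D : set 'cV[R]_n) t v : (0 <= t)%R -> D 0%R -> 0 <= sup_dot D t v.
Proof.
move=> t0 D0; apply: ereal_sup_ubound; exists 0%R; last by rewrite dot0r.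
by split => //=; rewrite /norm2 dot0l sqrtr0.
Qed.

(** [2 <v, x> <= |v|^2 + |x|^2] bounds the supremum by [(4 + t^2) exp (|v|^2 / 8)], which is
    integrable; so [fine] loses nothing in [local_width]. *)
Lemma local_width_fin n (D : set 'cV[R]_n) t : (0 <= t)%R -> D 0%R ->
  \int[Gam n]_g sup_dot D t (vec g) = (local_width D t)%:E.
Proof.
move=> t0 D0; rewrite /local_width fineK// ge0_fin_numE; last first.
  by apply: integral_ge0 => g _; exact: sup_dot_ge0.
have [A A1 hA] := @std_normal1_expsq_fin R.
have A0 : (0 <= A)%R by apply: le_trans A1.
pose F (g : n.-tuple RR) := (expR (dot (vec g) (vec g) / 8))%:E.
have F0 g : 0 <= F g by rewrite lee_fin expR_ge0.
have mF : measurable_fun setT F.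
  apply/measurable_EFinP; apply: measurableT_comp => //.
  by apply: measurable_funM; [apply: measurable_dot; mv2|exact: measurable_cst].
have k0 : (0 <= 4 + t ^+ 2 :> R)%R by rewrite addr_ge0// sqr_ge0.
apply: (@le_lt_trans _ _ (\int[Gam n]_g ((4 + t ^+ 2)%:E * F g))); last first.
  rewrite (ge0_integralZl_EFin (Gam n) measurableT (fun g _ => F0 g) mF k0).
  apply: (@le_lt_trans _ _ ((4 + t ^+ 2)%:E * (A ^+ n)%:E)); last by rewrite -EFinM ltry.
  by apply: lee_wpmul2l; [rewrite lee_fin|exact: std_normal_expsq].
apply: le_ge0_integral => [g|g]; first exact: sup_dot_ge0.
apply: ge_ereal_sup => _ [x [_ /= xt] <-]; rewrite /F -EFinM lee_fin.
set v := vec g.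
have := dot_ge0 (v - x)%R.
have -> : (dot (v - x) (v - x) = dot v v - 2 * dot v x + dot x x)%R.
  by rewrite dotDl !dotDr !dotNl !dotNr (dotC x v); ring.
move=> h.
have xx : (dot x x <= t ^+ 2)%R by rewrite -sqr_norm2 lerXn2r ?nnegrE ?norm2_ge0.
have e1 : (1 + dot v v / 8 <= expR (dot v v / 8))%R by exact: expR_ge1Dx.
have vv := dot_ge0 v.
have : (0 <= t ^+ 2 * (expR (dot v v / 8) - 1))%R.
  by rewrite mulr_ge0 ?sqr_ge0// subr_ge0; lra.
lra.
Qed.

Lemma local_width_ge0 n (D : set 'cV[R]_n) t : (0 <= t)%R -> D 0%R -> (0 <= local_width D t)%R.
Proof.
move=> t0 D0; rewrite -lee_fin -local_width_fin//.
by apply: integral_ge0 => g _; exact: sup_dot_ge0.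
Qed.

Lemma gmax_width n (D : set 'cV[R]_n) t (G : 'M[R]_n) (hs : seq 'cV[R]_n) :
  (0 <= t)%R -> D 0%R -> isometry_mx G ->
  (forall h, h \in hs -> exists2 x, D x /\ (norm2 x <= t)%R & h = (G *m x)%R) ->
  \int[Gam n]_g (gmax hs (vec g))%:E <= (local_width D t)%:E.
Proof.
move=> t0 D0 iG hD; rewrite -local_width_fin//.
rewrite -(isometry_law_invariant iG (F := fun v => (gmax hs v)%:E)); first last.
- by move=> v; rewrite lee_fin gmax_ge0.
- by apply/measurable_EFinP; apply: mvec_gmax; mv2.
apply: le_ge0_integral => g; first by rewrite lee_fin gmax_ge0.
rewrite /gmax; have [->|[h hh ->]] := max0_attained hs (dot (G *m vec g)%R).
  exact: sup_dot_ge0.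
have [x Dx ->] := hD h hh; rewrite iG.
by apply: ereal_sup_ubound; exists x.
Qed.

End Width.

Section Whitening.
Context {R : realType} d (Omega : measurableType d) (P : probability Omega R)
  dS (S : measurableType dS) (Q : probability S R).
Local Open Scope ereal_scope.
Notation RT n := (n.-tuple (measurableTypeR R)).
Variables (m n : nat) (Sigma B : 'M[R]_n)
  (a : 'I_m -> {RV P >-> RT n}) (xi : 'I_m -> {RV P >-> S}).

Definition whiten (w : Omega) : m.-tuple (RT n * S) :=
  [tuple (unvec (B *m vec (a i w))%R, xi i w) | i < m].

Lemma tnth_whiten w i : tnth (whiten w) i = (unvec (B *m vec (a i w))%R, xi i w).
Proof. by rewrite tnth_mktuple. Qed.

Lemma measurable_whiten : measurable_fun setT whiten.
Proof.
apply/measurable_fun_tnthP => i.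
rewrite (_ : _ \o _ = (fun w => (unvec (B *m vec (a i w))%R : RT n, xi i w))); last first.
  by apply/funext => w; rewrite /= tnth_whiten.
apply/measurable_fun_pair => //=.
by apply: mvec_unvec; apply: mvec_mulmx; apply: mvec_vec.
Qed.

Hypotheses (aN : forall i, is_centered_normal (a i) Sigma)
  (xiQ : forall i (X : set S), measurable X -> P (xi i @^-1` X) = Q X)
  (ind : samples_independent a xi) (BS : (B *m Sigma *m B^T = 1%:M)%R).

(** If [a_i] has the law of [M g] with [M M^T = Sigma], then [B M] is orthogonal, so [B a_i] is
    standard normal whatever [M] is. *)
Lemma whiten_law (E : set (m.-tuple (RT n * S))) : measurable E ->
  P (whiten @^-1` E) = iid_prob (std_normal n \x Q) m E.
Proof.
move=> mE.
have mW : measurable_fun setT whiten := measurable_whiten.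
apply: (@iid_prob_unique _ _ _ _ _ (std_normal n) Q m (pushforward P whiten)) => // A X mA mX.
rewrite /pushforward.
pose A' i := [set g : RT n | A i (unvec (B *m vec g)%R)].
have mA' i : measurable (A' i).
  rewrite -[A' i]setTI; have mU : measurable_fun setT (fun g : RT n => unvec (B *m vec g)%R : RT n).
    by apply: mvec_unvec; mv2.
  exact: mU.
transitivity (P [set w | forall i, A' i (a i w) /\ X i (xi i w)]).
  congr (P _).
  by apply/seteqP; split => w /= h i; have := h i; rewrite tnth_whiten.
rewrite (ind mA' mX); apply: eq_bigr => i _; rewrite xiQ//; congr (_ * _).
have [M [MM hM]] := aN i.
rewrite hM// -[RHS](@std_normal_isometry_set _ _ (B *m M)%R)//; last first.
  apply/isometry_mxP; apply: mulmx1C.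
  by rewrite trmx_mul mulmxA -(mulmxA B) MM.
congr (std_normal n _); apply/seteqP; split => g /=; rewrite /A' /= unvecK mulmxA//.
Qed.

End Whitening.

Lemma continuous_sumr (R : realType) (V : topologicalType) (I : Type) (s : seq I)
  (F : I -> V -> R) : (forall i, continuous (F i)) ->
  continuous (fun h => \sum_(i <- s) F i h).
Proof.
move=> cF h; elim: s => [|i s IH].
  rewrite (_ : (fun _ => _) = (fun=> 0)); first exact: cst_continuous.
  by apply/funext => x; rewrite big_nil.
rewrite (_ : (fun _ => _) = (F i \+ (fun h => \sum_(i <- s) F i h))); last first.
  by apply/funext => x; rewrite big_cons.
exact: continuousD (cF i h) IH.
Qed.

Section GoodClosure.
Context {R : realType} d (S : measurableType d) (n : nat).
Notation RR := (measurableTypeR R).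
Notation T := (n.+1.-tuple RR * S)%type.
Variables (c0 b0 : RR -> S -> RR) (k t : R) (m : nat) (theta Lam : R).

(** Each condition in [good] is an inequality for a continuous function of [h], hence passes to
    limits. *)
Lemma good_dense (A : set 'cV[R]_n.+1) (s : nat -> 'cV[R]_n.+1) (v : m.-tuple T) h :
  (forall x, A x -> forall e : R, 0 < e -> exists k, ball x e (s k)) ->
  (forall j, good c0 b0 k t theta Lam v (s j)) -> A h ->
  good c0 b0 k t theta Lam v h.
Proof.
move=> sd gs Ah.
have cd (u : 'cV[R]_n.+1) : continuous (dot u) := @continuous_dotr R _ u.
have ge := fun f c cf => @continuous_ge_dense R _ A s f c h cf sd.
split.
- apply: (ge (fun h => \sum_(i < m) coef c0 (tnth v i) * dot (sample_vec (tnth v i)) h)) => //.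
    apply: continuous_sumr => i x; apply: continuousM; last exact: cd.
    exact: cst_continuous.
  by move=> j; have [] := gs j.
- rewrite -lerN2.
  apply: (ge (fun h => - quad (@sample_vec R _ S n) v h)) => //; last first.
    by move=> j; rewrite lerN2; have [] := gs j.
  move=> x; apply: continuousN; apply: continuous_sumr => i y.
  exact: continuousM (cd _ y) (cd _ y).
- apply: (ge (fun h => \sum_(i < m) (keep b0 (tnth v i) : R) *
      Num.min `|dot (sample_vec (tnth v i)) h| t)) => //; last first.
    by move=> j; have [] := gs j.
  have cm (u : 'cV[R]_n.+1) : continuous (fun h => Num.min `|dot u h| t : R).
    move=> x; apply: (@continuous_min R _ (fun h => `|dot u h|) (fun=> t)).
      by apply: (continuous_comp (cd _ x)); exact: norm_continuous.
    exact: cst_continuous.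
  apply: continuous_sumr => i x.
  exact: (@continuousM R _ (fun=> keep b0 (tnth v i)) _ x (@cst_continuous _ _ _ x) (cm _ x)).
Qed.

End GoodClosure.

(** * The score and the retained samples *)

Section ModelParameters.
Context {R : realType} d (S : measurableType d) (Q : probability S R)
  (Y : set R) (f : S -> R -> R) (L : R -> R -> R) (CL mu sigma eta : R).
Local Open Scope ereal_scope.
Notation RR := (measurableTypeR R).
Notation gam := (std_normal1 R).
Hypotheses (cL : convex_C2_loss Y L) (lipL : loss1_lipschitz Y L CL) (CL0 : (0 < CL)%R)
  (Yf : forall s v, Y (f s v))
  (mf : measurable_fun setT (fun z : RR * S => f z.2 z.1)).

Definition score (s : RR) (q : S) : RR := loss1 L (mu * s)%R (f q s).

Lemma measurable_score : measurable_fun setT (fun y : RR * S => score y.1 y.2).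
Proof.
apply: (measurable_loss1 cL lipL CL0 _ mf) => //.
by apply: measurable_funM; [exact: measurable_cst|exact: measurable_fst].
Qed.

Variables (N : \bar R).

Let kept_set (B : R) : set (RR * S) := [set y | (`|y.1| <= B)%R /\ `|f y.2 y.1|%:E < N].

Definition kept (B : R) (s : RR) (q : S) : RR := \1_(kept_set B) (s, q).

Lemma kept_bool B s q : kept B s q = 0%R \/ kept B s q = 1%R.
Proof. by rewrite /kept indicE; case: (_ \in _); [right|left]. Qed.

Lemma kept1 B s q : kept B s q = 1%R -> (`|s| <= B)%R /\ `|f q s|%:E < N.
Proof.
rewrite /kept indicE; case: (boolP ((s, q) \in kept_set B)) => [|_ /eqP].
  by rewrite inE.
by rewrite eq_sym oner_eq0.
Qed.

Lemma kept0 B s q : kept B s q = 0%R -> (B < `|s|)%R \/ N <= `|f q s|%:E.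
Proof.
rewrite /kept indicE; case: (boolP ((s, q) \in kept_set B)) => [_ /eqP|].
  by rewrite oner_eq0.
rewrite notin_setE => h _; have [sB|] := leP `|s|%R B; last by left.
by right; rewrite leNgt; apply/negP => fN; apply: h.
Qed.

Lemma measurable_kept B : measurable_fun setT (fun y : RR * S => kept B y.1 y.2).
Proof.
rewrite (_ : (fun _ => _) = (\1_(kept_set B) : RR * S -> RR)); last by apply/funext => -[].
apply: measurable_indic.
rewrite (_ : kept_set B = [set y : RR * S | (`|y.1| <= B)%R] `&` [set y | `|f y.2 y.1|%:E < N]) //.
have mn : measurable_fun setT (fun y : RR * S => `|f y.2 y.1|%R) by exact: measurableT_comp.
apply: measurableI.
  by apply: measurable_le_cst; apply: measurableT_comp => //; exact: measurable_fst.
rewrite -[X in measurable X]setTI; apply: emeasurable_fun_infty_o => //.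
exact/measurable_EFinP.
Qed.

(** Markov's inequality, once for [|s|] and once for the output, each with the bound [k / 4]. The
    [C + 1] in the threshold keeps it positive. *)
Lemma kept_mean (k C : R) : (0 < k)%R -> (0 <= C)%R -> \int[gam]_x `|x|%:E <= C%:E ->
  0 < N -> (4 / k)%:E * mean_abs_output Q f <= N ->
  \int[gam \x Q]_y (1 - kept (4 * (C + 1) / k) y.1 y.2)%:E <= (k / 2)%:E.
Proof.
move=> k0 C0 hC N0; rewrite /mean_abs_output unlock.
set F := \int[_]_w _ => hF.
have F0 : 0 <= F by apply: integral_ge0 => y _; rewrite lee_fin.
(* [r] is the inverse of [N], read as 0 when [N] is infinite; the mean output may then be infinite
   as well, and [0 * +oo] is 0. *)
have [r [r0 rF r1]] : exists r : R, [/\ (0 <= r)%R, r%:E * F <= (k / 4)%:E &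
    forall u : R, N <= u%:E -> (1 <= r * u)%R].
  case: N N0 hF => [nu| |]// nu0 hF; last first.
    by exists 0%R; split => //; rewrite mul0e lee_fin divr_ge0// ltW.
  rewrite lte_fin in nu0; exists nu^-1%R; split; first by rewrite invr_ge0 ltW.
    rewrite -lee_pdivlMl// in hF; last by rewrite divr_gt0.
    apply: (@le_trans _ _ (nu^-1%:E * ((4 / k)^-1%:E * nu%:E))).
      by apply: lee_wpmul2l => //; rewrite lee_fin invr_ge0 ltW.
    by rewrite -!EFinM lee_fin invf_div mulrCA mulVf ?mulr1// gt_eqF.
  by move=> u; rewrite lee_fin => nu_u; rewrite -(mulVf (lt0r_neq0 nu0)) ler_pM2l// invr_gt0.
set B := (4 * (C + 1) / k)%R.
have B0 : (0 < B)%R by rewrite divr_gt0// mulr_gt0// ltr_wpDl.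
have mn : measurable_fun setT (fun y : RR * S => `|f y.2 y.1|%:E).
  by apply/measurable_EFinP; exact: measurableT_comp.
have ms : measurable_fun setT (fun y : RR * S => `|y.1|%:E).
  by apply/measurable_EFinP; apply: measurableT_comp => //; exact: measurable_fst.
have n0 (y : RR * S) : setT y -> 0 <= `|f y.2 y.1|%:E by rewrite lee_fin.
have s0 (y : RR * S) : setT y -> 0 <= `|y.1|%:E by rewrite lee_fin.
have iB0 : (0 <= B^-1)%R by rewrite invr_ge0 ltW.
apply: (@le_trans _ _ (\int[gam \x Q]_y (B^-1%:E * `|y.1|%:E + r%:E * `|f y.2 y.1|%:E))).
  apply: le_ge0_integral => -[s q] /=.
    by rewrite lee_fin subr_ge0; have [->|->] := kept_bool B s q.
  rewrite -!EFinM -EFinD lee_fin.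
  have p1 : (0 <= B^-1 * `|s|)%R by rewrite mulr_ge0.
  have p2 : (0 <= r * `|f q s|)%R by rewrite mulr_ge0.
  have [b0|->] := kept_bool B s q; last by lra.
  rewrite b0; have [Bs|/r1] := kept0 b0; last by lra.
  have : (1 <= B^-1 * `|s|)%R by rewrite mulrC ler_pdivlMr// mul1r ltW.
  lra.
have g1 (y : RR * S) : setT y -> 0 <= B^-1%:E * `|y.1|%:E.
  by rewrite -EFinM lee_fin mulr_ge0.
have g2 (y : RR * S) : setT y -> 0 <= r%:E * `|f y.2 y.1|%:E.
  by rewrite -EFinM lee_fin mulr_ge0.
have mg1 : measurable_fun setT (fun y : RR * S => B^-1%:E * `|y.1|%:E).
  by apply: emeasurable_funM => //; exact: measurable_cst.
have mg2 : measurable_fun setT (fun y : RR * S => r%:E * `|f y.2 y.1|%:E).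
  by apply: emeasurable_funM => //; exact: measurable_cst.
rewrite (ge0_integralD (gam \x Q) measurableT g1 mg1 g2 mg2).
rewrite (ge0_integralZl_EFin (gam \x Q) measurableT s0 ms iB0).
rewrite (ge0_integralZl_EFin (gam \x Q) measurableT n0 mn r0).
have -> : \int[gam \x Q]_y `|y.1|%:E = \int[gam]_x `|x|%:E.
  rewrite (ge0_integral_prod _ _ ms (fun z => s0 z I)).
  by apply: eq_integral => x _ /=; rewrite integral_cst_prob.
have -> : (k / 2)%:E = (k / 4)%:E + (k / 4)%:E by rewrite -EFinD; congr EFin; field.
apply: leeD => //; apply: (@le_trans _ _ (B^-1%:E * C%:E)).
  by apply: lee_wpmul2l => //; rewrite lee_fin.
rewrite -EFinM lee_fin /B invf_div mulrAC ler_pdivrMr ?mulr_gt0// ?ltr_wpDl//.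
have := mulr_ge0 (ltW k0) C0; nra.
Qed.

Lemma score_moments : is_model_param Q f L mu sigma eta ->
  [/\ \int[gam \x Q]_y (score y.1 y.2 * y.1)%:E = 0, (0 <= sigma)%R,
    \int[gam \x Q]_y (score y.1 y.2 ^+ 2)%:E = (sigma ^+ 2)%:E, (0 <= eta)%R &
    \int[gam \x Q]_y (score y.1 y.2 ^+ 2 * y.1 ^+ 2)%:E = (eta ^+ 2)%:E].
Proof. by move=> []; rewrite unlock => h1 s0 h2 e0 h3; split. Qed.

End ModelParameters.

(** * The risk increment *)

Section Geometry.
Context {R : realType}.

Lemma norm2Z n c (v : 'cV[R]_n) : 0 <= c -> norm2 (c *: v) = c * norm2 v.
Proof.
move=> c0.
by rewrite /norm2 dotZl dotZr mulrA -expr2 sqrtrM ?sqr_ge0// sqrtr_sqr ger0_norm.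
Qed.

Lemma minimizer_in_ball m n (s : 'M[R]_n) (K : set 'cV[R]_n) (x1 : 'cV[R]_n)
    (L : R -> R -> R) (a : 'I_m -> 'cV[R]_n) (y : 'I_m -> R) t xhat :
  (0 < m)%N -> convex_set K -> K x1 -> 0 < t ->
  (forall i, convex_function [set: R^o] (fun v : R^o => L v (y i) : R^o)) ->
  (forall x, K x -> norm2 (s *m (x - x1)) = t ->
    0 < \sum_i (L (dot (a i) x) (y i) - L (dot (a i) x1) (y i))) ->
  is_empirical_minimizer L K a y xhat -> norm2 (s *m (xhat - x1)) <= t.
Proof.
move=> m0 cK Kx1 t0 cL pos [Kx min]; rewrite leNgt; apply/negP => lt.
set r := norm2 _ in lt; have r0 : 0 < r by exact: lt_trans lt.
pose q := t / r; have q0 : 0 <= q by rewrite divr_ge0 ?(ltW t0) ?(ltW r0).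
have q1 : q <= 1 by rewrite ler_pdivrMr// mul1r (ltW lt).
have Kq : K (x1 + q *: (xhat - x1)).
  have -> : x1 + q *: (xhat - x1) = q *: xhat + (1 - q) *: x1.
    by rewrite scalerBr scalerBl scale1r addrCA addrA.
  exact: set_mem (cK xhat x1 (Itv01 q0 q1) (mem_set Kx) (mem_set Kx1)).
have nq : norm2 (s *m (x1 + q *: (xhat - x1) - x1)) = t.
  by rewrite addrAC subrr add0r -scalemxAr norm2Z// -/r divfK// gt_eqF.
have := pos _ Kq nq; apply/negP; rewrite -leNgt.
apply: (@le_trans _ _ (\sum_i q * (L (dot (a i) xhat) (y i) - L (dot (a i) x1) (y i)))).
  apply: ler_sum => i _.
  have := @convex_chord R (L ^~ (y i)) (dot (a i) x1) (dot (a i) xhat - dot (a i) x1) q (cL i).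
  rewrite q0 q1 => /(_ isT).
  by rewrite dotDr dotZr dotDr dotNr [dot (a i) x1 + (_ - _)]addrC subrK.
rewrite -mulr_sumr sumrB mulr_ge0_le0// subr_le0.
by have := min x1 Kx1; rewrite ler_pM2l// invr_gt0 ltr0n.
Qed.

End Geometry.

Section Descent.
Context {R : realType} d (S : measurableType d) (Y : set R) (f : S -> R -> R)
  (L : R -> R -> R) (CL CMN mu : R) (M N : \bar R).
Hypotheses (cL : convex_C2_loss Y L) (lipL : loss1_lipschitz Y L CL) (CL0 : 0 < CL)
  (Yf : forall s v, Y (f s v)) (CMN0 : 0 < CMN) (N0 : (0 < N)%E)
  (scL : strongly_convex_near0 Y L M N CMN).

(** [|u| <= t + B |mu|], which is at most [1 / 32 + 1 / 4] of the maximum bounded by [M], hence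
    strictly inside the interval of curvature. *)
Lemma kept_curvature (B t s : R) (q : S) (u : R) : 0 <= B -> 0 < t ->
  ((Num.max (32 * t) (4 * B * `|mu|))%:E <= M)%E ->
  kept f N B s q = 1 -> `|u - mu * s| <= t -> CMN <= loss2 L u (f q s).
Proof.
move=> B0 t0 hM /kept1[sB fN] hu.
set mx := Num.max _ _ in hM.
have m1 : 32 * t <= mx by rewrite le_max lexx.
have m2 : 4 * B * `|mu| <= mx by rewrite le_max lexx orbT.
have uM : `|u| < mx.
  have : `|u| <= `|u - mu * s| + `|mu * s| by rewrite -{1}(subrK (mu * s) u) ler_normD.
  have : `|mu| * `|s| <= `|mu| * B by rewrite ler_wpM2l.
  rewrite normrM; lra.
have absE (w r : R) : `|w| < r -> (- r%:E < w%:E < r%:E)%E.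
  by rewrite ltr_norml -EFinN !lte_fin.
apply: scL => //.
  have /andP[h1 h2] := absE _ _ uM; apply/andP; split.
    by apply: le_lt_trans h1; rewrite leeN2.
  exact: lt_le_trans h2 hM.
case: N N0 fN => [nu| |]// _ fN; last by rewrite ltNyr ltry.
by apply: absE; rewrite -lte_fin.
Qed.

(** Balance in units of [m t^2 CMN k^2]: the curvature gives at least [1 / 32], the linear term
    costs at most [1 / 64] by the choice of [theta], and the noise costs less than [1 / 64] by the
    lower bound on [C2]. *)
Lemma good_descent n m (v : m.-tuple (n.+1.-tuple (measurableTypeR R) * S)%type)
    (h : 'cV[R]_n.+1) (y' : 'I_m -> R) (B k t Lam C2 : R) :
  (forall i, Y (y' i)) -> 0 <= B -> 0 < t -> 0 < k -> 0 < C2 -> (0 < m)%N ->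
  ((Num.max (32 * t) (4 * B * `|mu|))%:E <= M)%E ->
  32 * (CL * (1 + Lam)) < C2 * (CMN * k ^+ 2) ->
  C2 ^+ 2 * (\sum_i `|y' i - f (tnth v i).2 (sample_head (tnth v i))| ^+ 2) <= m%:R * t ^+ 2 ->
  good (score f L mu) (kept f N B) k t (CMN * k ^+ 2 / 128) Lam v h ->
  0 < \sum_i (L (mu * sample_head (tnth v i) + dot (sample_vec (tnth v i)) h) (y' i) -
              L (mu * sample_head (tnth v i)) (y' i)).
Proof.
move=> Yy' B0 t0 k0 C20 m0 hM hC2 noise [g1 g2 g3].
have gap := empirical_gap cL lipL CL0 (fun i => dot (sample_vec (tnth v i)) h)
  (v := fun i => mu * sample_head (tnth v i))
  (y := fun i => f (tnth v i).2 (sample_head (tnth v i)))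
  (b := fun i => kept f N B (sample_head (tnth v i)) (tnth v i).2)
  (fun i => Yf _ _) Yy' (ltW CMN0) t0 C20 (fun i => kept_bool _ _ _ _ _)
  (fun i b1 u => kept_curvature B0 t0 hM b1).
apply: lt_le_trans gap.
set S1 := (X in X + _ - _); set S2 := (X in _ + _ * X - _); set E := (X in C2 * X); set S3 := (X in _^-1 * X).
have m0R : 0 < m%:R :> R by rewrite ltr0n.
set X := m%:R * t ^+ 2 in noise.
have X0 : 0 < X by rewrite mulr_gt0// exprn_gt0.
have h1 : - (X * (CMN * k ^+ 2) / 64) <= S1.
  apply: le_trans g1; rewrite lerN2.
  have -> : 2 * m%:R * (CMN * k ^+ 2 / 128) * t ^+ 2 = X * (CMN * k ^+ 2) / 64 by rewrite /X; field.
  exact: lexx.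
have h2 : X * k ^+ 2 / 16 <= S2.
  (* [w^2 >= 2 c w - c^2] at [c = t k / 4], the mean guaranteed by [good], passes from the sum of
     the clipped terms to that of their squares. *)
  pose c := t * k / 4; have c0 : 0 < c by rewrite divr_gt0// mulr_gt0.
  apply: (@le_trans _ _ (\sum_(i < m) (2 * c * clip (kept f N B) t (tnth v i) h - c ^+ 2))).
    rewrite sumrB -mulr_sumr sumr_const card_ord -[c ^+ 2 *+ m]mulr_natl.
    have : 2 * c * (m%:R * c) <= 2 * c * \sum_(i < m) clip (kept f N B) t (tnth v i) h.
      by rewrite ler_pM2l// mulr_gt0.
    have -> : X * k ^+ 2 / 16 = m%:R * c ^+ 2 by rewrite /X /c; field.
    have -> : 2 * c * (m%:R * c) = 2 * (m%:R * c ^+ 2) by ring.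
    by move=> *; lra.
  apply: ler_sum => i _; rewrite /clip /keep.
  set w := _ * Num.min _ _; have := sqr_ge0 (w - c); have -> : (w - c) ^+ 2 = w ^+ 2 - 2 * c * w + c ^+ 2 by ring.
  lra.
have h3 : S3 <= Lam * X.
  have -> : Lam * X = Lam * t ^+ 2 * m%:R by rewrite /X; ring.
  exact: g2.
have h4 : C2 * E <= X / C2.
  by rewrite ler_pdivlMr// mulrC mulrA -expr2.
have h5 : C2^-1 * S3 <= Lam * X / C2 by rewrite mulrC ler_pM2r ?invr_gt0.
have h6 : CL / 2 * (C2 * E + C2^-1 * S3) <= CL * (1 + Lam) * (X / C2) / 2.
  have : C2 * E + C2^-1 * S3 <= (1 + Lam) * (X / C2).
    have -> : (1 + Lam) * (X / C2) = X / C2 + Lam * X / C2 by ring.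
    exact: lerD.
  have CL2 : 0 < CL / 2 by rewrite divr_gt0.
  by rewrite -(ler_pM2l CL2) => /le_trans; apply; rewrite le_eqVlt; apply/orP; left; apply/eqP; field; rewrite gt_eqF.
have h7 : CL * (1 + Lam) * (X / C2) / 2 < X * (CMN * k ^+ 2) / 64.
  have XC : 0 < X / C2 / 64 by rewrite !divr_gt0.
  have := hC2; rewrite -(ltr_pM2l XC).
  have -> : X / C2 / 64 * (32 * (CL * (1 + Lam))) = CL * (1 + Lam) * (X / C2) / 2 by field; rewrite gt_eqF.
  by have -> : X / C2 / 64 * (C2 * (CMN * k ^+ 2)) = X * (CMN * k ^+ 2) / 64 by field; rewrite gt_eqF.
have h8 : X * (CMN * k ^+ 2) / 32 <= CMN / 2 * S2.
  have -> : X * (CMN * k ^+ 2) / 32 = CMN / 2 * (X * k ^+ 2 / 16) by field.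
  by rewrite ler_pM2l// divr_gt0.
lra.
Qed.

End Descent.

(** * The good event and the choice of constants *)

Section GoodEvent.
Context {R : realType} d (S : measurableType d) (Q : probability S R) (n : nat).
Local Open Scope ereal_scope.
Notation RR := (measurableTypeR R).
Notation RT n := (n.-tuple RR).
Notation gam := (std_normal1 R).
Notation Gam := (@std_normal R).
Notation T := (RT n.+1 * S)%type.
Variables (c0 b0 : RR -> S -> RR) (sigma eta k A t : R).
Hypotheses (mc0 : measurable_fun setT (fun y => c0 y.1 y.2))
  (mb0 : measurable_fun setT (fun y => b0 y.1 y.2))
  (b01 : forall s w, (0 <= b0 s w <= 1)%R)
  (c0_mean : \int[gam \x Q]_y (c0 y.1 y.2 * y.1)%:E = 0)
  (c0_sq : \int[gam \x Q]_y (c0 y.1 y.2 ^+ 2)%:E = (sigma ^+ 2)%:E)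
  (c0_sqs : \int[gam \x Q]_y (c0 y.1 y.2 ^+ 2 * y.1 ^+ 2)%:E = (eta ^+ 2)%:E)
  (kE : \int[gam]_x (Num.min `|x| 1)%:E = k%:E)
  (b0_mean : \int[gam \x Q]_y (1 - b0 y.1 y.2)%:E <= (k / 2)%:E)
  (A0 : (0 <= A)%R) (hA : \int[gam]_x (expR (x ^+ 2 / 8))%:E <= A%:E)
  (t0 : (0 < t)%R).

Lemma good_event (m : nat) (theta Lam eps a W : R) (D : set 'cV[R]_n.+1) (h0 : 'cV[R]_n.+1) :
  (0 < m)%N -> (0 < theta)%R -> (0 < k)%R -> (0 <= W)%R -> (0 < a)%R -> D h0 ->
  (forall h, D h -> dot h h = t ^+ 2)%R ->
  (forall hs : seq 'cV[R]_n.+1, (forall h, h \in hs -> D h) ->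
    \int[Gam n.+1]_g (gmax hs (vec g))%:E <= W%:E) ->
  [/\ 4 * eta ^+ 2 <= eps * (m%:R * theta ^+ 2 * t ^+ 2),
      m%:R * sigma ^+ 2 <= a ^+ 2,
      4 * (W * a) <= eps * (m%:R * theta * t ^+ 2),
      4 * (expR (W ^+ 2 / t ^+ 2) * A ^+ m) <= eps * expR (Lam * m%:R / 98) &
      32 * W <= eps * (Num.sqrt m%:R * t * k)]%R ->
  exists E : set (m.-tuple T), [/\ measurable E, (1 - eps)%:E <= iid_prob (Gam n.+1 \x Q) m E &
    forall v h, E v -> D h -> good c0 b0 k t theta Lam v h].
Proof.
move=> m0 th0 k0 W0 a0 Dh0 Dt DW [N1 N2a N2b N3 N4].
have [s [Ds sd]] := dense_sequence_cV Dh0.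
have mG h : measurable [set v : m.-tuple T | good c0 b0 k t theta Lam v h].
  by move=> X; exact: (measurable_good k t mc0 mb0).
pose E := [set v : m.-tuple T | forall j, good c0 b0 k t theta Lam v (s j)].
have mE : measurable E.
  rewrite (_ : E = \bigcap_j [set v : m.-tuple T | good c0 b0 k t theta Lam v (s j)]).
    exact: bigcap_measurable.
  by apply/seteqP; split => v /= Ev; [move=> j _; exact: Ev|move=> j; exact: Ev].
exists E; split => //; last by move=> v h Ev; exact: (good_dense sd Ev).
have bad : iid_prob (Gam n.+1 \x Q) m (~` E) <= eps%:E.
  apply: (countable_bad_prob (G := fun h => [set v : m.-tuple T | good c0 b0 k t theta Lam v h])) => // hs hsk.
  have hsD h : h \in hs -> D h by move=> /hsk[j ->].
  apply: (finite_good mc0 mb0 b01 c0_mean c0_sq c0_sqs kE b0_mean A0 hA t0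
    m0 th0 k0 W0 a0 _ (DW hs hsD) N1 N2a N2b N3 N4).
  by move=> h /hsD /Dt.
move: bad; rewrite probability_setC// EFinB.
have : iid_prob (Gam n.+1 \x Q) m E \is a fin_num by exact: fin_num_measure.
by move=> /fineK <-; rewrite -EFinB !lee_fin => ?; lra.
Qed.

End GoodEvent.

(** Turns the sample size and accuracy conditions into those of [finite_good]. Since the local
    dimension is [W^2 / t^2], its root is [W / t]. *)
Lemma deviation_parameters (R : realType) (A eps theta k C1 C2 t W sigma eta : R) (m : nat) :
  (0 < m)%N -> 1 <= A -> 0 < eps < 1 -> 0 < theta -> 0 < k -> 0 < t -> 0 <= W ->
  0 <= sigma -> 0 <= eta -> 1 <= C1 -> (32 / (k * eps)) ^+ 2 <= C1 ->
  C1 * (W ^+ 2 / t ^+ 2) <= m%:R -> 4 / (eps * theta) <= C2 ->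
  C2 * ((sigma * Num.sqrt (W ^+ 2 / t ^+ 2) + eta) / Num.sqrt m%:R) < t ->
  exists2 a, 0 < a &
  [/\ 4 * eta ^+ 2 <= eps * (m%:R * theta ^+ 2 * t ^+ 2),
      m%:R * sigma ^+ 2 <= a ^+ 2,
      4 * (W * a) <= eps * (m%:R * theta * t ^+ 2),
      4 * (expR (W ^+ 2 / t ^+ 2) * A ^+ m) <=
        eps * expR (98 * (1 + A + 4 / eps) * m%:R / 98) &
      32 * W <= eps * (Num.sqrt m%:R * t * k)].
Proof.
move=> m0 A1 /andP[eps0 eps1] th0 k0 t0 W0 s0 e0 C11 C1k dm C2b.
have m1 : 1 <= m%:R :> R by rewrite ler1n.
set q : R := Num.sqrt m%:R; have q2 : q ^+ 2 = m%:R by rewrite sqr_sqrtr.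
have q0 : 0 < q by rewrite sqrtr_gt0 ltr0n.
have et0 : 0 < eps * theta by rewrite mulr_gt0.
have C2et : 4 <= C2 * (eps * theta) by rewrite -ler_pdivrMr.
have C20 : 0 < C2 by rewrite -(pmulr_lgt0 _ et0); lra.
have -> : Num.sqrt (W ^+ 2 / t ^+ 2) = W / t.
  by rewrite -expr_div_n sqrtr_sqr ger0_norm// divr_ge0// (ltW t0).
have d0 : 0 <= W / t by rewrite divr_ge0// (ltW t0).
move=> h; have {}h : C2 * (sigma * (W / t) + eta) < t * q.
  by rewrite -ltr_pdivrMr// -mulrA.
have sd0 : 0 <= sigma * (W / t) by rewrite mulr_ge0.
have he : C2 * eta <= t * q.
  apply: le_trans (ltW h); rewrite ler_pM2l//; lra.
have hs : C2 * (sigma * (W / t)) <= t * q.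
  apply: le_trans (ltW h); rewrite ler_pM2l//; lra.
have dm1 : W ^+ 2 / t ^+ 2 <= m%:R.
  apply: le_trans dm; rewrite -[leLHS]mul1r ler_wpM2r//.
  by rewrite divr_ge0 ?sqr_ge0.
have G1 : 4 * eta ^+ 2 <= eps * (m%:R * theta ^+ 2 * t ^+ 2).
  have h1 : 4 * eta <= (eps * theta) * (t * q).
    apply: (@le_trans _ _ (C2 * (eps * theta) * eta)); first by rewrite ler_wpM2r.
    by rewrite mulrAC mulrC ler_pM2l.
  have h2 : (4 * eta) ^+ 2 <= ((eps * theta) * (t * q)) ^+ 2.
    apply: lerXn2r => //; rewrite nnegrE; first by rewrite mulr_ge0.
    by apply: mulr_ge0; [exact: ltW|rewrite mulr_ge0// ?(ltW t0) ?(ltW q0)].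
  have e2 : eps ^+ 2 <= eps by rewrite expr2 -[leRHS]mulr1 ler_pM2l// ltW.
  set Z := m%:R * theta ^+ 2 * t ^+ 2.
  have Z0 : 0 <= Z := mulr_ge0 (mulr_ge0 (ler0n _ _) (sqr_ge0 _)) (sqr_ge0 _).
  have E : ((eps * theta) * (t * q)) ^+ 2 = eps ^+ 2 * Z by rewrite /Z -q2; ring.
  have : eps ^+ 2 * Z <= eps * Z by rewrite ler_wpM2r.
  rewrite E (_ : (4 * eta) ^+ 2 = 16 * eta ^+ 2) in h2; last by ring.
  have := sqr_ge0 eta.
  lra.
(* The three summands of [Lam / 98] absorb one factor each: [expR (W^2 / t^2) <= expR m],
   [A^m <= expR (A m)] and [4 <= eps expR (4 m / eps)]. *)
have G4 : 4 * (expR (W ^+ 2 / t ^+ 2) * A ^+ m) <=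
        eps * expR (98 * (1 + A + 4 / eps) * m%:R / 98).
  have -> : 98 * (1 + A + 4 / eps) * m%:R / 98 = m%:R + A * m%:R + 4 / eps * m%:R.
    by field; rewrite gt_eqF.
  rewrite !expRD; set u := expR m%:R; set w := expR (A * m%:R).
  have hu : expR (W ^+ 2 / t ^+ 2) <= u by rewrite ler_expR.
  have hw : A ^+ m <= w.
    rewrite /w expRM_natr; apply: lerXn2r; rewrite ?nnegrE ?expR_ge0//; first by lra.
    by have := expR_ge1Dx A; lra.
  have hz : 4 <= eps * expR (4 / eps * m%:R).
    have : 4 / eps <= expR (4 / eps * m%:R).
      apply: le_trans (expR_ge1Dx _).
      have : 4 / eps * 1 <= 4 / eps * m%:R by rewrite ler_pM2l// divr_gt0.
      lra.
    by rewrite ler_pdivrMr// mulrC.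
  have -> : eps * (u * w * expR (4 / eps * m%:R)) = eps * expR (4 / eps * m%:R) * (u * w) by ring.
  have Am0 : 0 <= A ^+ m by rewrite exprn_ge0//; lra.
  have E0 : 0 <= expR (W ^+ 2 / t ^+ 2) := expR_ge0 _.
  exact: ler_pM (ler0n _ 4) (mulr_ge0 E0 Am0) hz (ler_pM E0 Am0 hu hw).
have G5 : 32 * W <= eps * (q * t * k).
  have ke0 : 0 < k * eps by rewrite mulr_gt0.
  have hx : (32 / (k * eps) * (W / t)) ^+ 2 <= q ^+ 2.
    rewrite exprMn q2 [(W / t) ^+ 2]expr_div_n; apply: le_trans dm; rewrite ler_wpM2r//.
    by rewrite divr_ge0 ?sqr_ge0.
  have : 32 / (k * eps) * (W / t) <= q.
    rewrite -(@ler_pXn2r _ 2)// nnegrE ?(ltW q0)//.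
    by rewrite mulr_ge0// divr_ge0// ltW.
  have kt0 : 0 < k * eps * t by rewrite mulr_gt0.
  rewrite -(ler_pM2l kt0).
  have -> : k * eps * t * (32 / (k * eps) * (W / t)) = 32 * W.
    by field; rewrite !gt_eqF.
  by have -> : k * eps * t * q = eps * (q * t * k) by ring.
(* For zero width nothing bounds [a] from above, so any value beyond [sqrt m * sigma] will do. *)
have [W0'|Wp] := leP W 0.
  have -> : W = 0 by apply/eqP; rewrite eq_le W0' W0.
  have a0 : 0 < q * sigma + 1 by rewrite ltr_wpDl// mulr_ge0// (ltW q0).
  exists (q * sigma + 1) => //.
  have qs0 : 0 <= q * sigma by rewrite mulr_ge0// ltW.
  split => //.
  - rewrite -q2 -exprMn; apply: lerXn2r; rewrite ?nnegrE ?(ltW a0)//; lra.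
  - rewrite mul0r mulr0.
    exact: mulr_ge0 (ltW eps0) (mulr_ge0 (mulr_ge0 (ler0n _ _) (ltW th0)) (sqr_ge0 _)).
  - move: G4; rewrite (_ : W = 0) //; by apply/eqP; rewrite eq_le W0' W0.
  - by move: G5; rewrite (_ : W = 0) //; apply/eqP; rewrite eq_le W0' W0.
have CW0 : 0 < C2 * W by rewrite mulr_gt0.
(* Chosen so that [4 W a = 4 m t^2 / C2], which [C2 >= 4 / (eps theta)] controls; the lower bound on
   [a] is then the [sigma] part of the accuracy condition. *)
exists (m%:R * t ^+ 2 / (C2 * W)); first by rewrite divr_gt0// mulr_gt0 ?exprn_gt0//; lra.
split => //.
  rewrite -q2 -exprMn; apply: lerXn2r; rewrite ?nnegrE.
  - by rewrite mulr_ge0// ltW.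
  - by rewrite divr_ge0 ?(ltW CW0)// mulr_ge0 ?sqr_ge0.
  rewrite ler_pdivlMr//.
  have tq0 : 0 < t * q by rewrite mulr_gt0.
  move: hs; rewrite -(ler_pM2l tq0).
  have -> : t * q * (C2 * (sigma * (W / t))) = q * sigma * (C2 * W) by field; rewrite gt_eqF.
  by have -> : t * q * (t * q) = q ^+ 2 * t ^+ 2 by ring.
have -> : 4 * (W * (m%:R * t ^+ 2 / (C2 * W))) = 4 / C2 * (m%:R * t ^+ 2).
  by field; rewrite !gt_eqF.
have -> : eps * (m%:R * theta * t ^+ 2) = eps * theta * (m%:R * t ^+ 2) by ring.
apply: ler_wpM2r; first exact: mulr_ge0 (ler0n _ _) (sqr_ge0 _).
by rewrite ler_pdivrMr// mulrC.
Qed.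

Theorem theorem2p8 (R : realType) :
  exists c1 c2 : R, [/\ 0 < c1, 0 < c2 &
  forall p : R, 0 < p < 1 ->
  exists C1 : R, 0 < C1 /\
  forall CMN CL : R, 0 < CMN -> 0 < CL ->
  exists C2 : R, 0 < C2 /\
  forall (m n : nat) (Sigma sqrtSigma : 'M[R]_n) (x0 : 'cV[R]_n)
    (dO : measure_display) (Omega : measurableType dO)
    (P : probability Omega R)
    (dS : measure_display) (S : measurableType dS) (Q : probability S R)
    (Y : set R) (f : S -> R -> R) (L : R -> R -> R)
    (a : 'I_m -> {RV P >-> n.-tuple (measurableTypeR R)})
    (xi : 'I_m -> {RV P >-> S})
    (ytilde : 'I_m -> {RV P >-> measurableTypeR R})
    (mu sigma eta : R) (K : set 'cV[R]_n) (t : R) (M N : \bar R),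
  let y (w : Omega) (i : 'I_m) : R := f (xi i w) (dot (vec (a i w)) x0) in
  let yt (w : Omega) (i : 'I_m) : R := ytilde i w in
  let dt := local_dim [set sqrtSigma *m (x - mu *: x0) | x in K] t in
  let t0 (w : Omega) :=
    (sigma * Num.sqrt dt + eta) / Num.sqrt m%:R + noise_level (y w) (yt w) in
  (0 < m)%N ->
  posdef Sigma -> posdef sqrtSigma -> sqrtSigma *m sqrtSigma = Sigma ->
  norm2 (sqrtSigma *m x0) = 1 ->
  closed Y ->
  (forall s v, Y (f s v)) ->
  measurable_fun setT (fun z : measurableTypeR R * S => f z.2 z.1) ->
  (forall i, is_centered_normal (a i) Sigma) ->
  (forall i (B : set S), measurable B -> P (xi i @^-1` B) = Q B) ->
  samples_independent a xi ->
  (forall i w, Y (ytilde i w)) ->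
  convex_C2_loss Y L ->
  loss1_lipschitz Y L CL ->
  is_model_param Q f L mu sigma eta ->
  convex_set K -> K (mu *: x0) ->
  0 < t ->
  (0 < M)%E -> (0 < N)%E ->
  ((Num.max (32 * t) (c1 * `|mu|))%:E <= M)%E ->
  strongly_convex_near0 Y L M N CMN ->
  C1 * dt <= m%:R ->
  exists E : set Omega, [/\ measurable E, (p%:E <= P E)%E &
    forall w, E w ->
      (c2%:E * mean_abs_output Q f + (noise_max (y w) (yt w))%:E <= N)%E ->
      C2 * t0 w < t ->
      forall xhat : 'cV[R]_n,
        is_empirical_minimizer L K (fun i => vec (a i w)) (yt w) xhat ->
        norm2 (sqrtSigma *m (xhat - mu *: x0)) <= t]].
Proof.
have [k /andP[k0 _] kE] := @std_normal1_min_abs R.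
have [A A1 hA] := @std_normal1_expsq_fin R.
have [C C0 hC] := @std_normal1_abs_fin R.
pose B := 4 * (C + 1) / k.
have B0 : 0 < B by rewrite divr_gt0// mulr_gt0// ltr_wpDl.
exists (4 * B), (4 / k); split; [by rewrite mulr_gt0|by rewrite divr_gt0|].
move=> p /andP[p0 p1]; pose eps := 1 - p.
have eps01 : 0 < eps < 1 by rewrite /eps; apply/andP; split; lra.
have /andP[eps0 _] := eps01.
pose Lam := 98 * (1 + A + 4 / eps).
have Lam0 : 0 < Lam by rewrite mulr_gt0// ltr_wpDl ?divr_gt0//; lra.
exists (1 + (32 / (k * eps)) ^+ 2); split; first by rewrite ltr_pwDl// sqr_ge0.
move=> CMN CL CMN0 CL0.
pose theta := CMN * k ^+ 2 / 128.
have Ck0 : 0 < CMN * k ^+ 2 by rewrite mulr_gt0// exprn_gt0.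
have th0 : 0 < theta by rewrite divr_gt0.
(* The first summand is for the deviation bounds, the last for the noise; the 1 makes the latter
   inequality strict. *)
pose C2 := 4 / (eps * theta) + (1 + 32 * (CL * (1 + Lam)) / (CMN * k ^+ 2)).
have q1 : 0 < 4 / (eps * theta) by rewrite divr_gt0// mulr_gt0.
have q2 : 0 < 32 * (CL * (1 + Lam)) / (CMN * k ^+ 2).
  by rewrite divr_gt0// mulr_gt0// mulr_gt0// ltr_pwDl// ltW.
have C20 : 0 < C2 by rewrite /C2; lra.
have C2b : 4 / (eps * theta) <= C2 by rewrite /C2; lra.
have C2c : 32 * (CL * (1 + Lam)) < C2 * (CMN * k ^+ 2).
  by rewrite -ltr_pdivrMr// /C2; lra.
exists C2; split => //.
move=> m [|n] Sigma s x0 dO Omega P dS S Q Y f L a xi ytilde mu sigma eta K t M N y yt dt t0.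
  (* In dimension 0 no [x0] has whitened norm 1. *)
  by move=> _ _ _ _ /eqP; rewrite /norm2 /dot big_ord0 sqrtr0 eq_sym oner_eq0.
move=> m0 _ [sT sP] ss u1 _ Yf mf aN xiQ ind Yyt cL lipL mp cK Kx0 tp _ N0 hM scL hdm.
have [mean0 sg0 sq et0 sqs] := score_moments mp.
have mR0 : 0 < m%:R :> R by rewrite ltr0n.
have nl0 w : 0 <= noise_level (y w) (yt w) by exact: sqrtr_ge0.
have nm0 w : (0 <= (noise_max (y w) (yt w))%:E)%E.
  rewrite lee_fin /noise_max; elim/big_ind: _ => // u v u0 v0.
  by rewrite le_max u0.
have d0 : 0 <= (sigma * Num.sqrt dt + eta) / Num.sqrt m%:R.
  by rewrite divr_ge0 ?sqrtr_ge0// addr_ge0// mulr_ge0 ?sqrtr_ge0.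
(* The event must not depend on the noise, so only the noise-free parts of the two conditions are
   used to build it. If one of them fails, so does the condition at every [w]; if [K] has no point
   at distance [t], [minimizer_in_ball] applies with nothing to check. *)
have [[hN ht [x1 Kx1 nx1]]|triv] := pselect
    [/\ ((4 / k)%:E * mean_abs_output Q f <= N)%E,
      C2 * ((sigma * Num.sqrt dt + eta) / Num.sqrt m%:R) < t &
      exists2 x, K x & norm2 (s *m (x - mu *: x0)) = t]; last first.
  exists setT; split => //; first by rewrite probability_setT lee_fin ltW.
  move=> w _ hN ht xhat.
  apply: minimizer_in_ball => // [i|x Kx nx]; first by have [] := cL _ (Yyt i w).
  case: triv; split; last by exists x.
    by apply: le_trans hN; rewrite leeDl.
  by apply: le_lt_trans ht; rewrite ler_pM2l// lerDl.
have sU : s \in unitmx.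
  rewrite -row_free_unit; apply/inj_row_free => v vs.
  have [v0|v0] := eqVneq v^T 0; first by rewrite -(trmxK v) v0 trmx0.
  have sv : s *m v^T = 0 by apply: trmx_inj; rewrite trmx_mul trmxK sT vs trmx0.
  by have := sP _ v0; rewrite sv dot0r ltxx.
pose u := s *m x0.
have uu : dot u u = 1 by rewrite -sqr_norm2 u1 expr1n.
have [G0 [r [iG0 _ G0u]]] := exists_law_invariant_to_axis u.
have r1 : r * r = 1 by have := iG0 u u; rewrite G0u dot_consv dot0l addr0 uu.
(* [r] is 1 or -1; multiplying by it sends [u] to the first axis itself, so that first coordinates
   are the inner products with [x0]. *)
pose G := r *: G0.
have iG : isometry_mx G.
  by move=> v v'; rewrite -!scalemxAl dotZl dotZr mulrA r1 mul1r iG0.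
pose O := G *m invmx s.
have OS : O *m Sigma *m O^T = 1%:M.
  rewrite -ss /O trmx_mul trmx_inv sT !mulmxA mulmxKV// -!mulmxA (mulmxA s) mulmxV// mul1mx.
  by apply: mulmx1C; apply/isometry_mxP.
pose D : set 'cV[R]_n.+1 := [set s *m (x - mu *: x0) | x in K].
have D0 : D 0 by exists (mu *: x0) => //; rewrite subrr mulmx0.
pose W := local_width D t.
have W0 : 0 <= W by apply: local_width_ge0 => //; exact: ltW.
(* Only directions of norm exactly [t] are tested; their Gaussian maxima are still bounded by the
   width of the ball of radius [t]. *)
pose Dg : set 'cV[R]_n.+1 := [set h | exists2 v, D v /\ norm2 v = t & h = G *m v].
have Dg1 : Dg (G *m (s *m (x1 - mu *: x0))).
  by exists (s *m (x1 - mu *: x0)) => //; split => //; exists x1.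
have Dgt h : Dg h -> dot h h = t ^+ 2.
  by move=> [v [_ nv] ->]; rewrite iG -sqr_norm2 nv.
have DgW (hs : seq 'cV[R]_n.+1) : (forall h, h \in hs -> Dg h) ->
    (\int[std_normal n.+1]_g (gmax hs (vec g))%:E <= W%:E)%E.
  move=> hD; apply: (gmax_width (ltW tp) D0 iG) => h /hD[v [Dv nv] ->].
  by exists v => //; rewrite nv.
have A0 : 0 <= A by lra.
have [al al0 params] := deviation_parameters m0 A1 eps01 th0 k0 tp W0 sg0 et0
  (C1 := 1 + (32 / (k * eps)) ^+ 2) ltac:(by rewrite lerDl sqr_ge0)
  ltac:(by rewrite lerDr) hdm C2b ht.
have k01 b q : 0 <= kept f N B b q <= 1.
  by have [->|->] := kept_bool f N B b q; rewrite ?lexx ?ler01.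
have [E' [mE' PE' gE']] := good_event (measurable_score mu cL lipL CL0 Yf mf)
  (measurable_kept mf N B) k01 mean0 sq sqs kE (kept_mean mf k0 C0 hC N0 hN)
  A0 hA tp m0 th0 k0 W0 al0 Dg1 Dgt DgW params.
exists (whiten O a xi @^-1` E'); split.
- by rewrite -[X in measurable X]setTI; exact: measurable_whiten.
- rewrite (whiten_law aN xiQ ind OS mE'); apply: le_trans PE'.
  by rewrite lee_fin /eps opprB addrC subrK.
move=> w Ew _ hw xhat.
(* [G] and the whitening cancel in inner products, which brings the estimates back to the original
   coordinates. *)
have dotE i x : dot (sample_vec (tnth (whiten O a xi w) i)) (G *m (s *m x)) = dot (vec (a i w)) x.
  rewrite tnth_whiten /sample_vec /= unvecK /O -mulmxA iG dot_mulmxl trmx_inv sT mulKmx//.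
have headE i : sample_head (tnth (whiten O a xi w) i) = dot (vec (a i w)) x0.
  rewrite -dotE -/u /G -scalemxAl G0u sample_vecE dotZr dot_consv dot0r addr0.
  by rewrite mulrCA r1 mulr1.
apply: minimizer_in_ball => // [i|x Kx nx]; first by have [] := cL _ (Yyt i w).
have gx : Dg (G *m (s *m (x - mu *: x0))).
  by exists (s *m (x - mu *: x0)) => //; split => //; exists x.
have noise : C2 ^+ 2 * (\sum_i `|yt w i - f (tnth (whiten O a xi w) i).2
    (sample_head (tnth (whiten O a xi w) i))| ^+ 2) <= m%:R * t ^+ 2.
  have hnl : C2 * noise_level (y w) (yt w) < t.
    by apply: le_lt_trans hw; rewrite ler_pM2l// lerDr.
  have : (C2 * noise_level (y w) (yt w)) ^+ 2 <= t ^+ 2.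
    apply: lerXn2r; rewrite ?nnegrE ?(ltW tp) ?(ltW hnl)//.
    by rewrite mulr_ge0 ?(ltW C20).
  rewrite -(ler_pM2l mR0); apply: le_trans.
  rewrite exprMn sqr_sqrtr; last first.
    by rewrite mulr_ge0 ?invr_ge0 ?(ltW mR0)// sumr_ge0.
  rewrite mulrCA mulVKf ?gt_eqF//.
  rewrite le_eqVlt; apply/orP; left; apply/eqP; congr (_ * _).
  by apply: eq_bigr => i _; rewrite headE tnth_whiten.
have := good_descent cL lipL CL0 Yf CMN0 N0 scL (fun i => Yyt i w) (ltW B0) tp k0 C20 m0 hM C2c
  noise (gE' _ _ Ew gx).
congr (0 < _); apply: eq_bigr => i _.
rewrite dotE headE dotDr dotNr dotZr [_ + (_ - _)]addrC subrK//.
Qed.
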